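(* Let $\kappa>0$, $\lambda\in\mathbb C$, and let $\gamma:=\min_{m\in\{6,7\}}\operatorname{gap}(H_{[1,m]})$, $\Gamma:=\max_{m\in\{6,7\}}\|H_{[1,m]}\|$. Let $n\ge2$ be an integer such that $$g_n:=\inf_{0\le r\le5}\operatorname{gap}\big(H_{[1,3(n+1)+r]}\big)>\frac{\Gamma}{n}.$$ Then for all integers $N>n$ and $r\in\{0,1,\dots,5\}$, $$\operatorname{gap}\big(H^{\mathrm{per}}_{[1,6N+r]}\big)\ge\frac{\gamma\, n}{2\Gamma(n-1)}\Big[g_n-\frac{\Gamma}{n}\Big].$$ In particular, for any $\lambda$ with $f(|\lambda|^2)<1/3$, $$\liminf_{L\to\infty}\operatorname{gap}\big(H^{\mathrm{per}}_{[1,L]}\big)\ge\frac{\gamma}{6\Gamma}\Big(\min_{L\in\{8,9,10\}}\operatorname{gap}H_{[1,L]}\Big)\big(1-\sqrt{3f(|\lambda|^2)}\big)^2.$$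
   Context: For a finite interval $\Lambda=[a,b]\subset\mathbb Z$ let $\mathcal F_\Lambda$ be the fermionic Fock space over $\ell^2(\Lambda)$ with CAR operators $c_x,c_x^*$, $n_x=c_x^*c_x$. For $\kappa>0$, $\lambda\in\mathbb C$, $q_x=c_{x+1}c_{x+2}-\lambda c_xc_{x+3}$ and the open-boundary Hamiltonian is $H_\Lambda=\sum_{x=a}^{b-2}n_xn_{x+2}+\kappa\sum_{x=a}^{b-3}q_x^*q_x$. The periodic Hamiltonian is $H^{\mathrm{per}}_{[a,b]}=\sum_{x=a}^{b}(n_xn_{x+2}+\kappa q_x^*q_x)$ where site indices are identified cyclically, $b+k\equiv a+k-1$ for $k\in\mathbb N$. For a nonnegative self-adjoint $H$ with nontrivial kernel, $\operatorname{gap}H=\inf\{\langle\psi,H\psi\rangle:\psi\perp\ker H,\|\psi\|=1\}$. For $r\ge0$ let $\mu_\pm=(1\pm\sqrt{1+4r})/2$, $\mu=\mu_-/\mu_+$, $\alpha_k=\frac{1}{\mu_+}\frac{1-\mu^k}{1-\mu^{k+1}}$ ($k\ge1$), and for $n\ge4$, $f_n(r)=r\alpha_n\alpha_{n-2}\big(\frac{[1-\alpha_{n-1}(1+r)]^2}{1+2r}+\alpha_{n-3}\frac{r(1-\alpha_{n-1})^2}{1+r}\big)$, $f(r)=\sup_{n\ge4}f_n(r)$. *)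

(* Defs.v *)
From HB Require Import structures.
From mathcomp Require Import all_boot all_order all_algebra.
From mathcomp Require Import complex.
From mathcomp Require Import all_classical all_reals all_analysis.
Set Implicit Arguments. Unset Strict Implicit. Unset Printing Implicit Defensive.
Import Order.TTheory GRing.Theory Num.Theory.
Local Open Scope ring_scope.
Local Open Scope classical_set_scope.
Local Open Scope complex_scope.

Section Fermions.
Variable R : realType.
Local Notation C := R[i].

(* Fock space over l^2 of a chain of L sites {0,...,L-1} (the interval [1,L],
   shifted): occupation-number basis indexed by subsets of 'I_L. *)
Definition fdim (L : nat) : nat := #|{set 'I_L}|.
Definition op (L : nat) := 'M[C]_(fdim L).
Definition vec (L : nat) := 'cV[C]_(fdim L).

Definition cfg (L : nat) (i : 'I_(fdim L)) : {set 'I_L} := enum_val i.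

Definition adj (m n : nat) (A : 'M[C]_(m, n)) : 'M[C]_(n, m) :=
  \matrix_(i, j) conjc (A j i).

(* annihilation operator c_x (site x taken mod L, i.e. cyclically),
   with the Jordan-Wigner sign:
   c_x |S> = (-1)^{#{y in S | y < x}} |S \ {x}> if x in S, 0 otherwise. *)
Definition cop (L x : nat) : op L :=
  \matrix_(i, j)
    let T := @cfg L i in let S := @cfg L j in
    if [exists k in S, val k == (x %% L)%N] && (T == [set k in S | val k != (x %% L)%N])
    then (-1) ^+ #|[set k in S | (val k < x %% L)%N]| else 0.

Definition nop (L x : nat) : op L := adj (cop L x) *m cop L x.

Definition qop (L : nat) (lam : C) (x : nat) : op L :=
  cop L x.+1 *m cop L x.+2 - lam *: (cop L x *m cop L x.+3).

Definition Hopen (kappa : R) (lam : C) (L : nat) : op L :=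
  \sum_(0 <= x < L - 2) (nop L x *m nop L (x + 2))
  + kappa%:C *: \sum_(0 <= x < L - 3) (adj (qop L lam x) *m qop L lam x).

(* periodic Hamiltonian H^per_[1,L]: sites identified cyclically mod L *)
Definition Hper (kappa : R) (lam : C) (L : nat) : op L :=
  \sum_(0 <= x < L)
    (nop L x *m nop L (x + 2) + kappa%:C *: (adj (qop L lam x) *m qop L lam x)).

Definition inner (L : nat) (u v : vec L) : C := (adj u *m v) 0 0.

Definition gap (L : nat) (H : op L) : R :=
  inf [set r : R | exists psi : vec L,
         [/\ inner psi psi = 1,
             (forall v : vec L, H *m v = 0 -> inner v psi = 0) &
             inner psi (H *m psi) = r%:C]].

Definition opnorm (L : nat) (H : op L) : R :=
  sup [set r : R | exists psi : vec L,
         [/\ inner psi psi = 1, 0 <= r & inner (H *m psi) (H *m psi) = (r ^+ 2)%:C]].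

Definition mup (r : R) : R := (1 + Num.sqrt (1 + 4 * r)) / 2.
Definition mum (r : R) : R := (1 - Num.sqrt (1 + 4 * r)) / 2.
Definition mu (r : R) : R := mum r / mup r.
Definition alpha (r : R) (k : nat) : R :=
  (mup r)^-1 * ((1 - mu r ^+ k) / (1 - mu r ^+ k.+1)).
Definition fn (n : nat) (r : R) : R :=
  r * alpha r n * alpha r (n - 2) *
  ((1 - alpha r (n - 1) * (1 + r)) ^+ 2 / (1 + 2 * r)
   + alpha r (n - 3) * (r * (1 - alpha r (n - 1)) ^+ 2 / (1 + r))).
Definition f (r : R) : R := sup [set fn n r | n in [set n : nat | (4 <= n)%N]].

End Fermions.

(* Main.v *)
Require Import Defs.
From HB Require Import structures.
From mathcomp Require Import all_boot all_order all_algebra.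
From mathcomp Require Import complex.
From mathcomp Require Import all_classical all_reals all_analysis.
From mathcomp Require Import ring lra zify.
From mathcomp Require Import finset.

(** Kernel states.  On an interval of at least 8 sites, a zero-energy state is supported on the
    configurations free of a few patterns, and the relation [q_x psi = 0] ties the amplitudes of
    two neighbouring monomers and of the dimer that replaces them.  Norms in a sector whose last
    chain has [m] monomers follow [beta_{k+2} = beta_{k+1} + |lam|^2 beta_k], and the overlap of
    a kernel state of the longer interval complement with the kernel projection of the shifted
    9-site window is there exactly [f_m (|lam|^2)], uniformly bounded by [f (|lam|^2)].

    Open gap.  The martingale method with windows that advance by 3 sites turns this overlap
    bound into [gap H_L >= m0 / 3 * (1 - sqrt (3 f))^2] for [L >= 8].

    Periodic gap.  The ring is cut into overlapping blocks of 6 or 7 sites.  Each block is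
    compared with the projection onto the complement of its kernel (up to the factors [gamma]
    and [Gamma]); only adjacent projections fail to commute, so Knabe's argument bounds the
    square of their sum from below by the gaps of the chains of [n] blocks. *)

Set Implicit Arguments. Unset Strict Implicit. Unset Printing Implicit Defensive.
Import Order.TTheory GRing.Theory Num.Theory.
Local Open Scope ring_scope.
Local Open Scope complex_scope.

(** Because of the Jordan-Wigner signs the Fock space of an interval is not translation invariant as
    it stands. Local gaps and norms are therefore transported through eigenvalues alone: a rotation
    of the ring with a compensating sign moves the interval to the origin, where no string sees the
    outside sites and their occupation can be frozen.

    In the overlap bound, a state x in the kernel on the first e sites obeys the move relation only
    for moves inside those sites. Testing its orthogonality to the kernel on e + 3 sites against a
    state built from x itself fixes the one missing ratio. The bound is kept in the form 2 Re<y,x>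
    <= |y|^2 + f |x|^2, which adds up over configurations, and which becomes |y|^2 <= f |x|^2 when y
    is the projection of x. The case lam = 0, where no amplitude can be carried back along a move,
    is treated apart.

    The two threes in the open gap have different origins: a window projection couples at most three
    consecutive increments of the kernel projections, whence sqrt (3 f), and an interaction term
    lies in at most three windows, whence the division by 3. *)

Section HermitianForms.
Variable R : realType.
Local Notation C := R[i].

(** * Hermitian forms and their spectral decomposition *)

Definition dot (n : nat) (u v : 'cV[C]_n) : C := (adj u *m v) 0 0.
Definition rdot (n : nat) (u v : 'cV[C]_n) : R := complex.Re (dot u v).

Lemma adjE m n (A : 'M[C]_(m, n)) : adj A = (map_mx Num.conj A^T).
Proof. by apply/matrixP=> i j; rewrite !mxE. Qed.

Lemma adjK m n (A : 'M[C]_(m, n)) : adj (adj A) = A.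
Proof. by apply/matrixP=> i j; rewrite !mxE conjcK. Qed.

Lemma adjM m n p (A : 'M[C]_(m, n)) (B : 'M[C]_(n, p)) :
  adj (A *m B) = adj B *m adj A.
Proof. by rewrite !adjE trmx_mul map_mxM. Qed.

Lemma adjD m n (A B : 'M[C]_(m, n)) : adj (A + B) = adj A + adj B.
Proof. by rewrite !adjE linearD /= map_mxD. Qed.

Lemma adjN m n (A : 'M[C]_(m, n)) : adj (- A) = - adj A.
Proof. by rewrite !adjE linearN /= map_mxN. Qed.

Lemma adj0 m n : adj (0 : 'M[C]_(m, n)) = 0.
Proof. by rewrite !adjE trmx0 map_mx0. Qed.

Lemma adjZ m n (c : C) (A : 'M[C]_(m, n)) : adj (c *: A) = Num.conj c *: adj A.
Proof. by apply/matrixP=> i j; rewrite !mxE rmorphM. Qed.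

Lemma adjZR m n (c : R) (A : 'M[C]_(m, n)) : adj (c%:C *: A) = c%:C *: adj A.
Proof. by rewrite adjZ; congr (_ *: _); exact: conjc_real. Qed.

Lemma adj1 n : adj (1%:M : 'M[C]_n) = 1%:M.
Proof. by rewrite adjE trmx1 map_mx1. Qed.

Lemma adj_sum m n I (r : seq I) (P : pred I) (F : I -> 'M[C]_(m, n)) :
  adj (\sum_(i <- r | P i) F i) = \sum_(i <- r | P i) adj (F i).
Proof. by elim/big_rec2: _ => [|i x y _ <-]; rewrite ?adj0 ?adjD. Qed.

Lemma dot_adj m n (A : 'M[C]_(m, n)) u v : dot (A *m u) v = dot u (adj A *m v).
Proof. by rewrite /dot adjM mulmxA. Qed.

Lemma rdot_adj m n (A : 'M[C]_(m, n)) u v : rdot (A *m u) v = rdot u (adj A *m v).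
Proof. by rewrite /rdot dot_adj. Qed.

Lemma dotE n (u v : 'cV[C]_n) : dot u v = \sum_i Num.conj (u i 0) * v i 0.
Proof. by rewrite /dot mxE; apply: eq_bigr => i _; rewrite mxE. Qed.

Lemma dotC n (u v : 'cV[C]_n) : dot u v = Num.conj (dot v u).
Proof.
rewrite !dotE rmorph_sum; apply: eq_bigr => i _.
by rewrite rmorphM /= conjCK mulrC.
Qed.

Lemma rdotC n (u v : 'cV[C]_n) : rdot u v = rdot v u.
Proof. by rewrite /rdot dotC; case: (dot v u). Qed.

Lemma ReD (x y : C) : complex.Re (x + y) = complex.Re x + complex.Re y.
Proof. by case: x y => a b [c d]. Qed.

Lemma ReN (x : C) : complex.Re (- x) = - complex.Re x.
Proof. by case: x. Qed.

Lemma ReZ (c : R) (x : C) : complex.Re (c%:C * x) = c * complex.Re x.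
Proof. by case: x => a b /=; rewrite mul0r subr0. Qed.

Lemma Re_sum I (r : seq I) (P : pred I) (F : I -> C) :
  complex.Re (\sum_(i <- r | P i) F i) = \sum_(i <- r | P i) complex.Re (F i).
Proof. by elim/big_rec2: _ => [//|i x y _ <-]; rewrite ReD. Qed.

Lemma rdotDr n (u v w : 'cV[C]_n) : rdot u (v + w) = rdot u v + rdot u w.
Proof. by rewrite /rdot /dot mulmxDr mxE ReD. Qed.

Lemma rdotNr n (u v : 'cV[C]_n) : rdot u (- v) = - rdot u v.
Proof. by rewrite /rdot /dot mulmxN mxE ReN. Qed.

Lemma rdotZr n c (u v : 'cV[C]_n) : rdot u (c%:C *: v) = c * rdot u v.
Proof. by rewrite /rdot /dot -scalemxAr mxE ReZ. Qed.

Lemma rdotBr n (u v w : 'cV[C]_n) : rdot u (v - w) = rdot u v - rdot u w.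
Proof. by rewrite rdotDr rdotNr. Qed.

Lemma rdot0r n (u : 'cV[C]_n) : rdot u 0 = 0.
Proof. by rewrite /rdot /dot mulmx0 mxE. Qed.

Lemma rdotDl n (u v w : 'cV[C]_n) : rdot (u + v) w = rdot u w + rdot v w.
Proof. by rewrite rdotC rdotDr ![rdot w _]rdotC. Qed.

Lemma rdotNl n (u v : 'cV[C]_n) : rdot (- u) v = - rdot u v.
Proof. by rewrite rdotC rdotNr rdotC. Qed.

Lemma rdotZl n c (u v : 'cV[C]_n) : rdot (c%:C *: u) v = c * rdot u v.
Proof. by rewrite rdotC rdotZr rdotC. Qed.

Lemma rdotBl n (u v w : 'cV[C]_n) : rdot (u - v) w = rdot u w - rdot v w.
Proof. by rewrite rdotDl rdotNl. Qed.

Lemma rdot_sumr n I (r : seq I) (P : pred I) u (F : I -> 'cV[C]_n) :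
  rdot u (\sum_(i <- r | P i) F i) = \sum_(i <- r | P i) rdot u (F i).
Proof. by elim/big_rec2: _ => [|i x y _ <-]; rewrite ?rdot0r ?rdotDr. Qed.

Lemma rdot_suml n I (r : seq I) (P : pred I) u (F : I -> 'cV[C]_n) :
  rdot (\sum_(i <- r | P i) F i) u = \sum_(i <- r | P i) rdot (F i) u.
Proof. by rewrite rdotC rdot_sumr; apply: eq_bigr => i _; rewrite rdotC. Qed.

Definition sqmod (z : C) : R := complex.Re z ^+ 2 + complex.Im z ^+ 2.

Lemma sqmodE z : Num.conj z * z = (sqmod z)%:C.
Proof.
case: z => a b; apply/eqP; rewrite eq_complex /= /sqmod /=.
by apply/andP; split; apply/eqP; ring.
Qed.

Lemma sqmod_ge0 z : 0 <= sqmod z.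
Proof. by rewrite addr_ge0 ?sqr_ge0. Qed.

Lemma sqmod_eq0 z : (sqmod z == 0) = (z == 0).
Proof.
case: z => a b; rewrite /sqmod /= eq_complex /= paddr_eq0 ?sqr_ge0 //.
by rewrite !sqrf_eq0.
Qed.

Lemma sqmodM z w : sqmod (z * w) = sqmod z * sqmod w.
Proof. by case: z w => a b [c d]; rewrite /sqmod /=; ring. Qed.

Lemma real_complex_sum I (r : seq I) (P : pred I) (F : I -> R) :
  (\sum_(i <- r | P i) F i)%:C = \sum_(i <- r | P i) (F i)%:C.
Proof. by rewrite rmorph_sum. Qed.

Lemma dot_self n (u : 'cV[C]_n) : dot u u = (rdot u u)%:C.
Proof.
rewrite /rdot dotE; under eq_bigr => i _ do rewrite sqmodE.
by rewrite -real_complex_sum.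
Qed.

Lemma rdot_selfE n (u : 'cV[C]_n) : rdot u u = \sum_i sqmod (u i 0).
Proof.
rewrite /rdot dotE Re_sum; apply: eq_bigr => i _; by rewrite sqmodE.
Qed.

Lemma rdot_ge0 n (u : 'cV[C]_n) : 0 <= rdot u u.
Proof. by rewrite rdot_selfE sumr_ge0 // => i _; exact: sqmod_ge0. Qed.

Lemma rdot_eq0 n (u : 'cV[C]_n) : rdot u u = 0 -> u = 0.
Proof.
rewrite rdot_selfE => /eqP; rewrite psumr_eq0; last by move=> i _; exact: sqmod_ge0.
move=> /allP h; apply/matrixP=> i j; rewrite ord1 mxE; apply/eqP.
by rewrite -sqmod_eq0; apply: h; rewrite mem_index_enum.
Qed.

(** This is |c u - v|^2 >= 0 divided by [c]. *)
Lemma rdot_amgm n (c : R) (u v : 'cV[C]_n) : 0 < c ->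
  2 * rdot u v <= c * rdot u u + c^-1 * rdot v v.
Proof.
move=> c0; have := rdot_ge0 (c%:C *: u - v).
rewrite rdotBl !rdotBr !rdotZl !rdotZr (rdotC v u) => h.
rewrite -(ler_pM2l c0) mulrDr [c * (c^-1 * _)]mulrA mulfV ?gt_eqF // mul1r.
by lra.
Qed.

Definition herm n (A : 'M[C]_n) := adj A = A.
Definition psd n (A : 'M[C]_n) := forall v, 0 <= rdot v (A *m v).
Definition orthker n (A : 'M[C]_n) (v : 'cV[C]_n) :=
  forall w, A *m w = 0 -> dot w v = 0.
(** A gap bound stated without an infimum. For the zero operator every [c] qualifies, whereas [gap]
    is then the infimum of an empty set. *)
Definition gapge n (A : 'M[C]_n) (c : R) :=
  forall v, orthker A v -> c * rdot v v <= rdot v (A *m v).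
Definition eigv n (A : 'M[C]_n) (mu : R) :=
  exists2 v : 'cV[C]_n, v != 0 & A *m v = mu%:C *: v.

Lemma herm_dot_real n (A : 'M[C]_n) v : herm A -> dot v (A *m v) = (rdot v (A *m v))%:C.
Proof.
move=> hA; have : dot v (A *m v) = Num.conj (dot v (A *m v)).
  by rewrite -dotC dot_adj hA.
rewrite /rdot; case: (dot _ _) => a b /= [] h.
by apply/eqP; rewrite eq_complex /= eqxx /=; apply/eqP; lra.
Qed.

Lemma herm_spectral n (A : 'M[C]_n) : herm A ->
  exists U : 'M[C]_n, exists d : 'I_n -> R,
   [/\ adj U *m U = 1%:M, U *m adj U = 1%:M &
      A = adj U *m diag_mx (\row_i (d i)%:C) *m U].
Proof.
move=> hA.
have hs : A \is hermsymmx.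
  by apply/is_hermitianmxP; rewrite expr0 scale1r -[LHS]hA adjE.
have /orthomx_spectralP eA := hermitian_normalmx hs.
have hr := hermitian_spectral_diag_real hs.
have hU := spectral_unitarymx A.
have eU : invmx (spectralmx A) = adj (spectralmx A) by rewrite invmx_unitary // adjE.
exists (spectralmx A), (fun i => complex.Re (spectral_diag A 0 i)); split.
- by rewrite -eU mulVmx // spectral_unit.
- by rewrite -eU mulmxV // spectral_unit.
rewrite [LHS]eA eU; congr (_ *m diag_mx _ *m _); apply/matrixP => i j.
by rewrite ord1 mxE RRe_real //; move/mxOverP: hr; apply.
Qed.

Section Spectral.
Variables (n : nat) (A : 'M[C]_n) (hA : herm A).

Lemma eigenbasis : exists (U : 'M[C]_n) (d : 'I_n -> R),
  [/\ adj U *m U = 1%:M, U *m adj U = 1%:M,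
      forall (v : 'cV[C]_n) i, (U *m (A *m v)) i 0 = (d i)%:C * (U *m v) i 0 &
      forall i, eigv A (d i)].
Proof.
have [U [d [h1 h2 e]]] := herm_spectral hA.
have e1 (v : 'cV[C]_n) i : (U *m (A *m v)) i 0 = (d i)%:C * (U *m v) i 0.
  by rewrite e !mulmxA h2 mul1mx -mulmxA mul_diag_mx !mxE.
exists U, d; split => // i.
exists (adj U *m delta_mx i 0).
  apply/eqP => /(congr1 (mulmx U)); rewrite mulmxA h2 mul1mx mulmx0 => /matrixP/(_ i 0).
  by rewrite !mxE !eqxx => /eqP; rewrite oner_eq0.
rewrite e -!mulmxA [U *m _]mulmxA h2 mul1mx scalemxAr; congr (_ *m _).
apply/matrixP=> k j; rewrite mul_diag_mx !mxE.
by case: eqP => [->|_] /=; rewrite ?mulr0.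
Qed.

Lemma rdot_unitary (U : 'M[C]_n) (u v : 'cV[C]_n) : adj U *m U = 1%:M ->
  rdot (U *m u) (U *m v) = rdot u v.
Proof. by move=> h; rewrite rdot_adj mulmxA h mul1mx. Qed.

(** [w v i] is the squared modulus of the component of [v] along the i-th eigenvector, so that
    inequalities between forms in [A] reduce to termwise inequalities between eigenvalues. *)
Lemma spectral_forms : exists (w : 'cV[C]_n -> 'I_n -> R) (d : 'I_n -> R),
  [/\ forall v i, 0 <= w v i, forall i, eigv A (d i),
     forall v, rdot v v = \sum_i w v i,
     forall v, rdot v (A *m v) = \sum_i d i * w v i &
     forall v, rdot (A *m v) (A *m v) = \sum_i d i ^+ 2 * w v i] /\
  (forall v, orthker A v -> forall i, d i = 0 -> w v i = 0).
Proof.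
have [U [d [h1 h2 e1 e2]]] := eigenbasis.
exists (fun v i => sqmod ((U *m v) i 0)), d; split.
  split => // [v i|v|v|v]; first exact: sqmod_ge0.
  - by rewrite -(rdot_unitary _ _ h1) rdot_selfE.
  - rewrite -(rdot_unitary _ _ h1) /rdot dotE Re_sum; apply: eq_bigr => i _.
    by rewrite e1 mulrCA sqmodE ReZ.
  - rewrite -(rdot_unitary _ _ h1) rdot_selfE; apply: eq_bigr => i _.
    by rewrite e1 sqmodM /sqmod /= expr0n /= addr0.
move=> v hv i di.
(* The i-th eigenvector lies in the kernel when [d i = 0], hence is an admissible test vector. *)
have := hv (adj U *m delta_mx i 0).
have -> : A *m (adj U *m (delta_mx i 0 : 'cV[C]_n)) = 0.
  have : U *m (A *m (adj U *m (delta_mx i 0 : 'cV[C]_n))) = 0.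
    apply/matrixP=> a b; rewrite ord1 e1 mulmxA h2 mul1mx !mxE.
    by case: eqP => [->|_] /=; rewrite ?mulr0 ?di ?mul0r.
  by move/(congr1 (mulmx (adj U))); rewrite mulmxA h1 mul1mx mulmx0.
move=> /(_ erefl); rewrite dot_adj adjK dotE (bigD1 i) //= big1 => [|j /negPf ji].
  by rewrite !mxE !eqxx conjC_nat mul1r addr0 => ->; rewrite /sqmod /= expr0n /= addr0.
by rewrite !mxE ji conjC_nat mul0r.
Qed.

Lemma kernel_projection : exists P : 'M[C]_n,
  [/\ herm P, P *m P = P, A *m P = 0 & forall v : 'cV[C]_n, A *m v = 0 -> P *m v = v].
Proof.
have [U [d [h1 h2 e1 e2]]] := eigenbasis.
pose D : 'M[C]_n := diag_mx (\row_i (d i == 0)%:R).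
have aD : adj D = D.
  apply/matrixP=> i j; rewrite !mxE; case: (eqVneq i j) => [->|ij].
    by rewrite !mulr1n; exact: conjc_nat.
  by rewrite !mulr0n; exact: conjc0.
exists (adj U *m D *m U); split.
- by rewrite /herm !adjM adjK aD mulmxA.
- rewrite -!mulmxA; congr (_ *m _); rewrite [U *m (_ *m _)]mulmxA h2 mul1mx mulmxA.
  congr (_ *m _); apply/matrixP=> i j; rewrite mul_diag_mx !mxE.
  by case: (i =P j) => [->|_] /=; rewrite ?mulr0n ?mulr0 // mulr1n; case: (d j == 0); rewrite ?mulr1 ?mulr0.
- have : forall v : 'cV[C]_n, A *m (adj U *m D *m U *m v) = 0.
    move=> v.
    have : U *m (A *m (adj U *m D *m U *m v)) = 0.
      apply/matrixP=> i j; rewrite ord1 e1 -!mulmxA (mulmxA U) h2 mul1mx mul_diag_mx !mxE.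
      by case: (d i =P 0) => [->|_]; rewrite ?mul0r ?mulr0.
    by move/(congr1 (mulmx (adj U))); rewrite mulmxA h1 mul1mx mulmx0.
  move=> h; apply/matrixP=> i j.
  have /matrixP/(_ i 0) := h (delta_mx j 0).
  by rewrite mulmxA -colE !mxE.
move=> v hv; rewrite -[RHS]mul1mx -h1 -!mulmxA; congr (_ *m _).
apply/matrixP=> i j; rewrite ord1 mul_diag_mx 2!mxE.
have := e1 v i; rewrite hv mulmx0 mxE => /esym/eqP.
rewrite mulf_eq0 => /orP[|/eqP ->]; last by rewrite mulr0.
by rewrite eq_complex /= eqxx andbT => ->; rewrite mul1r.
Qed.

Lemma orthker_eig v (mu : R) : mu != 0 -> A *m v = mu%:C *: v -> orthker A v.
Proof.
move=> m0 e w hw.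
have : dot w (A *m v) = 0 by rewrite -{1}hA -dot_adj hw /dot adj0 mul0mx mxE.
rewrite e /dot -scalemxAr mxE => /eqP; rewrite mulf_eq0 => /orP[|/eqP//].
by rewrite eq_complex /= (negPf m0).
Qed.

Lemma gapge_eig c : gapge A c -> forall mu, eigv A mu -> mu = 0 \/ c <= mu.
Proof.
move=> hc mu [v v0 e]; case: (eqVneq mu 0) => [->|m0]; [by left | right].
have := hc v (orthker_eig m0 e); rewrite e rdotZr ler_pM2r //.
by rewrite lt_neqAle rdot_ge0 andbT eq_sym; apply: contra v0 => /eqP/rdot_eq0 ->.
Qed.

Lemma eig_gapge c : (forall mu, eigv A mu -> mu = 0 \/ c <= mu) -> gapge A c.
Proof.
move=> h v hv; have [w [d [[w0 e n1 n2 _] k]]] := spectral_forms.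
rewrite n1 n2 mulr_sumr; apply: ler_sum => i _.
case: (h _ (e i)) => [z|le]; first by rewrite (k v hv i z) !mulr0.
exact: ler_wpM2r.
Qed.

(** Every eigenvalue is zero or at least [c], and then c mu <= mu^2 can only fail for a negative
    mu. *)
Lemma gapge_sq c v : gapge A c -> c * rdot v (A *m v) <= rdot (A *m v) (A *m v) \/
  exists2 mu, eigv A mu & mu < 0.
Proof.
move=> /gapge_eig h; have [w [d [[w0 e _ n2 n3] k]]] := spectral_forms.
case: (pselect (exists2 mu, eigv A mu & mu < 0)) => [?|np]; [by right|left].
rewrite n2 n3 mulr_sumr; apply: ler_sum => i _.
rewrite mulrA; apply: ler_wpM2r => //.
have d0 : 0 <= d i by rewrite leNgt; apply/negP => d0; apply: np; exists (d i).
case: (h _ (e i)) => [->|le]; first by rewrite mulr0 expr0n.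
by rewrite expr2; apply: ler_wpM2r.
Qed.

Lemma psd_eig : psd A -> forall mu, eigv A mu -> 0 <= mu.
Proof.
move=> hp mu [v v0 e]; have := hp v; rewrite e rdotZr.
rewrite pmulr_lge0 //.
by rewrite lt_neqAle rdot_ge0 andbT eq_sym; apply: contra v0 => /eqP/rdot_eq0 ->.
Qed.

Lemma psd_gapge_sq c v : psd A -> gapge A c ->
  c * rdot v (A *m v) <= rdot (A *m v) (A *m v).
Proof. by move=> /psd_eig hp /gapge_sq-/(_ v)[//|[mu /hp]]; case: ltP. Qed.

Lemma psd_ker v : psd A -> rdot v (A *m v) = 0 -> A *m v = 0.
Proof.
move=> /psd_eig hp; have [w [d [[w0 e n1 n2 n3] k]]] := spectral_forms.
rewrite n2 => /eqP; rewrite psumr_eq0 => [/allP h|i _]; last first.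
  by rewrite mulr_ge0 // hp.
apply: rdot_eq0; rewrite n3; apply: big1 => i _.
have /eqP := h i (mem_index_enum _); rewrite expr2 -mulrA => ->.
by rewrite mulr0.
Qed.

Lemma eig_le_form G v : (forall mu, eigv A mu -> mu <= G) -> rdot v (A *m v) <= G * rdot v v.
Proof.
move=> h; have [w [d [[w0 e n1 n2 n3] k]]] := spectral_forms.
by rewrite n1 n2 mulr_sumr; apply: ler_sum => i _; apply: ler_wpM2r => //; apply: h.
Qed.

Lemma form_bounded : exists B : R, 0 <= B /\ forall v, rdot (A *m v) (A *m v) <= B * rdot v v.
Proof.
have [w [d [[w0 e n1 n2 n3] k]]] := spectral_forms.
exists (\sum_i d i ^+ 2); split; first by apply: sumr_ge0 => i _; exact: sqr_ge0.
move=> v; rewrite n3 n1 mulr_sumr; apply: ler_sum => i _.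
apply: ler_wpM2r => //; rewrite (bigD1 i) //= lerDl.
by apply: sumr_ge0 => j _; exact: sqr_ge0.
Qed.

End Spectral.

(** The orthogonal projection onto the kernel, chosen from its existence; the default 0 makes it
    total, and [kerpP] gives its properties for Hermitian [A]. *)
Definition kerp n (A : 'M[C]_n) : 'M[C]_n :=
  if pselect (exists P : 'M[C]_n,
  [/\ herm P, P *m P = P, A *m P = 0 & forall v : 'cV[C]_n, A *m v = 0 -> P *m v = v])
  is left h then projT1 (cid h) else 0.

Lemma kerpP n (A : 'M[C]_n) : herm A ->
  [/\ herm (kerp A), kerp A *m kerp A = kerp A, A *m kerp A = 0 &
    forall v : 'cV[C]_n, A *m v = 0 -> kerp A *m v = v].
Proof.
move=> /kernel_projection h; rewrite /kerp; case: pselect => [h'|//].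
by case: cid.
Qed.

End HermitianForms.

(** * Projections onto kernels *)

Section KernelProjections.
Variable R : realType.
Local Notation C := R[i].

Lemma mulmx_ext m n (A B : 'M[C]_(m, n)) : (forall v : 'cV[C]_n, A *m v = B *m v) -> A = B.
Proof.
move=> h; apply/matrixP=> i j; have /matrixP/(_ i 0) := h (delta_mx j 0).
by rewrite -!colE !mxE.
Qed.

Section Herm.
Variables (n : nat) (A : 'M[C]_n) (hA : herm A).
Implicit Types (v w : 'cV[C]_n).

Lemma rdot_herm u v : rdot (A *m u) v = rdot u (A *m v).
Proof. by rewrite rdot_adj hA. Qed.

Lemma rdot_proj v : A *m A = A -> rdot (A *m v) (A *m v) = rdot v (A *m v).
Proof. by move=> h; rewrite rdot_herm mulmxA h. Qed.

Lemma herm_kerp : herm (kerp A). Proof. by case: (kerpP hA). Qed.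
Lemma kerp_idem : kerp A *m kerp A = kerp A. Proof. by case: (kerpP hA). Qed.
Lemma mul_kerp : A *m kerp A = 0. Proof. by case: (kerpP hA). Qed.
Lemma kerp_id v : A *m v = 0 -> kerp A *m v = v. Proof. by case: (kerpP hA) => _ _ _; apply. Qed.

Lemma kerp_mul : kerp A *m A = 0.
Proof. by rewrite -{2}hA -herm_kerp -adjM mul_kerp adj0. Qed.

Lemma kerp_ker v : kerp A *m v = v -> A *m v = 0.
Proof. by move=> <-; rewrite mulmxA mul_kerp mul0mx. Qed.

Lemma orthkerE v : orthker A v <-> kerp A *m v = 0.
Proof.
split=> [h|h w /kerp_id <-]; last first.
  by rewrite dot_adj herm_kerp h /dot mulmx0 mxE.
apply: rdot_eq0; rewrite /rdot dot_adj herm_kerp mulmxA kerp_idem.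
have := h (kerp A *m v); rewrite mulmxA mul_kerp mul0mx => /(_ erefl).
by rewrite dot_adj herm_kerp => ->.
Qed.

(** The operator inequality c (1 - P) <= A, with P the kernel projection: the gap is applied to v -
    P v. *)
Lemma gapge_form c v : gapge A c ->
  c * (rdot v v - rdot v (kerp A *m v)) <= rdot v (A *m v).
Proof.
move=> h; have : orthker A (v - kerp A *m v).
  by apply/orthkerE; rewrite mulmxBr mulmxA kerp_idem subrr.
move/h; rewrite mulmxBr !rdotBl !rdotBr mulmxA mul_kerp mul0mx !rdot0r !subr0.
rewrite !(rdot_adj (kerp A)) herm_kerp !mulmxA kerp_mul kerp_idem mul0mx rdot0r.
by rewrite subrr !subr0.
Qed.

Lemma form_le_kerp G v : (forall mu, eigv A mu -> mu <= G) ->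
  rdot v (A *m v) <= G * (rdot v v - rdot v (kerp A *m v)).
Proof.
move=> hG; have := eig_le_form hA (v - kerp A *m v) hG.
rewrite mulmxBr !rdotBl !rdotBr mulmxA mul_kerp mul0mx !rdot0r !subr0.
rewrite !(rdot_adj (kerp A)) herm_kerp !mulmxA kerp_mul kerp_idem mul0mx rdot0r.
by rewrite subrr !subr0.
Qed.

(** An operator commuting with [A] preserves its kernel, so P B P = B P; the adjoint of this
    identity gives P B P = P B. *)
Lemma kerp_comm (B : 'M[C]_n) : herm B -> A *m B = B *m A ->
  kerp A *m B = B *m kerp A.
Proof.
move=> hB e.
have h : kerp A *m B *m kerp A = B *m kerp A.
  apply: mulmx_ext => v; rewrite -!mulmxA; apply: kerp_id.
  by rewrite !mulmxA e -(mulmxA B) mul_kerp mulmx0 mul0mx.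
rewrite -[RHS]h -[LHS]adjK adjM hB herm_kerp -[X in adj X]h.
by rewrite !adjM hB herm_kerp mulmxA.
Qed.

(** The way a gap is read off from Knabe's inequality: on an eigenvector, c mu <= mu^2 forces mu = 0
    or mu >= c. *)
Lemma sq_gapge c : psd A ->
  (forall v, c * rdot v (A *m v) <= rdot (A *m v) (A *m v)) -> gapge A c.
Proof.
move=> hp h; apply: eig_gapge => // mu hmu; case: (eqVneq mu 0) => [->|m0]; [by left|right].
have mu0 : 0 < mu by rewrite lt_neqAle eq_sym m0 (psd_eig hp hmu).
case: hmu => v v0 e; have := h v; rewrite e rdotZl !rdotZr !mulrA.
have v1 : 0 < rdot v v.
  by rewrite lt_neqAle rdot_ge0 andbT eq_sym; apply: contra v0 => /eqP/rdot_eq0 ->.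
by rewrite !ler_pM2r.
Qed.

End Herm.

Lemma kerp_comm2 n (A B : 'M[C]_n) : herm A -> herm B -> A *m B = B *m A ->
  kerp A *m kerp B = kerp B *m kerp A.
Proof.
move=> hA hB e; apply/esym; apply: kerp_comm => //; first exact: herm_kerp.
by apply/esym; apply: kerp_comm.
Qed.

End KernelProjections.

(** * The martingale method, abstractly *)

Section Martingale.
Variable R : realType.
Local Notation C := R[i].
Variables (n N : nat) (h g G : nat -> 'M[C]_n) (gam eps s : R).
Hypotheses (hG : forall k, (k <= N)%N -> herm (G k))
  (GG : forall j k, (j <= k <= N)%N -> G j *m G k = G k)
  (G0 : G 0 = 1%:M)
  (hg : forall k, (k < N)%N -> herm (g k)) (gg : forall k, (k < N)%N -> g k *m g k = g k)
  (gG : forall k m, (k < m <= N)%N -> g k *m G m = G m)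
  (gGC : forall k m, (k < N)%N -> (m + 2 <= k)%N -> g k *m G m = G m *m g k)
  (overlap : forall k (v : 'cV[C]_n), (k < N)%N ->
     let x := (G k - G k.+1) *m v in rdot (g k *m x) (g k *m x) <= eps ^+ 2 * rdot x x)
  (hform : forall k (v : 'cV[C]_n), (k < N)%N ->
     gam * (rdot v v - rdot v (g k *m v)) <= rdot v (h k *m v))
  (gam0 : 0 <= gam) (s0 : 0 < s) (s2 : s ^+ 2 = 3) (eps0 : 0 < eps) (es1 : eps * s < 1).
Variable v : 'cV[C]_n.
Hypothesis Gv : G N *m v = 0.

Let GGl j k : (j <= k <= N)%N -> G k *m G j = G k.
Proof.
move=> jk; have := congr1 (@adj _ _ _) (GG jk); rewrite adjM !hG //; lia.
Qed.

(** The martingale increments: mutually orthogonal projections that resolve [v], since [G 0] is the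
    identity and [G N] kills [v]. *)
Let E k := G k - G k.+1.
Let x k := E k *m v.

Let hE k : (k < N)%N -> herm (E k).
Proof. by move=> kN; rewrite /herm adjD adjN !hG // ltnW. Qed.

Let EE j k : (j < N)%N -> (k < N)%N -> E j *m E k = if j == k then E k else 0.
Proof.
move=> jN kN; rewrite /E mulmxBl !mulmxBr; case: ltngtP => jk.
- by rewrite !GG ?subrr //; lia.
- by rewrite !GGl ?subrr //; lia.
rewrite jk (@GGl k k.+1) ?(@GG k k) ?(@GG k k.+1) ?(@GG k.+1 k.+1) ?leqnn ?leqnSn //; last lia.
by rewrite subrr subr0.
Qed.

Let rxx j k w : (j < N)%N -> (k < N)%N -> j != k -> rdot (E j *m w) (x k) = 0.
Proof.
move=> jN kN /negPf jk.
by rewrite rdot_herm ?mulmxA; [rewrite EE // jk mul0mx rdot0r | exact: hE].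
Qed.

Let sumx M : (M <= N)%N -> \sum_(0 <= k < M) x k = v - G M *m v.
Proof.
elim: M => [|M IH] MN; first by rewrite big_nil G0 mul1mx subrr.
rewrite big_nat_recr //= IH; last exact: ltnW.
by rewrite /x /E mulmxBl addrA subrK.
Qed.

Let vE : v = \sum_(0 <= k < N) x k.
Proof. by rewrite sumx // Gv subr0. Qed.

Let rvx k : (k < N)%N -> rdot v (x k) = rdot (x k) (x k).
Proof.
by move=> kN; rewrite rdot_herm ?mulmxA; [rewrite EE // eqxx | exact: hE].
Qed.

Let y k := \sum_(0 <= j < N | (j <= k <= j + 2)%N) x j.

(** For j > k the projection [g k] fixes [x j], and for j + 3 <= k it commutes with [E j]. In both
    cases the contribution of [x j] is orthogonal to [x k], so only j = k - 2, k - 1, k survive. *)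
Let rgvx k : (k < N)%N -> rdot (g k *m v) (x k) = rdot (y k) (g k *m x k).
Proof.
move=> kN; rewrite rdot_herm; last exact: hg.
rewrite {1}vE /y rdot_suml [RHS]rdot_suml [RHS]big_mkcond /=.
apply: eq_big_nat => j /andP[_ jN].
case: ifP => // /negbT; rewrite negb_and -!ltnNge => jk.
rewrite -rdot_herm; last exact: hg.
case: (ltnP k j) => kj.
  rewrite /x mulmxA /E mulmxBr !gG; [|lia|lia].
  by apply: rxx => //; rewrite neq_ltn kj orbT.
rewrite /x mulmxA /E mulmxBr !gGC; [|lia|lia|lia|lia].
rewrite -mulmxBl -mulmxA; apply: rxx => //; lia.
Qed.

Let ryy k : (k < N)%N ->
  rdot (y k) (y k) = \sum_(0 <= j < N | (j <= k <= j + 2)%N) rdot (x j) (x j).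
Proof.
move=> kN; rewrite /y rdot_suml ![RHS]big_mkcond [LHS]big_mkcond /=.
apply: eq_big_nat => i /andP[_ iN]; case: ifP => // iw.
rewrite rdot_sumr big_mkcond (bigD1_seq i) ?iota_uniq ?mem_index_iota //= iw big_seq_cond.
rewrite big1 ?addr0 // => j.
rewrite mem_index_iota => /andP[/andP[_ jN] ji]; case: ifP => // _.
by apply: rxx; rewrite // eq_sym.
Qed.

Let count_win j M : (\sum_(0 <= k < M) ((j <= k <= j + 2)%N : nat) = minn (M - j) 3)%N.
Proof.
elim: M => [|M IH]; first by rewrite big_nil; lia.
by rewrite big_nat_recr //= IH; lia.
Qed.

Let X := \sum_(0 <= k < N) rdot (x k) (x k).

(** Each [x j] occurs in [y k] for k = j, j + 1, j + 2 only. *)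
Let sum_ryy : \sum_(0 <= k < N) rdot (y k) (y k) <= 3 * X.
Proof.
rewrite (eq_big_nat _ _ (F2 := fun k => \sum_(0 <= j < N)
   (if (j <= k <= j + 2)%N then rdot (x j) (x j) else 0))); last first.
  by move=> k /andP[_ kN]; rewrite ryy // big_mkcond.
rewrite exchange_big /X mulr_sumr /=; apply: ler_sum => j _.
rewrite (eq_bigr (fun k => rdot (x j) (x j) *+ (j <= k <= j + 2)%N)); last first.
  by move=> k _; case: ifP.
rewrite sumrMnr count_win -[leLHS]mulr_natl; apply: ler_wpM2r; first exact: rdot_ge0.
by rewrite ler_nat; lia.
Qed.

Let XE : rdot v v = X.
Proof.
rewrite {2}vE rdot_sumr; apply: eq_big_nat => k /andP[_ kN]; exact: rvx.
Qed.

(** Write |x_k|^2 = <v, x_k> = <(1 - g_k) v, x_k> + <g_k v, x_k> and apply the arithmetic-geometric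
    inequality to both terms, with weights c = 1 - eps s and eps / s. As s^2 = 3, the second term
    sums to 2 eps s |v|^2, and 2 - c - 2 eps s = c is left over on the left. *)
Lemma martingale_bound :
  gam * (1 - eps * s) ^+ 2 * rdot v v <= \sum_(0 <= k < N) rdot v (h k *m v).
Proof.
set c := 1 - eps * s; have c0 : 0 < c by rewrite subr_gt0.
have es0 : 0 < eps / s by rewrite divr_gt0.
have step k : (k < N)%N -> 2 * rdot (x k) (x k) <=
   c^-1 * (rdot v v - rdot v (g k *m v)) + c * rdot (x k) (x k)
   + (eps / s * rdot (y k) (y k) + s * eps * rdot (x k) (x k)).
  move=> kN; rewrite -{1}rvx //.
  have -> : v = (v - g k *m v) + g k *m v by rewrite subrK.
  rewrite {1}rdotDl {1}subrK rgvx // mulrDr.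
  apply: lerD.
    have ci0 : 0 < c^-1 by rewrite invr_gt0.
    apply: (le_trans (rdot_amgm _ _ ci0)); rewrite invrK; apply: lerD => //.
    rewrite ler_pM2l // subrK rdotBl !rdotBr rdot_proj; [|exact: hg|exact: gg].
    by rewrite rdot_herm; [lra|exact: hg].
  apply: (le_trans (rdot_amgm _ _ es0)); apply: lerD => //.
  have := overlap v kN; rewrite -/(E k) -/(x k) /= => ho.
  have := ler_wpM2l (ltW (_ : 0 < (eps / s)^-1)) ho; rewrite invr_gt0 => /(_ es0).
  move=> /le_trans; apply; rewrite invf_div mulrA.
  by rewrite expr2 mulrA divfK ?gt_eqF.
have : 2 * X <= c^-1 * (\sum_(0 <= k < N) (rdot v v - rdot v (g k *m v))) + c * X
    + (eps / s * (3 * X) + s * eps * X).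
  have : 2 * X <= c^-1 * (\sum_(0 <= k < N) (rdot v v - rdot v (g k *m v))) + c * X
    + (eps / s * (\sum_(0 <= k < N) rdot (y k) (y k)) + s * eps * X).
    rewrite /X !mulr_sumr -!big_split /= !big_seq; apply: ler_sum => k.
    by rewrite mem_index_iota => /andP[_ /step].
  move=> /le_trans; apply; rewrite lerD2l lerD2r ler_pM2l //.
rewrite -XE; set Y := \sum_(_ <= _ < _) _.
have -> : eps / s * (3 * rdot v v) = eps * s * rdot v v.
  by rewrite -s2; field; rewrite gt_eqF.
move=> hY.
have hY' : c * rdot v v <= c^-1 * Y by rewrite {1}/c; rewrite /c in hY *; lra.
have hY2 : c ^+ 2 * rdot v v <= Y.
  have := ler_wpM2l (ltW c0) hY'; rewrite !mulrA mulfV ?gt_eqF // mul1r expr2 //.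
rewrite -mulrA; apply: (le_trans (ler_wpM2l gam0 hY2)).
rewrite /Y mulr_sumr !big_seq; apply: ler_sum => k.
by rewrite mem_index_iota => /andP[_ kN]; exact: hform.
Qed.

End Martingale.

(** * Knabe's argument on a ring of projections *)

Section Knabe.
Variable R : realType.
Local Notation C := R[i].

Lemma periodic_sum_shift (M i : nat) (F : nat -> R) : (forall k, F (k + M)%N = F k) ->
  \sum_(0 <= l < M) F (l + i)%N = \sum_(0 <= l < M) F l.
Proof.
move=> p; elim: i => [|i IH]; first by apply: eq_bigr => l _; rewrite addn0.
rewrite -IH; case: M p {IH} => [|M] p; first by rewrite !big_nil.
rewrite big_nat_recr //= [RHS]big_nat_recl //= addrC; congr (_ + _).
  by rewrite add0n -[RHS]p; congr F; lia.
by apply: eq_bigr => l _; rewrite addSnnS.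
Qed.

(** Sort both sides by the cyclic distance d. A window of n blocks sees the distance d exactly n - d
    times in either order, the ring side n - 1 times. Distance one, the only one that may contribute
    negatively, has the same coefficient on both sides. *)
Lemma knabe_count (M n : nat) (a : nat -> nat -> R) :
  (0 < n)%N -> (2 * n <= M)%N ->
  (forall i j, a i j = a j i) ->
  (forall i j, a (i + M)%N j = a i j) ->
  (forall i j, (i + 2 <= j)%N -> (j + 2 <= i + M)%N -> 0 <= a i j) ->
  \sum_(0 <= l < M) \sum_(0 <= i < n) \sum_(0 <= j < n) a (l + i)%N (l + j)%N <=
  (n%:R - 1) * (\sum_(0 <= i < M) \sum_(0 <= j < M) a i j) + \sum_(0 <= l < M) a l l.
Proof.
move=> n0 nM sym per pos.
have per' i j : a i (j + M)%N = a i j by rewrite sym per sym.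
pose B d := \sum_(0 <= l < M) a l (l + d)%N.
have Bs i d : \sum_(0 <= l < M) a (l + i)%N (l + i + d)%N = B d.
  rewrite (@periodic_sum_shift M i (fun l => a l (l + d)%N)) // => k.
  by rewrite per addnAC per'.
have Bsym d : (d <= M)%N -> B (M - d)%N = B d.
  move=> dM; rewrite -(Bs d) /B; apply: eq_bigr => l _.
  by rewrite -addnA subnKC // per' sym.
have Bpos d : (2 <= d)%N -> (d + 2 <= M)%N -> 0 <= B d.
  by move=> h1 h2; apply: sumr_ge0 => l _; apply: pos; lia.
have total : \sum_(0 <= i < M) \sum_(0 <= j < M) a i j = \sum_(0 <= d < M) B d.
  rewrite /B [RHS]exchange_big /=; apply: eq_bigr => i _.
  rewrite -[LHS](@periodic_sum_shift M i (a i)) //; apply: eq_bigr => j _.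
  by rewrite addnC.
have rev j F : \sum_(1 <= d < j.+1) F d = \sum_(0 <= i < j) F (j - i)%N :> R.
  rewrite big_add1 /= big_nat_rev /=; apply: eq_big_nat => i /andP[_ ij].
  by congr F; lia.
(* As B d = B (M - d), both ends of the range give the same sum; the middle part has distances
   between 2 and M - 2 and is nonnegative. *)
have key j : (0 < j < n)%N ->
   \sum_(1 <= d < j.+1) B d + \sum_(1 <= d < j.+1) B d <= \sum_(1 <= d < M) B d.
  move=> jn; rewrite [leRHS](@big_cat_nat _ _ _ j.+1) /=; [|lia|lia].
  rewrite lerD2l [leRHS](@big_cat_nat _ _ _ (M - j)%N) /=; [|lia|lia].
  have -> : \sum_(M - j <= d < M) B d = \sum_(1 <= d < j.+1) B d.
    rewrite rev -{1}[(M - j)%N]add0n big_addn; have -> : (M - (M - j) = j)%N by lia.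
    apply: eq_big_nat => i /andP[_ ij]; rewrite -Bsym; last lia.
    by congr B; lia.
  rewrite lerDr big_seq; apply: sumr_ge0 => d; rewrite mem_index_iota => hd.
  by apply: Bpos; lia.
pose D i j := \sum_(0 <= l < M) a (l + i)%N (l + j)%N.
have DB i j : (i <= j)%N -> D i j = B (j - i)%N.
  move=> ij; rewrite -(Bs i); apply: eq_bigr => l _; congr (a _ _); lia.
have Dsym i j : D i j = D j i by apply: eq_bigr => l _; rewrite sym.
pose T := \sum_(1 <= d < M) B d.
(* Enlarging the window by block m adds B 0 and twice the distances 1 to m, which [key] bounds by
   T. *)
have Q m : (0 < m <= n)%N ->
   \sum_(0 <= i < m) \sum_(0 <= j < m) D i j <= m%:R * B 0%N + (m%:R - 1) * T.
  elim: m => [//|m IH] mn.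
  rewrite big_nat_recr //=.
  rewrite (eq_bigr (fun i => \sum_(0 <= j < m) D i j + D i m)); last first.
    by move=> i _; rewrite big_nat_recr.
  rewrite big_split /= big_nat_recr //= DB // subnn.
  have -> : \sum_(0 <= i < m) D m i = \sum_(0 <= i < m) D i m.
    by apply: eq_bigr => i _; rewrite Dsym.
  have -> : \sum_(0 <= i < m) D i m = \sum_(1 <= d < m.+1) B d.
    by rewrite rev; apply: eq_big_nat => i /andP[_ im]; rewrite DB // ltnW.
  case: (posnP m) => [m0|m0].
    by rewrite m0 !big_geq // subrr mul0r !addr0 !add0r mul1r.
  have h1 := key m; have h2 := IH; rewrite m0 /= in h1 h2.
  have {}h1 := h1 mn; have {}h2 := h2 (ltnW mn).
  rewrite -/T in h1; rewrite -natr1; move: h1 h2.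
  set Z := \sum_(1 <= d < m.+1) _; set Y := \sum_(0 <= i < m) _ => h1 h2; lra.
have e1 : \sum_(0 <= l < M) \sum_(0 <= i < n) \sum_(0 <= j < n) a (l + i)%N (l + j)%N
   = \sum_(0 <= i < n) \sum_(0 <= j < n) D i j.
  rewrite exchange_big /=; apply: eq_bigr => i _; rewrite exchange_big /=.
  by apply: eq_bigr.
rewrite e1 total; apply: (le_trans (Q n _)); first by rewrite n0 /=.
have -> : \sum_(0 <= l < M) a l l = B 0%N by apply: eq_bigr => l _; rewrite addn0.
have -> : \sum_(0 <= d < M) B d = B 0%N + T by rewrite big_ltn //; lia.
by lra.
Qed.

Variables (d n M : nat) (h : nat -> 'M[C]_d) (c : R).
Hypotheses (n0 : (0 < n)%N) (nM : (2 * n <= M)%N)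
  (hh : forall k, herm (h k)) (h2 : forall k, h k *m h k = h k)
  (hper : forall k, h (k + M)%N = h k)
  (hcomm : forall i j, (i + 2 <= j)%N -> (j + 2 <= i + M)%N -> h i *m h j = h j *m h i).
Let A l := \sum_(0 <= i < n) h (l + i)%N.
Let Ht := \sum_(0 <= k < M) h k.
Hypothesis (hA : forall l (v : 'cV[C]_d), c * rdot v (A l *m v) <= rdot (A l *m v) (A l *m v)).

(** Cross terms of commuting projections are nonnegative, their product being a projection. The
    inequalities c A_l <= A_l^2 are summed over the M windows; each h_k lies in n of them. *)
Lemma knabe_sq (v : 'cV[C]_d) :
  (n%:R * c - 1) * rdot v (Ht *m v) <= (n%:R - 1) * rdot (Ht *m v) (Ht *m v).
Proof.
pose a i j := rdot (h i *m v) (h j *m v).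
have := @knabe_count M n a n0 nM.
have aii i : a i i = rdot v (h i *m v) by rewrite /a rdot_proj.
have eH : rdot (Ht *m v) (Ht *m v) = \sum_(0 <= i < M) \sum_(0 <= j < M) a i j.
  rewrite /Ht mulmx_suml rdot_suml; apply: eq_bigr => i _.
  by rewrite rdot_sumr.
have eHt : rdot v (Ht *m v) = \sum_(0 <= i < M) a i i.
  rewrite /Ht mulmx_suml rdot_sumr; apply: eq_bigr => i _; by rewrite aii.
have eA l : rdot (A l *m v) (A l *m v) = \sum_(0 <= i < n) \sum_(0 <= j < n) a (l + i)%N (l + j)%N.
  rewrite /A mulmx_suml rdot_suml; apply: eq_bigr => i _.
  by rewrite rdot_sumr.
have eAt l : rdot v (A l *m v) = \sum_(0 <= i < n) a (l + i)%N (l + i)%N.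
  rewrite /A mulmx_suml rdot_sumr; apply: eq_bigr => i _; by rewrite aii.
rewrite eH eHt => hk.
have : n%:R * c * \sum_(0 <= l < M) a l l <=
   \sum_(0 <= l < M) \sum_(0 <= i < n) \sum_(0 <= j < n) a (l + i)%N (l + j)%N.
  have -> : n%:R * c * \sum_(0 <= l < M) a l l =
     c * \sum_(0 <= l < M) \sum_(0 <= i < n) a (l + i)%N (l + i)%N.
    have -> : \sum_(0 <= l < M) \sum_(0 <= i < n) a (l + i)%N (l + i)%N
       = \sum_(0 <= i < n) \sum_(0 <= l < M) a l l.
      rewrite exchange_big; apply: eq_bigr => i _ /=.
      by apply: (@periodic_sum_shift M i (fun l => a l l)) => k; rewrite /a hper.
    by rewrite sumr_const_nat subn0 -[in RHS]mulr_natl mulrCA mulrA.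
  rewrite mulr_sumr; apply: ler_sum => l _; rewrite -eA -eAt; exact: hA.
move=> h1; have {}hk := hk _ _ _.
have : \sum_(0 <= l < M) \sum_(0 <= i < n) \sum_(0 <= j < n) a (l + i)%N (l + j)%N <=
  (n%:R - 1) * (\sum_(0 <= i < M) \sum_(0 <= j < M) a i j) + \sum_(0 <= l < M) a l l.
  apply: hk => [i j|i j|i j h3 h4]; first by rewrite /a rdotC.
    by rewrite /a hper.
  have e := hcomm h3 h4.
  rewrite /a rdot_herm // mulmxA.
  set P := h i *m h j.
  have PP : P *m P = P by rewrite /P mulmxA -(mulmxA (h i)) -e !mulmxA h2 -mulmxA h2.
  have aP : adj P = P by rewrite /P adjM !hh -e.
  by rewrite -PP -mulmxA -{1}aP -rdot_adj rdot_ge0.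
move=> h5; have := le_trans h1 h5; lra.
Qed.

End Knabe.

(** * The gap as an infimum and the norm as a supremum *)

Section GapNorm.
Variable R : realType.
Local Notation C := R[i].

Lemma rdot_unit n (v : 'cV[C]_n) : v != 0 ->
  let w := ((Num.sqrt (rdot v v))^-1)%:C *: v in
  dot w w = 1 /\ forall A : 'M[C]_n, rdot w (A *m w) = (rdot v v)^-1 * rdot v (A *m v).
Proof.
move=> v0 w.
have v1 : 0 < rdot v v.
  by rewrite lt_neqAle rdot_ge0 andbT eq_sym; apply: contra v0 => /eqP/rdot_eq0 ->.
have e : (Num.sqrt (rdot v v))^-1 * (Num.sqrt (rdot v v))^-1 = (rdot v v)^-1.
  by rewrite -invfM -expr2 sqr_sqrtr // ltW.
split; last by move=> A; rewrite -scalemxAr rdotZl rdotZr mulrA e.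
by rewrite dot_self rdotZl rdotZr mulrA e mulVf ?gt_eqF.
Qed.

Variables (L : nat) (H : op R L).
Hypotheses (hH : herm H) (pH : psd H).

Lemma gap_lbound : has_lbound [set r : R | exists psi : vec R L,
         [/\ inner psi psi = 1,
             (forall v : vec R L, H *m v = 0 -> inner v psi = 0) &
             inner psi (H *m psi) = r%:C]]%classic.
Proof.
exists 0 => r /= [psi [_ _ e]]; have := pH psi.
by rewrite /rdot -[dot _ _]/(inner _ _) e.
Qed.

Lemma gap_ge0 : 0 <= gap H.
Proof.
rewrite /gap; set S := [set r | _]%classic.
case: (pselect (S !=set0)%classic) => [S0|].
  apply: lb_le_inf => // r /= [psi [_ _ e]]; have := pH psi.
  by rewrite /rdot -[dot _ _]/(inner _ _) e.
by move/set0P/negP/negPn/eqP => ->; rewrite inf0.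
Qed.

Lemma gap_gapge : gapge H (gap H).
Proof.
move=> v hv; case: (eqVneq v 0) => [->|v0]; first by rewrite mulmx0 rdot0r mulr0.
have [w1 w2] := rdot_unit v0; set w := _ *: v in w1 w2.
have v1 : 0 < rdot v v.
  by rewrite lt_neqAle rdot_ge0 andbT eq_sym; apply: contra v0 => /eqP/rdot_eq0 ->.
rewrite -ler_pdivlMr // mulrC -w2; apply: (ge_inf gap_lbound) => /=.
exists w; split => //; last exact: herm_dot_real.
move=> u /hv; rewrite /w /inner -scalemxAr mxE => e.
by rewrite -[X in _ * X]/(dot u v) e mulr0.
Qed.

(** A nonzero [H] has a nonzero vector in its range, which is orthogonal to the kernel; hence the
    infimum is over a nonempty set and is not the default 0. *)
Lemma gapge_le_gap c : H != 0 -> gapge H c -> c <= gap H.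
Proof.
move=> H0 hc; apply: lb_le_inf.
  have [v Hv0] : exists v : 'cV[C]_(fdim L), H *m v != 0.
    apply: contrapT => /forallNP h; case/eqP: H0; apply: mulmx_ext => v.
    by rewrite mul0mx; apply/eqP; apply/negPn/negP; apply: h.
  have [w1 w2] := rdot_unit Hv0; set w := _ *: _ in w1 w2.
  exists (rdot w (H *m w)); exists w; split => //; last exact: herm_dot_real.
  move=> u Hu; rewrite /inner /w -scalemxAr mxE -[X in _ * X]/(dot u (H *m v)).
  have -> : dot u (H *m v) = 0 by rewrite -{1}hH -dot_adj Hu /dot adj0 mul0mx mxE.
  by rewrite mulr0.
move=> r /= [psi [e1 e2 e3]]; have := hc psi e2.
rewrite /rdot -![dot _ _]/(inner _ _) e1 e3 /=; by rewrite mulr1.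
Qed.

Lemma eig_le_opnorm mu : eigv H mu -> mu <= opnorm H.
Proof.
move=> e; have mu0 := psd_eig pH e; case: e => v v0 e.
apply: ub_le_sup.
  have [B [B0 hB]] := form_bounded hH.
  (* From r^2 <= B <= (B + 1)^2 follows r <= B + 1, with no square root taken. *)
  exists (B + 1) => r /= [psi [e1 r0 e3]].
  have := hB psi; rewrite /rdot -![dot _ _]/(inner _ _) e1 e3 /= mulr1 => hr.
  rewrite -(@ler_pXn2r _ 2) ?nnegrE ?addr_ge0 //.
  by apply: (le_trans hr); rewrite sqrrD1; nra.
have [w1 _] := rdot_unit v0; set w := _ *: v in w1.
exists w; split => //.
have -> : H *m w = mu%:C *: w by rewrite /w -scalemxAr e !scalerA mulrC.
rewrite -[LHS]/(dot _ _) dot_self rdotZl rdotZr; congr _%:C.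
have : rdot w w = 1 by rewrite /rdot w1.
by move=> ->; rewrite mulr1 expr2.
Qed.

End GapNorm.

(** * Amplitudes in the occupation basis and anticommutation relations *)

Section Amplitudes.
Variable R : realType.
Local Notation C := R[i].

Section Fock.
Variable L : nat.
Implicit Types (S T : {set 'I_L}) (psi : vec R L) (x y : 'I_L).

Definition amp psi S : C := psi (enum_rank S) 0.
Definition mkv (F : {set 'I_L} -> C) : vec R L := \col_i F (enum_val i).

Lemma amp_mkv F S : amp (mkv F) S = F S.
Proof. by rewrite /amp mxE enum_rankK. Qed.

Lemma amp_ext psi phi : (forall S, amp psi S = amp phi S) -> psi = phi.
Proof.
move=> h; apply/matrixP=> i j; rewrite ord1.
by have := h (enum_val i); rewrite /amp enum_valK.
Qed.

Lemma ampD psi phi S : amp (psi + phi) S = amp psi S + amp phi S.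
Proof. by rewrite /amp mxE. Qed.
Lemma ampN psi S : amp (- psi) S = - amp psi S.
Proof. by rewrite /amp mxE. Qed.
Lemma ampZ c psi S : amp (c *: psi) S = c * amp psi S.
Proof. by rewrite /amp mxE. Qed.
Lemma amp0 S : amp 0 S = 0.
Proof. by rewrite /amp mxE. Qed.

Lemma sum_sets (F : 'I_(fdim L) -> C) : \sum_i F i = \sum_S F (enum_rank S).
Proof.
rewrite [LHS](reindex (@enum_rank _)) //=.
by exists enum_val => i _; rewrite ?enum_rankK ?enum_valK.
Qed.

Lemma dot_amp psi phi : dot psi phi = \sum_S Num.conj (amp psi S) * amp phi S.
Proof. by rewrite dotE sum_sets. Qed.

Definition sgn S (x : nat) : C := (-1) ^+ #|finset (fun k : 'I_L => (k \in S) && (k < x)%N)|.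

Lemma sgnC S x : Num.conj (sgn S x) = sgn S x.
Proof. by rewrite /sgn rmorph_sign. Qed.

Lemma sgn2 S (x : nat) : sgn S x * sgn S x = 1.
Proof. by rewrite /sgn -exprMn mulrNN mulr1 expr1n. Qed.

Lemma sgnU S y (x : nat) : y \notin S ->
  sgn (y |: S) x = (if (y < x)%N then -1 else 1) * sgn S x.
Proof.
move=> yS; rewrite /sgn; case: ltnP => yx.
  rewrite -exprS; congr (_ ^+ _).
  rewrite (cardD1 y) inE setU11 yx /= add1n; congr _.+1; apply: eq_card => k.
  rewrite !inE; case: eqP => //= ->; by rewrite (negPf yS).
rewrite mul1r; congr (_ ^+ _); apply: eq_card => k.
by rewrite !inE; case: eqP => //= ->; rewrite (negPf yS) ltnNge yx.
Qed.

Lemma sgnD S y (x : nat) : y \in S ->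
  sgn (S :\ y) x = (if (y < x)%N then -1 else 1) * sgn S x.
Proof.
move=> yS; rewrite -{2}(setD1K yS) sgnU ?setD11 // mulrA.
by case: ifP => _; rewrite ?mulrNN mulr1 mul1r.
Qed.

Lemma amp_cop x psi T :
  amp (cop R L x *m psi) T = if x \in T then 0 else sgn T x * amp psi (x |: T).
Proof.
rewrite /amp mxE sum_sets.
rewrite (eq_bigr (fun S => (if (x \in S) && (T == S :\ x) then sgn S x else 0) * amp psi S)); last first.
  move=> S _; rewrite !mxE /cfg !enum_rankK modn_small //; congr (_ * _).
  have -> : [exists k in S, val k == x] = (x \in S).
    apply/existsP/idP => [[k /andP[kS /eqP e]]|xS]; last by exists x; rewrite xS eqxx.
    by rewrite -(val_inj e).
  have -> : finset (fun k => (k \in S) && (val k != x)) = S :\ x.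
    by apply/setP=> k; rewrite !inE andbC.
  by case: ifP.
case: ifPn => xT.
  apply: big1 => S _; case: ifP => [/andP[_ /eqP e]|_]; last by rewrite mul0r.
  by move: xT; rewrite e setD11.
rewrite (bigD1 (x |: T)) //= setU11 /= setU1K // eqxx big1 ?addr0.
  by rewrite sgnU // ltnn mul1r.
move=> S nS; case: ifP => [/andP[xS /eqP e]|_]; last by rewrite mul0r.
by case/eqP: nS; rewrite e setD1K.
Qed.

(** Obtained by duality from [amp_cop]: both sides are paired with an arbitrary [phi], then [phi] is
    taken to be the basis vector of [T]. *)
Lemma amp_copadj x psi T :
  amp (adj (cop R L x) *m psi) T = if x \in T then sgn T x * amp psi (T :\ x) else 0.
Proof.
have h phi : dot phi (adj (cop R L x) *m psi) =
   \sum_T Num.conj (amp phi T) * (if x \in T then sgn T x * amp psi (T :\ x) else 0).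
  rewrite -dot_adj dot_amp.
  rewrite (bigID (fun T => x \in T)) /= big1 => [|S xS]; last first.
    by rewrite amp_cop xS rmorph0 mul0r.
  rewrite add0r [RHS](bigID (fun T => x \in T)) /= [X in _ = _ + X]big1 => [|S /negPf ->]; last by rewrite mulr0.
  rewrite addr0 [RHS](reindex_onto (fun S => x |: S) (fun S => S :\ x)) /=; last first.
    by move=> S xS; rewrite setD1K.
  apply: eq_big => S.
    by rewrite setU11 /=; apply/idP/eqP => [/setU1K ->//|<-]; rewrite setD11.
  move=> xS; rewrite amp_cop (negPf xS) setU11 setU1K // rmorphM /= sgnC sgnU // ltnn mul1r.
  by rewrite mulrAC mulrC mulrA.
pose e := mkv (fun S => (S == T)%:R).
have eT F : \sum_S Num.conj (amp e S) * F S = F T.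
  rewrite (bigD1 T) //= amp_mkv eqxx conjC_nat mul1r big1 ?addr0 // => S /negPf ST.
  by rewrite amp_mkv ST conjC_nat mul0r.
by have := h e; rewrite dot_amp !eT.
Qed.

Lemma amp_nop x psi T : amp (nop R L x *m psi) T = (x \in T)%:R * amp psi T.
Proof.
rewrite /nop -mulmxA amp_copadj; case: ifP => xT; last by rewrite mul0r.
by rewrite amp_cop setD11 setD1K // sgnD // ltnn mul1r mulrA sgn2 !mul1r.
Qed.

Lemma car_cc x y : x != y -> cop R L x *m cop R L y = - (cop R L y *m cop R L x).
Proof.
move=> xy; apply: mulmx_ext => psi; apply: amp_ext => T.
rewrite mulNmx ampN -!mulmxA !amp_cop.
case: (boolP (x \in T)) => xT; case: (boolP (y \in T)) => yT.
- by rewrite oppr0.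
- by rewrite !inE xT orbT mulr0 oppr0.
- by rewrite !inE yT orbT mulr0 oppr0.
rewrite !inE (negPf xT) (negPf yT) eq_sym (negPf xy) /= !sgnU //.
rewrite setUCA; move: (xy); rewrite -val_eqE /= neq_ltn => /orP[] h.
  by rewrite h ltnNge (ltnW h) /=; ring.
by rewrite h ltnNge (ltnW h) /=; ring.
Qed.

Lemma car_cca x y : x != y ->
  cop R L x *m adj (cop R L y) = - (adj (cop R L y) *m cop R L x).
Proof.
move=> xy; apply: mulmx_ext => psi; apply: amp_ext => T.
rewrite mulNmx ampN -!mulmxA !(amp_cop, amp_copadj).
case: (boolP (x \in T)) => xT; case: (boolP (y \in T)) => yT.
- by rewrite !inE xT xy /= mulr0 oppr0.
- by rewrite oppr0.
- rewrite !inE yT (negPf xT) orbT andbF sgnU // sgnD //.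
  have -> : (x |: T) :\ y = x |: (T :\ y).
    by apply/setP=> k; rewrite !inE; case: (k =P x) => [->|] //=; rewrite xy.
  move: (xy); rewrite -val_eqE /= neq_ltn => /orP[] h.
    by rewrite h ltnNge (ltnW h) /=; ring.
  by rewrite h ltnNge (ltnW h) /=; ring.
by rewrite !inE (negPf yT) eq_sym (negPf xy) /= mulr0 oppr0.
Qed.

End Fock.
End Amplitudes.

(** * Occupation numbers indexed by natural numbers *)

Section Occupation.
Variable L : nat.
Implicit Types (S T : {set 'I_L}).

(** Indexing by natural numbers lets patterns be shifted by plain arithmetic. Beyond the last site
    the value is false: unlike [cop], there is no wrap-around. *)
Definition oc S (x : nat) : bool := [exists k in S, val k == x].

Lemma ocE S (k : 'I_L) : oc S k = (k \in S).
Proof.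
apply/existsP/idP => [[j /andP[jS /eqP e]]|kS]; last by exists k; rewrite kS eqxx.
by rewrite -(val_inj e).
Qed.

Lemma oc_lt S x : oc S x -> (x < L)%N.
Proof. by move=> /existsP[k /andP[_ /eqP <-]]; exact: ltn_ord. Qed.

Lemma oc_ext S T : (forall x, (x < L)%N -> oc S x = oc T x) -> S = T.
Proof. by move=> h; apply/setP=> k; rewrite -!ocE h. Qed.

Lemma card_oc_lt S x : (x <= L)%N ->
  #|finset (fun k : 'I_L => (k \in S) && (k < x)%N)| = (\sum_(0 <= i < x) oc S i)%N.
Proof.
move=> xL; rewrite (big_nat_widen _ _ L) // big_mkord -sum1_card big_mkcond [RHS]big_mkcond /=.
by apply: eq_bigr => i _; rewrite inE ocE; case: (i \in S); case: (i < x)%N.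
Qed.

Lemma card_oc S : #|S| = (\sum_(0 <= i < L) oc S i)%N.
Proof.
rewrite -card_oc_lt //; apply: eq_card => k; by rewrite inE ltn_ord andbT.
Qed.

End Occupation.

(** * Local Hamiltonians: positivity, commutation, transport of eigenvalues *)

Section Hamiltonians.
Variables (R : realType) (kappa : R) (lam : R[i]).
Local Notation C := R[i].

Definition nn L x : op R L := nop R L x *m nop R L (x + 2).
Definition qq L x : op R L := adj (qop L lam x) *m qop L lam x.
(** The open Hamiltonian of the [l] sites from [s] on, taken modulo [L], acting on the Fock space of
    the whole ring. *)
Definition Hloc L s l : op R L :=
  \sum_(s <= x < s + (l - 2)) nn L x + kappa%:C *: \sum_(s <= x < s + (l - 3)) qq L x.

Lemma HopenE L : Hopen kappa lam L = Hloc L 0 L. Proof. by []. Qed.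

Lemma HperE L : Hper kappa lam L =
  \sum_(0 <= x < L) nn L x + kappa%:C *: \sum_(0 <= x < L) qq L x.
Proof. by rewrite /Hper big_split /= scaler_sumr. Qed.

Section FixedL.
Variable L : nat.
Hypothesis L0 : (0 < L)%N.
Implicit Types (S T : {set 'I_L}) (psi : vec R L).

Definition site x : 'I_L := Ordinal (ltn_pmod x L0).

Lemma cop_site x : cop R L x = cop R L (site x).
Proof. by apply/matrixP=> i j; rewrite !mxE /= modn_mod. Qed.

Lemma cop_mod x y : x = y %[mod L] -> cop R L x = cop R L y.
Proof. by move=> e; apply/matrixP=> i j; rewrite !mxE e. Qed.

Lemma siteE x : (x < L)%N -> val (site x) = x.
Proof. by move=> xL; rewrite /= modn_small. Qed.

Lemma amp_nop_nat x psi T : amp (nop R L x *m psi) T = (site x \in T)%:R * amp psi T.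
Proof. by rewrite /nop cop_site -[adj _ *m _]/(nop R L (site x)) amp_nop. Qed.

Lemma amp_nn x psi T :
  amp (nn L x *m psi) T = ((site x \in T) && (site (x + 2) \in T))%:R * amp psi T.
Proof. by rewrite /nn -mulmxA !amp_nop_nat mulrA -natrM mulnb. Qed.

Lemma nn_idem x : nn L x *m nn L x = nn L x.
Proof.
apply: mulmx_ext => psi; apply: amp_ext => T; rewrite -mulmxA !amp_nn mulrA -natrM.
by case: (_ && _).
Qed.

Lemma herm_nop x : herm (nop R L x).
Proof. by rewrite /herm /nop adjM adjK. Qed.

Lemma herm_nn x : herm (nn L x).
Proof.
rewrite /herm /nn adjM !herm_nop; apply: mulmx_ext => psi; apply: amp_ext => T.
have e y z : amp (nop R L y *m nop R L z *m psi) T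
    = ((site y \in T) * (site z \in T))%:R * amp psi T.
  by rewrite -mulmxA !amp_nop_nat mulrA -natrM.
by rewrite !e mulnC.
Qed.

Lemma herm_qq x : herm (qq L x).
Proof. by rewrite /herm /qq adjM adjK. Qed.

Lemma rdot_nn x psi : rdot psi (nn L x *m psi) = rdot (nn L x *m psi) (nn L x *m psi).
Proof. by rewrite rdot_proj //; [exact: herm_nn | exact: nn_idem]. Qed.

Lemma rdot_qq x psi : rdot psi (qq L x *m psi) = rdot (qop L lam x *m psi) (qop L lam x *m psi).
Proof. by rewrite rdot_adj mulmxA. Qed.

Lemma rdot_nn_ge0 x psi : 0 <= rdot psi (nn L x *m psi).
Proof. by rewrite rdot_nn rdot_ge0. Qed.

Lemma rdot_qq_ge0 x psi : 0 <= rdot psi (qq L x *m psi).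
Proof. by rewrite rdot_qq rdot_ge0. Qed.

(** Two independent ranges cover local, open and periodic Hamiltonians alike. *)
Definition Hsum (a b c d : nat) : op R L :=
  \sum_(a <= x < b) nn L x + kappa%:C *: \sum_(c <= x < d) qq L x.

Lemma herm_Hsum a b c d : herm (Hsum a b c d).
Proof.
rewrite /herm adjD adjZR !adj_sum; congr (_ + _ *: _); apply: eq_bigr => x _.
  exact: herm_nn.
exact: herm_qq.
Qed.

Lemma rdot_Hsum a b c d psi : rdot psi (Hsum a b c d *m psi) =
  \sum_(a <= x < b) rdot psi (nn L x *m psi) + kappa * \sum_(c <= x < d) rdot psi (qq L x *m psi).
Proof.
by rewrite mulmxDl rdotDr -scalemxAl rdotZr !mulmx_suml !rdot_sumr.
Qed.

Lemma psd_Hsum a b c d : 0 < kappa -> psd (Hsum a b c d).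
Proof.
move=> kappa_gt0 v; rewrite rdot_Hsum addr_ge0 //; last rewrite mulr_ge0 ?(ltW kappa_gt0) //.
  by apply: sumr_ge0 => x _; exact: rdot_nn_ge0.
by apply: sumr_ge0 => x _; exact: rdot_qq_ge0.
Qed.

(** Frustration-freeness: the terms are nonnegative and [kappa > 0], so zero energy means zero
    energy of each term. *)
Lemma ker_Hsum a b c d psi : 0 < kappa -> Hsum a b c d *m psi = 0 <->
  (forall x, (a <= x < b)%N -> nn L x *m psi = 0) /\
  (forall x, (c <= x < d)%N -> qop L lam x *m psi = 0).
Proof.
move=> kappa_gt0; split=> [h|[h1 h2]]; last first.
  rewrite mulmxDl -scalemxAl !mulmx_suml !big_seq !big1 ?scaler0 ?addr0 // => x;
    rewrite mem_index_iota => hx; last exact: h1.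
  by rewrite /qq -mulmxA h2 // mulmx0.
have := congr1 (rdot psi) h; rewrite rdot_Hsum rdot0r => /eqP.
have p1 : 0 <= \sum_(a <= x < b) rdot psi (nn L x *m psi).
  by apply: sumr_ge0 => x _; exact: rdot_nn_ge0.
have p2 : 0 <= \sum_(c <= x < d) rdot psi (qq L x *m psi).
  by apply: sumr_ge0 => x _; exact: rdot_qq_ge0.
rewrite paddr_eq0 // ?mulr_ge0 ?(ltW kappa_gt0) // mulf_eq0 (gt_eqF kappa_gt0) /=.
rewrite !psumr_eq0; [|by move=> x _; exact: rdot_qq_ge0|by move=> x _; exact: rdot_nn_ge0].
move=> /andP[/allP h1 /allP h2]; split=> x hx.
  apply: rdot_eq0; rewrite -rdot_nn; apply/eqP.
  by apply: h1; rewrite mem_index_iota.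
apply: rdot_eq0; rewrite -rdot_qq; apply/eqP.
by apply: h2; rewrite mem_index_iota.
Qed.

(** Satisfied by products of two fermion operators at other sites, since two sign changes cancel.
    Holding it at every site of an interval gives commutation with the Hamiltonian of the
    interval. *)
Definition cmt y (A : op R L) :=
  A *m cop R L y = cop R L y *m A /\ A *m adj (cop R L y) = adj (cop R L y) *m A.

Lemma cmtM y A B : cmt y A -> cmt y B -> cmt y (A *m B).
Proof.
move=> [a1 a2] [b1 b2]; split.
  by rewrite -mulmxA b1 !mulmxA a1.
by rewrite -mulmxA b2 !mulmxA a2.
Qed.

Lemma cmtD y A B : cmt y A -> cmt y B -> cmt y (A + B).
Proof. by move=> [a1 a2] [b1 b2]; split; rewrite mulmxDl mulmxDr ?a1 ?a2 ?b1 ?b2. Qed.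

Lemma cmtZ y c A : cmt y A -> cmt y (c *: A).
Proof. by move=> [a1 a2]; split; rewrite -scalemxAl -scalemxAr ?a1 ?a2. Qed.

Lemma cmtA y A : cmt y A -> cmt y (adj A).
Proof.
move=> [a1 a2]; split.
  by rewrite -[in LHS](adjK (cop R L y)) -adjM -a2 adjM adjK.
by rewrite -adjM -a1 adjM.
Qed.

Lemma cmt_sum y I (r : seq I) (P : pred I) (F : I -> op R L) :
  (forall i, P i -> cmt y (F i)) -> cmt y (\sum_(i <- r | P i) F i).
Proof.
move=> h; elim/big_rec: _ => [|i A Pi hA]; last by apply: cmtD => //; exact: h.
by split; rewrite mul0mx mulmx0.
Qed.

Let anti (A B : op R L) := A *m B = - (B *m A).

Let anti_cc x y : x != y %[mod L] -> anti (cop R L x) (cop R L y).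
Proof. by move=> xy; rewrite /anti (cop_site x) (cop_site y) car_cc. Qed.

Let anti_cca x y : x != y %[mod L] -> anti (cop R L x) (adj (cop R L y)).
Proof. by move=> xy; rewrite /anti (cop_site x) (cop_site y) car_cca. Qed.

Let anti_prod A B D : anti A D -> anti B D -> A *m B *m D = D *m (A *m B).
Proof. by move=> a b; rewrite -mulmxA b mulmxN !mulmxA a mulNmx opprK. Qed.

Lemma cmt_cc x y z : x != z %[mod L] -> y != z %[mod L] -> cmt z (cop R L x *m cop R L y).
Proof. by move=> xz yz; split; apply: anti_prod; (exact: anti_cc || exact: anti_cca). Qed.

Lemma cmt_nop x z : x != z %[mod L] -> cmt z (nop R L x).
Proof.
move=> xz; have h1 : anti (adj (cop R L x)) (adj (cop R L z)).
  by have := congr1 (@adj _ _ _) (anti_cc xz); rewrite /anti adjN !adjM => ->; rewrite opprK.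
have h2 : anti (adj (cop R L x)) (cop R L z).
  have zx : z != x %[mod L] by rewrite eq_sym.
  by have := anti_cca zx; rewrite /anti => ->; rewrite opprK.
by split; apply: anti_prod => //; (exact: anti_cc || exact: anti_cca).
Qed.

Lemma cmt_nn x z : x != z %[mod L] -> x + 2 != z %[mod L] -> cmt z (nn L x).
Proof. by move=> h1 h2; apply: cmtM; apply: cmt_nop. Qed.

Lemma cmt_qop x z : (forall i, (i < 4)%N -> x + i != z %[mod L]) -> cmt z (qop L lam x).
Proof.
move=> h; rewrite /qop -scaleN1r; apply: cmtD.
  by apply: cmt_cc; [have := h 1%N isT | have := h 2%N isT]; rewrite ?addn1 ?addn2.
by do 2 apply: cmtZ; apply: cmt_cc; [have := h 0%N isT | have := h 3%N isT]; rewrite ?addn0 ?addn3.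
Qed.

Lemma cmt_Hloc s l z : (forall i, (i < l)%N -> s + i != z %[mod L]) -> cmt z (Hloc L s l).
Proof.
move=> h; apply: cmtD; last apply: cmtZ; rewrite big_seq; apply: cmt_sum => x;
  rewrite mem_index_iota => hx.
  apply: cmt_nn.
    by have := h (x - s)%N; rewrite subnKC; [apply|]; lia.
  have -> : (x + 2 = s + (x + 2 - s))%N by lia.
  by apply: h; lia.
apply: cmtM; [apply: cmtA|]; apply: cmt_qop => i i4;
  (have -> : (x + i = s + (x + i - s))%N by lia); apply: h; lia.
Qed.

Lemma comm_Hloc s l A : (forall z, (s <= z < s + l)%N -> cmt z A) ->
  A *m Hloc L s l = Hloc L s l *m A.
Proof.
move=> h.
have hq x : (s <= x < s + (l - 3))%N -> A *m qop L lam x = qop L lam x *m A.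
  move=> hx; have [a0 _] : cmt x A by apply: h; lia.
  have [a1 _] : cmt x.+1 A by apply: h; lia.
  have [a2 _] : cmt x.+2 A by apply: h; lia.
  have [a3 _] : cmt x.+3 A by apply: h; lia.
  rewrite /qop mulmxBr mulmxBl -scalemxAr -scalemxAl !mulmxA a1 a0.
  by rewrite -!mulmxA a2 a3 !mulmxA.
have hqa x : (s <= x < s + (l - 3))%N -> A *m adj (qop L lam x) = adj (qop L lam x) *m A.
  move=> hx; have [_ a0] : cmt x A by apply: h; lia.
  have [_ a1] : cmt x.+1 A by apply: h; lia.
  have [_ a2] : cmt x.+2 A by apply: h; lia.
  have [_ a3] : cmt x.+3 A by apply: h; lia.
  rewrite /qop adjD adjN adjZ !adjM mulmxBr mulmxBl -scalemxAr -scalemxAl !mulmxA a2 a3.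
  by rewrite -!mulmxA a1 a0 !mulmxA.
have hn x : (s <= x < s + l)%N -> A *m nop R L x = nop R L x *m A.
  by move=> hx; have [a0 a1] := h x hx; rewrite /nop mulmxA a1 -mulmxA a0 mulmxA.
rewrite mulmxDr mulmxDl -scalemxAr -scalemxAl; congr (_ + _ *: _);
  rewrite mulmx_suml mulmx_sumr !big_seq; apply: eq_bigr => x; rewrite mem_index_iota => hx.
  by rewrite /nn mulmxA hn -?mulmxA ?hn ?mulmxA //; lia.
by rewrite /qq mulmxA hqa // -(mulmxA _ A) hq // mulmxA.
Qed.

Lemma comm_Hloc2 s l s' l' :
  (forall i j, (i < l)%N -> (j < l')%N -> s + i != s' + j %[mod L]) ->
  Hloc L s l *m Hloc L s' l' = Hloc L s' l' *m Hloc L s l.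
Proof.
move=> h; apply: comm_Hloc => z hz; apply: cmt_Hloc => i il.
by have := h i (z - s')%N il; rewrite subnKC; [apply; lia|lia].
Qed.

End FixedL.

Section Intertwiners.
Variables (L L' s k l : nat) (F : vec R L -> vec R L').
Hypotheses (FD : forall u v, F (u + v) = F u + F v) (FZ : forall c u, F (c *: u) = c *: F u).
Hypotheses (Fc : forall x u, (s <= x < s + l)%N -> F (cop R L x *m u) = cop R L' (x + k) *m F u)
  (Fa : forall x u, (s <= x < s + l)%N -> F (adj (cop R L x) *m u) = adj (cop R L' (x + k)) *m F u).

Let F0 : F 0 = 0. Proof. by rewrite -(scale0r 0) FZ scale0r. Qed.

Let FN u : F (- u) = - F u. Proof. by rewrite -scaleN1r FZ scaleN1r. Qed.

Let Fsum I (r : seq I) (P : pred I) (G : I -> vec R L) :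
  F (\sum_(i <- r | P i) G i) = \sum_(i <- r | P i) F (G i).
Proof. by elim/big_rec2: _ => [|i x y _ <-]; rewrite ?F0 ?FD. Qed.

(** Applied to the rotation of the ring with k = 1 and to the restriction to the first sites with k
    = 0. *)
Lemma intertwine_Hloc u : F (Hloc L s l *m u) = Hloc L' (s + k) l *m F u.
Proof.
have Fn x w : (s <= x < s + l)%N -> F (nop R L x *m w) = nop R L' (x + k) *m F w.
  by move=> hx; rewrite /nop -mulmxA Fa // Fc // mulmxA.
have Fq x w : (s <= x < s + (l - 3))%N -> F (qop L lam x *m w) = qop L' lam (x + k) *m F w.
  move=> hx; rewrite /qop !mulmxBl FD FN -!scalemxAl FZ -!mulmxA.
  by rewrite !Fc // ?addSn //; lia.
have Fqa x w : (s <= x < s + (l - 3))%N ->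
    F (adj (qop L lam x) *m w) = adj (qop L' lam (x + k)) *m F w.
  move=> hx; rewrite /qop !adjD !adjN !adjZ !adjM !mulmxBl FD FN -!scalemxAl FZ -!mulmxA.
  by rewrite !Fa // ?addSn //; lia.
rewrite /Hloc !mulmxDl -!scalemxAl FD FZ !mulmx_suml !Fsum.
have sh m (G : nat -> vec R L') : \sum_(s + k <= x < s + k + m) G x = \sum_(s <= x < s + m) G (x + k)%N.
  rewrite -[(s + k)%N]/(s + k)%N big_addn; congr bigop.
  by congr index_iota; lia.
rewrite !sh; congr (_ + _ *: _); apply: eq_big_nat => x hx.
  rewrite /nn -(mulmxA (nop R L x)) -(mulmxA (nop R L' (x + k))) Fn; last lia.
  by rewrite Fn; [rewrite addnAC | lia].
by rewrite /qq -!mulmxA Fqa // Fq.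
Qed.

End Intertwiners.

Section Rotation.
Variable L : nat.
Hypothesis L0 : (0 < L)%N.
Implicit Types (S T : {set 'I_L}) (psi : vec R L) (x : 'I_L).

Definition unrot T : {set 'I_L} := finset (fun k => ordS k \in T).
(** A particle on the last site is moved to site 0, in front of the [#|T| - 1] others, and picks up
    one sign for each of them. *)
Definition rot_sign T : C := (-1) ^+ (if oc T 0 then #|T|.-1 else 0%N).
Definition rotv psi : vec R L := mkv (fun T => rot_sign T * amp psi (unrot T)).

Lemma oc_unrot T i : (i.+1 < L)%N -> oc (unrot T) i = oc T i.+1.
Proof.
move=> iL; have iL' := ltnW iL.
have /= -> := ocE (unrot T) (Ordinal iL'); rewrite inE -ocE /=.
by rewrite modn_small.
Qed.

(** Below the last site, a particle at site 0 enters the string of the shifted site, and the extra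
    particle in [rot_sign] compensates for it. At the last site, the string before the rotation
    counts all the particles, and after it none. *)
Lemma rot_sign_shift T x : ordS x \notin T ->
  rot_sign T * sgn R (unrot T) x = sgn R T (ordS x) * rot_sign (ordS x |: T).
Proof.
move=> xT; rewrite /rot_sign /sgn.
have c1 : #|ordS x |: T| = #|T|.+1 by rewrite cardsU1 xT.
have [xL|xL] : (x.+1 < L)%N \/ x.+1 = L.
  by have := ltn_ord x; rewrite leq_eqVlt => /orP[/eqP|]; [right|left].
  have eS : nat_of_ord (ordS x) = x.+1 by rewrite /= modn_small.
  rewrite eS !card_oc_lt ?(ltnW xL) //; last exact: ltnW.
  have -> : oc (ordS x |: T) 0 = oc T 0.
    have := ocE (ordS x |: T) (Ordinal L0); have := ocE T (Ordinal L0); rewrite /= => -> ->.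
    by rewrite !inE -val_eqE /= modn_small.
  rewrite c1 /= big_nat_recl //=.
  have -> : (\sum_(0 <= i < x) oc (unrot T) i = \sum_(0 <= i < x) oc T i.+1)%N.
    by apply: eq_big_nat => i /andP[_ ix]; rewrite oc_unrot //; lia.
  case: (boolP (oc T 0)) => T0; last by rewrite add0n expr0 mul1r mulr1.
  rewrite add1n exprS mulN1r mulNr.
  have Tp : (0 < #|T|)%N by case/existsP: T0 => k /andP[kT _]; apply/card_gt0P; exists k.
  by rewrite -[in RHS](prednK Tp) exprS mulN1r mulrN opprK mulrC.
have eS : nat_of_ord (ordS x) = 0%N by rewrite /= xL modnn.
have T0 : oc T 0 = false by rewrite -eS ocE (negPf xT).
have -> : oc (ordS x |: T) 0 by rewrite -eS ocE setU11.
rewrite T0 c1 expr0 mul1r eS.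
rewrite !card_oc_lt //; last exact: ltnW.
rewrite (big_geq (leqnn 0)) expr0 mul1r; congr (_ ^+ _).
have eL : index_iota 0 L = index_iota 0 x.+1 by rewrite xL.
rewrite card_oc eL big_nat_recl //= T0 add0n.
by apply: eq_big_nat => i /andP[_ ix]; rewrite oc_unrot // -xL ltnS.
Qed.

Lemma unrotU T x : unrot (ordS x |: T) = x |: unrot T.
Proof. by apply/setP=> k; rewrite !inE (inj_eq (@ordS_inj _)). Qed.

Lemma unrotD T x : unrot (T :\ ordS x) = unrot T :\ x.
Proof. by apply/setP=> k; rewrite !inE (inj_eq (@ordS_inj _)). Qed.

Lemma cop_ordS x : cop R L (x + 1) = cop R L (ordS x).
Proof. by apply: cop_mod; rewrite /= addn1 modn_mod. Qed.

Lemma rotv_cop x psi : rotv (cop R L x *m psi) = cop R L (x + 1) *m rotv psi.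
Proof.
apply: amp_ext => T; rewrite cop_ordS amp_mkv !amp_cop inE; case: ifPn => xT.
  by rewrite mulr0.
by rewrite amp_mkv unrotU !mulrA rot_sign_shift.
Qed.

Lemma rot_sign2 T : rot_sign T * rot_sign T = 1.
Proof. by rewrite /rot_sign -exprMn mulrNN mulr1 expr1n. Qed.

Lemma rotv_copadj x psi : rotv (adj (cop R L x) *m psi) = adj (cop R L (x + 1)) *m rotv psi.
Proof.
apply: amp_ext => T; rewrite cop_ordS amp_mkv !amp_copadj inE; case: ifPn => xT; last first.
  by rewrite mulr0.
rewrite amp_mkv unrotD !mulrA; congr (_ * _).
have xT' : ordS x \notin T :\ ordS x by rewrite setD11.
have := rot_sign_shift xT'; rewrite setD1K // unrotD !sgnD ?inE // !ltnn !mul1r => e.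
have := congr1 (fun z => rot_sign (T :\ ordS x) * rot_sign T * z) e.
have -> : rot_sign (T :\ ordS x) * rot_sign T * (rot_sign (T :\ ordS x) * sgn R (unrot T) x)
  = (rot_sign (T :\ ordS x) * rot_sign (T :\ ordS x)) * (rot_sign T * sgn R (unrot T) x) by ring.
have -> : rot_sign (T :\ ordS x) * rot_sign T * (sgn R T (ordS x) * rot_sign T)
  = (rot_sign T * rot_sign T) * (sgn R T (ordS x) * rot_sign (T :\ ordS x)) by ring.
by rewrite !rot_sign2 !mul1r.
Qed.

Lemma rotv_inj psi : rotv psi = 0 -> psi = 0.
Proof.
move=> h; apply: amp_ext => S; rewrite amp0.
have [f fK Kf] := ordS_bij L.
have := congr1 (fun v => amp v (finset (fun k => f k \in S))) h; rewrite amp_mkv amp0 => /eqP.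
rewrite mulf_eq0 signr_eq0 /= => /eqP; congr (_ = _); congr amp.
by apply/setP=> k; rewrite !inE fK.
Qed.

Lemma eigv_Hloc_shift s k l mu : eigv (Hloc L s l) mu -> eigv (Hloc L (s + k) l) mu.
Proof.
elim: k => [|k IH]; first by rewrite addn0.
move=> /IH [v v0 e]; exists (rotv v); first by apply: contra v0 => /eqP/rotv_inj ->.
have FD u w : rotv (u + w) = rotv u + rotv w.
  by apply: amp_ext => T; rewrite !(ampD, amp_mkv) mulrDr.
have FZ c u : rotv (c *: u) = c *: rotv u.
  by apply: amp_ext => T; rewrite !(ampZ, amp_mkv) mulrCA.
rewrite addnS -[(s + k).+1]addn1 -intertwine_Hloc ?e ?FZ // => x u _.
  rewrite !(cop_site L0 x) rotv_cop; congr (_ *m _); apply: cop_mod.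
  by rewrite /= modnDml.
rewrite !(cop_site L0 x) rotv_copadj; congr (adj _ *m _); apply: cop_mod.
by rewrite /= modnDml.
Qed.

Lemma Hloc_mod s s' l : s = s' %[mod L] -> Hloc L s l = Hloc L s' l.
Proof.
move=> e.
have eC i : cop R L (s + i) = cop R L (s' + i) by apply: cop_mod; rewrite -modnDml e modnDml.
have sh t m (G : nat -> op R L) : \sum_(t <= x < t + m) G x = \sum_(0 <= x < m) G (t + x)%N.
  rewrite -{1}[t]add0n big_addn addKn; apply: eq_bigr => i _; by rewrite addnC.
have en (x : nat) : nn L (s + x) = nn L (s' + x) by rewrite /nn /nop -!addnA !eC.
have eq (x : nat) : qq L (s + x) = qq L (s' + x) by rewrite /qq /qop -!addnS !eC.
have sh' m (G : nat -> op R L) : (forall x : nat, G (s + x)%N = G (s' + x)%N) ->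
    \sum_(s <= x < s + m) G x = \sum_(s' <= x < s' + m) G x.
  by move=> eG; rewrite (sh s) (sh s'); apply: eq_bigr => x _; exact: eG.
by rewrite /Hloc (sh' _ _ en) (sh' _ _ eq).
Qed.

End Rotation.

Section Restriction.
Variables (L l : nat).
Hypothesis lL : (l <= L)%N.

Definition extend (S : {set 'I_l}) (eta : {set 'I_L}) : {set 'I_L} :=
  finset (fun k : 'I_L => if (k < l)%N then oc S k else k \in eta).
(** The slice of [psi] on which the occupation outside the first [l] sites is frozen. *)
Definition restr eta (psi : vec R L) : vec R l := mkv (fun S => amp psi (extend S eta)).

Lemma oc_extend S eta i : (i < l)%N -> oc (extend S eta) i = oc S i.
Proof.
move=> il; have iL := leq_trans il lL.
by have /= -> := ocE (extend S eta) (Ordinal iL); rewrite inE /= il.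
Qed.

(** Strings run to the left, so for the first [l] sites they contain no outside site. This is why an
    interval is rotated to the origin before it is cut out. *)
Lemma sgn_extend S eta (x : 'I_l) : sgn R (extend S eta) x = sgn R S x.
Proof.
rewrite /sgn !card_oc_lt ?(ltnW (ltn_ord x)) ?(leq_trans (ltnW (ltn_ord x)) lL) //.
congr (_ ^+ _); apply: eq_big_nat => i /andP[_ ix]; rewrite oc_extend //.
exact: ltn_trans ix (ltn_ord x).
Qed.

Lemma extendU S eta (x : 'I_l) :
  extend (x |: S) eta = widen_ord lL x |: extend S eta.
Proof.
apply/setP=> k; rewrite !inE; case: ltnP => kl.
  have := ocE (x |: S) (Ordinal kl); have := ocE S (Ordinal kl); rewrite /= => -> ->.
  by rewrite !inE -!val_eqE.
case: eqP => //= e; move: kl; rewrite e /= leqNgt ltn_ord //.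
Qed.

Lemma extendD S eta (x : 'I_l) :
  extend (S :\ x) eta = extend S eta :\ widen_ord lL x.
Proof.
apply/setP=> k; rewrite !inE; case: ltnP => kl.
  have := ocE (S :\ x) (Ordinal kl); have := ocE S (Ordinal kl); rewrite /= => -> ->.
  by rewrite !inE -!val_eqE.
case: eqP => //= e; move: kl; rewrite e /= leqNgt ltn_ord //.
Qed.

Lemma mem_extend S eta (x : 'I_l) : (widen_ord lL x \in extend S eta) = (x \in S).
Proof. by rewrite inE /= ltn_ord ocE. Qed.

Lemma restr_cop eta (x : 'I_l) psi :
  restr eta (cop R L x *m psi) = cop R l x *m restr eta psi.
Proof.
apply: amp_ext => S; rewrite amp_mkv -[nat_of_ord x]/(nat_of_ord (widen_ord lL x)).
rewrite !amp_cop mem_extend; case: ifP => // _.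
by rewrite amp_mkv extendU sgn_extend.
Qed.

Lemma restr_copadj eta (x : 'I_l) psi :
  restr eta (adj (cop R L x) *m psi) = adj (cop R l x) *m restr eta psi.
Proof.
apply: amp_ext => S; rewrite amp_mkv -[nat_of_ord x]/(nat_of_ord (widen_ord lL x)).
rewrite !amp_copadj mem_extend; case: ifP => // _.
by rewrite amp_mkv extendD sgn_extend.
Qed.

(** A slice through a configuration of nonzero amplitude is a nonzero eigenvector of the short
    chain. *)
Lemma eigv_Hopen mu : eigv (Hloc L 0 l) mu -> eigv (Hopen kappa lam l) mu.
Proof.
move=> [v v0 e].
have [T vT] : exists T, amp v T != 0.
  apply: contrapT => /forallNP h; case/eqP: v0; apply: amp_ext => S.
  by rewrite amp0; apply/eqP; apply/negPn/negP; exact: h.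
exists (restr T v).
  apply/eqP => /(congr1 (fun w => amp w (finset (fun k : 'I_l => oc T k)))).
  rewrite amp_mkv amp0 => h; case/eqP: vT; rewrite -[RHS]h; congr amp.
  apply/setP=> k; rewrite inE; case: ltnP => kl //.
  by have := ocE (finset (fun k : 'I_l => oc T k)) (Ordinal kl); rewrite /= => ->; rewrite inE /= ocE.
have FD u w : restr T (u + w) = restr T u + restr T w.
  by apply: amp_ext => S; rewrite !(ampD, amp_mkv).
have FZ c u : restr T (c *: u) = c *: restr T u.
  by apply: amp_ext => S; rewrite !(ampZ, amp_mkv).
rewrite HopenE -[Hloc l 0 l]/(Hloc l (0 + 0) l) -intertwine_Hloc ?e ?FZ // => x u;
  rewrite add0n addn0 => /= xl.
  exact: (restr_cop T (Ordinal xl)).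
exact: (restr_copadj T (Ordinal xl)).
Qed.

End Restriction.

(** This inclusion of spectra bounds the gap of a local Hamiltonian from below, and its eigenvalues
    from above, by those of the open chain. *)
Lemma eigv_Hloc L s l mu : (0 < L)%N -> (l <= L)%N ->
  eigv (Hloc L s l) mu -> eigv (Hopen kappa lam l) mu.
Proof.
move=> L0 lL e; apply: (eigv_Hopen lL).
(* Rotating by L s - s brings the first site to L s, which is site 0 of the ring. *)
rewrite (@Hloc_mod L _ (s + (L * s - s))%N); last first.
  by rewrite subnKC ?modnMr ?mod0n // leq_pmull.
exact: eigv_Hloc_shift.
Qed.

End Hamiltonians.

(** * Cutting the ring into blocks *)

Lemma neq_mod_lt (L x y : nat) : (x < y < x + L)%N -> x != y %[mod L].
Proof.
move=> h; apply/negP; rewrite eq_sym eqn_mod_dvd; last lia.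
by move/dvdn_leq; lia.
Qed.

Lemma sum_blocks_disj (R : realType) (a : nat -> R) (s : nat -> nat) n :
  (forall i, (s i <= s i.+1)%N) ->
  \sum_(s 0%N <= x < s n) a x = \sum_(0 <= i < n) \sum_(s i <= x < s i.+1) a x.
Proof.
move=> hs; have mono i : (s 0%N <= s i)%N by elim: i => // i IH; exact: leq_trans (hs i).
elim: n => [|n IH]; first by rewrite !big_geq.
by rewrite big_nat_recr //= -IH -big_cat_nat.
Qed.

(** Consecutive ranges share one index; all but the last may be shortened by it, the terms being
    nonnegative. *)
Lemma sum_blocks_overlap (R : realType) (a : nat -> R) (s : nat -> nat) n :
  (forall x, 0 <= a x) -> (forall i, (s i <= s i.+1)%N) -> (0 < n)%N ->
  \sum_(s 0%N <= x < (s n).+1) a x <=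
  \sum_(0 <= i < n) \sum_(s i <= x < (s i.+1).+1) a x.
Proof.
move=> a0 hs; have mono i : (s 0%N <= s i)%N by elim: i => // i IH; exact: leq_trans (hs i).
case: n => // n _; rewrite big_nat_recr //= sum_blocks_disj // big_nat_recr //=.
rewrite [leRHS]big_nat_recr //= [X in _ <= _ + X]big_nat_recr ?hs //= -addrA lerD2r.
apply: ler_sum => i _; rewrite [leRHS]big_nat_recr ?hs //= lerDl //.
Qed.

Lemma comm_compl (R : realType) n (P Q : 'M[R[i]]_n) : P *m Q = Q *m P ->
  (1%:M - P) *m (1%:M - Q) = (1%:M - Q) *m (1%:M - P).
Proof.
move=> e; rewrite !mulmxBr !mulmx1 !mulmxBl !mul1mx e.
by apply/matrixP=> i j; rewrite !mxE; ring.
Qed.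

Section Cuts.
Variables (N r : nat).
Hypotheses (N3 : (2 < N)%N) (r5 : (r <= 5)%N).
Local Notation L := (6 * N + r)%N.
Local Notation M := (2 * N)%N.

(* The ring is cut at the points [cut k] into [2 N] steps of 3 or 4 sites per turn;
   the k-th block consists of the k-th step and the three sites following it. *)
Definition cut k := (L * (k %/ M) + (3 * (k %% M) + minn (k %% M) r))%N.
Definition len k := (cut k.+1 - cut k + 3)%N.

Lemma cutE q i : (i <= M)%N -> cut (q * M + i) = (L * q + (3 * i + minn i r))%N.
Proof.
have M0 : (0 < M)%N by lia.
rewrite leq_eqVlt => /orP[/eqP ->|iM]; last first.
  by rewrite /cut divnMDl // modnMDl divn_small // modn_small // addn0.
have -> : (q * M + M = q.+1 * M)%N by rewrite (mulSn q) addnC.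
rewrite /cut mulnK // modnMl (mulnS _ q); set X := (L * q)%N; lia.
Qed.

Lemma cut_decomp k : exists q i, (i < M)%N /\ k = (q * M + i)%N.
Proof.
by exists (k %/ M)%N, (k %% M)%N; rewrite -divn_eq ltn_pmod //; lia.
Qed.

Lemma cut_per k : cut (k + M) = (cut k + L)%N.
Proof.
have [q [i [iM ->]]] := cut_decomp k.
have -> : (q * M + i + M = q.+1 * M + i)%N by rewrite (mulSn q) addnAC (addnC M).
by rewrite !cutE ?(ltnW iM) // (mulnS _ q); set X := (L * q)%N; lia.
Qed.

Lemma cut_step k : cut k.+1 = (cut k + 3)%N \/ cut k.+1 = (cut k + 4)%N.
Proof.
have [q [i [iM ->]]] := cut_decomp k; rewrite -addnS !cutE ?(ltnW iM) //.
by set X := (L * q)%N; case: (ltnP i r) => ir; [right|left]; lia.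
Qed.

Lemma cut_le k : (cut k <= cut k.+1)%N.
Proof. by case: (cut_step k) => ->; rewrite leq_addr. Qed.

Lemma cut_mono i j : (i <= j)%N -> (cut i <= cut j)%N.
Proof.
move=> ij; rewrite -(subnK ij); elim: (j - i)%N => [|m IH] //=.
by apply: leq_trans IH _; rewrite addSn; exact: cut_le.
Qed.

(** In less than one turn at most [r] of the steps have four sites, and the others have three. *)
Lemma cut_len n k : (n < M)%N -> exists2 j, (j <= 5)%N & cut (k + n) = (cut k + (3 * n + j))%N.
Proof.
move=> nM; have [q [i [iM ->]]] := cut_decomp k; rewrite -addnA (cutE _ (ltnW iM)).
case: (leqP (i + n) M) => h.
  exists (minn (i + n) r - minn i r)%N; first lia.
  by rewrite cutE //; set X := (L * q)%N; lia.
have -> : (q * M + (i + n) = q.+1 * M + (i + n - M))%N by rewrite (mulSn q); set X := (q * M)%N; lia.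
rewrite cutE; last lia.
rewrite (mulnS _ q); exists (r + minn (i + n - M) r - minn i r)%N; first lia.
by set X := (L * q)%N; lia.
Qed.

Lemma len67 k : len k = 6 \/ len k = 7.
Proof. by rewrite /len; case: (cut_step k) => ->; [left|right]; rewrite addKn. Qed.

Lemma len_per k : len (k + M) = len k.
Proof. by rewrite /len -addSn !cut_per; lia. Qed.

(** A block extends three sites past its own step, which the next step, of at least three sites,
    contains. *)
Lemma cut_disjoint i j a b : (i + 2 <= j)%N -> (j + 2 <= i + M)%N ->
  (a < len i)%N -> (b < len j)%N -> cut i + a != cut j + b %[mod L].
Proof.
move=> ij ji la lb; apply: neq_mod_lt.
have h1 : (cut i.+2 <= cut j)%N by apply: cut_mono; rewrite -addn2.
have h3 : (cut j.+2 <= cut (i + M))%N by apply: cut_mono; rewrite -addn2.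
rewrite cut_per in h3; rewrite /len in la lb.
by case: (cut_step i.+1) => e1; case: (cut_step j.+1) => e2;
   have := cut_le i; have := cut_le j; lia.
Qed.

Lemma cut0 : cut 0 = 0%N.
Proof. by rewrite /cut div0n mod0n muln0 min0n. Qed.

Lemma cutM : cut M = L. Proof. by have := cut_per 0; rewrite cut0. Qed.

End Cuts.

Section BlockSums.
Variables (R : realType) (N r : nat) (kappa : R) (a b : nat -> R).
Hypotheses (N3 : (2 < N)%N) (r5 : (r <= 5)%N) (k0 : 0 <= kappa)
  (a0 : forall x, 0 <= a x) (b0 : forall x, 0 <= b x).
Local Notation cut := (cut N r).

(** The energy of block k in terms of the interaction energies. The [b] terms, of range four, are
    partitioned by the blocks; an [a] term, of range three, that starts at a cut belongs to two of
    them. *)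
Definition block_sum k :=
  \sum_(cut k <= x < (cut k.+1).+1) a x + kappa * \sum_(cut k <= x < cut k.+1) b x.

Lemma block_sum_ge l m : (0 < m)%N ->
  \sum_(cut l <= x < (cut (l + m)).+1) a x + kappa * \sum_(cut l <= x < cut (l + m)) b x
  <= \sum_(0 <= i < m) block_sum (l + i).
Proof.
move=> m0; rewrite /block_sum big_split /= -mulr_sumr.
have cl i : (cut (l + i) <= cut (l + i.+1))%N by rewrite addnS; exact: cut_le.
have := @sum_blocks_overlap R a (fun i => cut (l + i)) m a0 cl m0.
have := @sum_blocks_disj R b (fun i => cut (l + i)) m cl.
rewrite addn0 => -> ha; apply: lerD; last first.
  by apply: ler_wpM2l => //; apply: ler_sum => i _; rewrite addnS.
by apply: (le_trans ha); apply: ler_sum => i _; rewrite addnS.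
Qed.

(** The factor 2 pays for the [a] terms at the cuts, which two blocks contain. *)
Lemma ring_sum_le : (forall x, a (x + (6 * N + r))%N = a x) ->
  \sum_(0 <= k < 2 * N) block_sum k <=
  2 * (\sum_(0 <= x < 6 * N + r) a x + kappa * \sum_(0 <= x < 6 * N + r) b x).
Proof.
move=> aper; rewrite /block_sum big_split /= -mulr_sumr.
have e0 := @sum_blocks_disj R b cut (2 * N) (cut_le N3 r5); rewrite cut0 cutM // in e0.
have e1 := @sum_blocks_disj R a cut (2 * N) (cut_le N3 r5); rewrite cut0 cutM // in e1.
rewrite -e0 mulrDr; apply: lerD; last first.
  by rewrite mulr_natl mulr2n lerDl mulr_ge0 ?sumr_ge0.
(* The second copy of the ring sum starts at [cut 1], so that its i-th piece begins with the term
   that block i repeats. *)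
have e2 : \sum_(0 <= x < 6 * N + r) a x =
    \sum_(0 <= i < 2 * N) \sum_(cut i.+1 <= x < cut i.+2) a x.
  rewrite -(@sum_blocks_disj R a (fun i => cut i.+1) (2 * N) (fun i => cut_le N3 r5 i.+1)).
  rewrite -[(2 * N).+1]add1n cut_per // -{1}[cut 1]add0n big_addn addKn.
  by rewrite (periodic_sum_shift (cut 1) aper).
rewrite mulr_natl mulr2n {1}e1 e2 -big_split /=; apply: ler_sum => i _.
rewrite big_nat_recr ?cut_le //= lerD2l.
have : (cut i.+1 < cut i.+2)%N by case: (cut_step N3 r5 i.+1) => ->; rewrite -[ltnLHS]addn0 ltn_add2l.
by move=> hlt; rewrite big_ltn // lerDl sumr_ge0.
Qed.

End BlockSums.

(** * Gap and norm of local Hamiltonians *)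

Section Local.
Variables (R : realType) (kappa : R) (lam : R[i]).
Hypothesis kappa_gt0 : 0 < kappa.
Local Notation Hl := (Hloc kappa lam).

Lemma herm_Hloc L s l : (0 < L)%N -> herm (Hl L s l).
Proof. by move=> L0; exact: (herm_Hsum kappa lam L0). Qed.

Lemma psd_Hloc L s l : (0 < L)%N -> psd (Hl L s l).
Proof. by move=> L0; exact: psd_Hsum. Qed.

Lemma gapge_Hloc L s l : (0 < l <= L)%N -> gapge (Hl L s l) (gap (Hopen kappa lam l)).
Proof.
move=> /andP[l0 lL]; have L0 := leq_trans l0 lL.
apply: eig_gapge; first exact: herm_Hloc.
move=> mu /(eigv_Hloc L0 lL); apply: gapge_eig; first exact: (herm_Hloc 0 l l0).
apply: gap_gapge; [exact: (herm_Hloc 0 l l0) | exact: (psd_Hloc 0 l l0)].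
Qed.

Lemma eig_Hloc_le L s l mu : (0 < l <= L)%N -> eigv (Hl L s l) mu ->
  mu <= opnorm (Hopen kappa lam l).
Proof.
move=> /andP[l0 lL] /(eigv_Hloc (leq_trans l0 lL) lL); apply: eig_le_opnorm.
  exact: (herm_Hloc 0 l l0).
exact: (psd_Hloc 0 l l0).
Qed.

Lemma gap_Hopen_ge0 l : (0 < l)%N -> 0 <= gap (Hopen kappa lam l).
Proof. by move=> l0; apply: gap_ge0; exact: (psd_Hloc 0 l l0). Qed.

(** The basis state with particles exactly at the sites 0 and 2 has a positive density
    interaction. *)
Lemma Hsum_neq0 L b c d : (2 < L)%N -> (0 < b)%N -> Hsum kappa lam L 0 b c d != 0.
Proof.
move=> L3 b0; have L0 : (0 < L)%N by lia.
apply/eqP => h.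
pose S : {set 'I_L} := finset (fun k : 'I_L => ((k : nat) == 0) || ((k : nat) == 2))%N.
pose psi : vec R L := mkv (fun T => (T == S)%:R).
have /(ker_Hsum _ L0 _ _ _ _ _ kappa_gt0) [/(_ 0%N) h0 _] : Hsum kappa lam L 0 b c d *m psi = 0.
  by rewrite h mul0mx.
have := congr1 (fun v => amp v S) (h0 b0).
rewrite (amp_nn L0) amp_mkv amp0 eqxx mulr1 !inE !siteE //= => /eqP.
by rewrite oner_eq0.
Qed.

End Local.

(** * The finite-size criterion for the periodic gap *)

Section PeriodicGap.
Variables (R : realType) (kappa : R) (lam : R[i]).
Hypothesis kappa_gt0 : 0 < kappa.
Variables (n N r : nat) (gam Gam g : R).
Hypotheses (n2 : (2 <= n)%N) (nN : (n < N)%N) (r5 : (r <= 5)%N)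
  (gam0 : 0 <= gam) (Gam0 : 0 < Gam)
  (gam6 : gam <= gap (Hopen kappa lam 6)) (gam7 : gam <= gap (Hopen kappa lam 7))
  (Gam6 : opnorm (Hopen kappa lam 6) <= Gam) (Gam7 : opnorm (Hopen kappa lam 7) <= Gam)
  (hg : forall j, (j <= 5)%N -> g <= gap (Hopen kappa lam (3 * n.+1 + j)))
  (g0 : 0 <= g).

Let L := (6 * N + r)%N.
Let M := (2 * N)%N.
Let N3 : (2 < N)%N. Proof. exact: leq_ltn_trans n2 nN. Qed.
Let L0 : (0 < L)%N. Proof. by rewrite /L addn_gt0 muln_gt0 (ltn_trans _ N3). Qed.
Local Notation cut := (cut N r).
Local Notation len := (len N r).
Let Hb k := Hloc kappa lam L (cut k) (len k).
Let h k : op R L := 1%:M - kerp (Hb k).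

Let hHb k : herm (Hb k). Proof. exact: herm_Hloc. Qed.
Let pHb k : psd (Hb k). Proof. exact: psd_Hloc. Qed.

Let hh k : herm (h k).
Proof. by rewrite /herm /h adjD adjN adj1 (herm_kerp (hHb k)). Qed.

Let h2 k : h k *m h k = h k.
Proof.
by rewrite /h mulmxBr mulmx1 mulmxBl mul1mx (kerp_idem (hHb k)) subrr subr0.
Qed.

Let hper k : h (k + M)%N = h k.
Proof.
have e : Hb (k + M) = Hb k.
  rewrite /Hb (len_per N3 r5) (cut_per N3 r5); apply: Hloc_mod; exact: modnDr.
by rewrite /h e.
Qed.

Let hcomm i j : (i + 2 <= j)%N -> (j + 2 <= i + M)%N -> h i *m h j = h j *m h i.
Proof.
move=> ij ji.
apply/comm_compl/kerp_comm2; [exact: hHb|exact: hHb|].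
by apply: comm_Hloc2 => // a b la lb; exact: cut_disjoint.
Qed.

Let rdot_h k v : rdot v (h k *m v) = rdot v v - rdot v (kerp (Hb k) *m v).
Proof. by rewrite mulmxBl mul1mx rdotBr. Qed.

Let lenL k : (0 < len k <= L)%N.
Proof. case: (len67 N3 r5 k) => -> /=; rewrite /L; move: N3; clear; lia. Qed.

Let Hb_ge k v : gam * rdot v (h k *m v) <= rdot v (Hb k *m v).
Proof.
rewrite rdot_h; apply: gapge_form => // w hw.
apply: le_trans (@gapge_Hloc R kappa lam kappa_gt0 L (cut k) _ (lenL k) _ hw).
apply: ler_wpM2r; first exact: rdot_ge0.
by case: (len67 N3 r5 k) => ->.
Qed.

Let Hb_le k v : rdot v (Hb k *m v) <= Gam * rdot v (h k *m v).
Proof.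
rewrite rdot_h; apply: form_le_kerp => // mu /(eig_Hloc_le kappa_gt0 (lenL k)) /le_trans; apply.
by case: (len67 N3 r5 k) => ->.
Qed.

Let a v x := rdot v (nn R L x *m v).
Let b v x := rdot v (qq lam L x *m v).

Let a0 v x : 0 <= a v x. Proof. exact: rdot_nn_ge0. Qed.
Let b0 v x : 0 <= b v x. Proof. exact: rdot_qq_ge0. Qed.

Let rdot_Hb k v : rdot v (Hb k *m v) = block_sum N r kappa (a v) (b v) k.
Proof.
rewrite rdot_Hsum.
have -> : (cut k + (len k - 2) = (cut k.+1).+1)%N by rewrite /len; move: (cut_le N3 r5 k); clear; lia.
by have -> : (cut k + (len k - 3) = cut k.+1)%N by rewrite /len; move: (cut_le N3 r5 k); clear; lia.
Qed.

Let sum_blocks_ge v l m : (0 < m)%N ->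
  \sum_(cut l <= x < (cut (l + m)).+1) a v x + kappa * \sum_(cut l <= x < cut (l + m)) b v x
  <= \sum_(0 <= i < m) rdot v (Hb (l + i) *m v).
Proof.
move=> m0; under [leRHS]eq_bigr do rewrite rdot_Hb.
by apply: block_sum_ge; [exact: N3|exact: r5|exact: ltW|exact: a0|exact: m0].
Qed.

Let A l := \sum_(0 <= i < n) h (l + i)%N.

Let rdot_A l v : rdot v (A l *m v) = \sum_(0 <= i < n) rdot v (h (l + i)%N *m v).
Proof. by rewrite /A mulmx_suml rdot_sumr. Qed.

Let rdot_h_ge0 k v : 0 <= rdot v (h k *m v).
Proof. by rewrite -(rdot_proj (hh k)) // rdot_ge0. Qed.

(** The n blocks fill an interval of 3 (n + 1) + j sites. Its kernel states are annihilated by every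
    block, so a vector orthogonal to ker (A l) is orthogonal to them, and on it g <= H of the
    interval <= sum of the blocks <= Gam (A l). *)
Let gapge_A l : gapge (A l) (g / Gam).
Proof.
move=> v hv; have nM : (n < 2 * N)%N by move: nN; clear; lia.
have [j j5 ej] := cut_len N3 r5 l nM.
have lenu : (0 < 3 * n.+1 + j <= L)%N by rewrite /L; move: nN n2 j5; clear; lia.
have hu : orthker (Hloc kappa lam L (cut l) (3 * n.+1 + j)) v.
  move=> w; rewrite -/(Hsum kappa lam L _ _ _ _) => /(ker_Hsum _ L0 _ _ _ _ _ kappa_gt0) [w1 w2].
  apply: hv; rewrite /A mulmx_suml big_seq; apply: big1 => i; rewrite mem_index_iota => hi.
  rewrite mulmxBl mul1mx kerp_id ?subrr //.
  have c1 : (cut l <= cut (l + i))%N by apply: cut_mono => //; move: hi; clear; lia.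
  have c2 : (cut (l + i).+1 <= cut (l + n))%N by apply: cut_mono => //; move: hi; clear; lia.
  apply/(ker_Hsum _ L0 _ _ _ _ _ kappa_gt0); split=> x hx; [apply: w1|apply: w2];
    by move: hx; rewrite /len; move: c1 c2 (cut_le N3 r5 (l + i)) ej; clear; lia.
have := @gapge_Hloc R kappa lam kappa_gt0 L (cut l) _ lenu _ hu.
rewrite -/(Hsum kappa lam L _ _ _ _) rdot_Hsum => h1.
have {}h1 : g * rdot v v <= \sum_(0 <= i < n) rdot v (Hb (l + i) *m v).
  apply: le_trans (sum_blocks_ge v l (_ : 0 < n)%N); last exact: ltnW.
  have e1 : (cut l + (3 * n.+1 + j - 2) = (cut (l + n)).+1)%N by move: ej; clear; lia.
  have e2 : (cut l + (3 * n.+1 + j - 3) = cut (l + n))%N by move: ej; clear; lia.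
  rewrite e1 e2 in h1; apply: le_trans h1; apply: ler_wpM2r; first exact: rdot_ge0.
  exact: hg.
rewrite rdot_A mulrAC ler_pdivrMr // [leRHS]mulrC mulr_sumr; apply: (le_trans h1).
by apply: ler_sum => i _; exact: Hb_le.
Qed.

Let psd_A l : psd (A l).
Proof. by move=> v; rewrite rdot_A; apply: sumr_ge0 => i _; exact: rdot_h_ge0. Qed.

Let herm_A l : herm (A l).
Proof. by rewrite /herm /A adj_sum; apply: eq_bigr => i _; exact: hh. Qed.

Let Ht := \sum_(0 <= k < M) h k.

Let rdot_Ht v : rdot v (Ht *m v) = \sum_(0 <= k < M) rdot v (h k *m v).
Proof. by rewrite /Ht mulmx_suml rdot_sumr. Qed.

Let gapge_Ht : gapge Ht ((n%:R * (g / Gam) - 1) / (n%:R - 1)).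
Proof.
have n1 : 0 < n%:R - 1 :> R by rewrite subr_gt0 ltr1n.
apply: sq_gapge; first by rewrite /herm /Ht adj_sum; apply: eq_bigr => i _; exact: hh.
  by move=> v; rewrite rdot_Ht; apply: sumr_ge0 => i _; exact: rdot_h_ge0.
move=> v; rewrite mulrAC ler_pdivrMr // [leRHS]mulrC.
apply: (@knabe_sq R _ n M h (g / Gam)) => //; [exact: ltnW|by rewrite /M leq_mul2l ltnW ?orbT|].
move=> l w; apply: psd_gapge_sq; [exact: herm_A|exact: psd_A|exact: gapge_A].
Qed.

Let rdot_Hper v : rdot v (Hper kappa lam L *m v) =
  \sum_(0 <= x < L) a v x + kappa * \sum_(0 <= x < L) b v x.
Proof. by rewrite HperE -/(Hsum kappa lam L _ _ _ _) rdot_Hsum. Qed.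

Let a_per v x : a v (x + L)%N = a v x.
Proof.
have e1 : cop R L (x + L) = cop R L x by apply: cop_mod; exact: modnDr.
have e2 : cop R L (x + L + 2) = cop R L (x + 2) by apply: cop_mod; rewrite addnAC modnDr.
by rewrite /a /nn /nop e1 e2.
Qed.

Let Hper_ge v : \sum_(0 <= k < M) rdot v (Hb k *m v) <= 2 * rdot v (Hper kappa lam L *m v).
Proof.
rewrite rdot_Hper; under [leLHS]eq_bigr do rewrite rdot_Hb.
by apply: ring_sum_le; [exact: N3|exact: r5|exact: ltW|exact: a0|exact: b0|exact: a_per].
Qed.

Let Hper_le v : rdot v (Hper kappa lam L *m v) <= \sum_(0 <= k < M) rdot v (Hb k *m v).
Proof.
have M0 : (0 < M)%N by rewrite muln_gt0 (ltn_trans _ N3).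
apply: le_trans (sum_blocks_ge v 0 M0); rewrite add0n cut0 (cutM N3 r5) rdot_Hper lerD2r.
by rewrite [leRHS]big_nat_recr //= lerDl.
Qed.

Lemma gap_Hper_ge :
  gam * n%:R / (2 * Gam * (n%:R - 1)) * (g - Gam / n%:R) <= gap (Hper kappa lam (6 * N + r)).
Proof.
have n1 : 0 < n%:R - 1 :> R by rewrite subr_gt0 ltr1n.
have n0 : 0 < n%:R :> R by rewrite ltr0n ltnW.
have hP : herm (Hper kappa lam L) by rewrite HperE; exact: (herm_Hsum kappa lam L0).
have pP : psd (Hper kappa lam L) by rewrite HperE; exact: psd_Hsum.
apply: gapge_le_gap => //; first by rewrite HperE; apply: Hsum_neq0 => //; rewrite /L; move: N3; clear; lia.
have -> : gam * n%:R / (2 * Gam * (n%:R - 1)) * (g - Gam / n%:R) =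
   gam / 2 * ((n%:R * (g / Gam) - 1) / (n%:R - 1)).
  by field; rewrite !gt_eqF.
move=> v hv.
(* The kernel of [Ht] lies in that of the periodic Hamiltonian, which is at most the sum of the
   blocks and hence at most Gam Ht. *)
have hv' : orthker Ht v.
  move=> w /(congr1 (rdot w)); rewrite rdot0r rdot_Ht => e; apply: hv.
  apply: (psd_ker hP pP); apply/eqP; rewrite eq_le pP andbT.
  apply: (le_trans (Hper_le w)).
  apply: le_trans (_ : Gam * \sum_(0 <= k < M) rdot w (h k *m w) <= 0).
    by rewrite mulr_sumr; apply: ler_sum => k _; exact: Hb_le.
  by rewrite e mulr0.
have h1 := gapge_Ht hv'.
have h3 : gam * rdot v (Ht *m v) <= 2 * rdot v (Hper kappa lam L *m v).
  apply: le_trans (Hper_ge v); rewrite rdot_Ht mulr_sumr.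
  by apply: ler_sum => k _; exact: Hb_ge.
have h4 := ler_wpM2l gam0 h1.
set c := (_ / _ : R) in h1 h4 *; rewrite [gam / 2 * c]mulrAC.
have -> : gam * c / 2 * rdot v v = gam * (c * rdot v v) / 2 by ring.
by rewrite ler_pdivrMr // mulrC (mulrC _ 2); apply: le_trans h3; rewrite mulrC.
Qed.

End PeriodicGap.

(** * Combinatorics of patterns, moves and chains *)

Section Configurations.
Local Open Scope nat_scope.
Implicit Types (s : nat -> bool).

(* The forbidden patterns 1?1, 11001, 10011 and 1100011: the configurations on at
   least 8 sites from which the moves 1001 <-> 0110 lead to two particles at distance 2. *)
Definition good s := forall y,
  [/\ ~ (s y /\ s (y + 2)), ~ [/\ s y, s (y + 1) & s (y + 4)],
      ~ [/\ s y, s (y + 3) & s (y + 4)] & ~ [/\ s y, s (y + 1), s (y + 5) & s (y + 6)]].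

Definition movable s x := [&& s x, s (x + 3), ~~ s (x + 1) & ~~ s (x + 2)].
Definition movable' s x := [&& s (x + 1), s (x + 2), ~~ s x & ~~ s (x + 3)].
Definition toggle x s : nat -> bool := fun y => s y (+) (x <= y <= x + 3).

Section Patterns.
Variable s : nat -> bool.
Hypothesis hg : good s.

Lemma pat2 a b : s a -> s b -> b = a + 2 -> False.
Proof. by move=> h1 h2 e; subst b; case: (hg a) => h _ _ _; exact: h. Qed.

Lemma pat5 a b c : s a -> s b -> s c -> b = a + 1 -> c = a + 4 -> False.
Proof. by move=> h1 h2 h3 e e'; subst b c; case: (hg a) => _ h _ _; exact: h. Qed.

Lemma pat5' a b c : s a -> s b -> s c -> b = a + 3 -> c = a + 4 -> False.
Proof. by move=> h1 h2 h3 e e'; subst b c; case: (hg a) => _ _ h _; exact: h. Qed.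

Lemma pat7 a b c d : s a -> s b -> s c -> s d -> b = a + 1 -> c = a + 5 -> d = a + 6 -> False.
Proof. by move=> h1 h2 h3 h4 e e' e''; subst b c d; case: (hg a) => _ _ _ h; exact: h. Qed.
End Patterns.

Lemma occ_neg s a b : s a -> ~~ s b -> a = b -> False.
Proof. by move=> h1 h2 e; subst b; rewrite h1 in h2. Qed.

Ltac alia := repeat match goal with
  | H : is_true (?s _) |- _ => is_var s; clear H
  | H : is_true (~~ ?s _) |- _ => is_var s; clear H
  | H : is_true (toggle _ _ _) |- _ => clear H
  | H : is_true (~~ toggle _ _ _) |- _ => clear H
  | H : is_true (movable _ _) |- _ => clear H
  | H : is_true (movable' _ _) |- _ => clear H
  end; lia.

(** Refutes a context in which the occupied sites form one of the four patterns, or in which a site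
    is both occupied and empty. *)
Ltac pats hg := exfalso; let s := match type of hg with good ?s => s end in
  solve [ alia | match goal with
  | H1 : is_true (s _), H2 : is_true (~~ s _) |- _ => apply (occ_neg H1 H2); alia
  | H1 : is_true (s _), H2 : is_true (s _) |- _ => apply (pat2 hg H1 H2); alia
  | H1 : is_true (s _), H2 : is_true (s _), H3 : is_true (s _) |- _ =>
      first [apply (pat5 hg H1 H2 H3); alia | apply (pat5' hg H1 H2 H3); alia]
  | H1 : is_true (s _), H2 : is_true (s _), H3 : is_true (s _), H4 : is_true (s _) |- _ =>
      apply (pat7 hg H1 H2 H3 H4); alia
  end ].

Lemma toggleK x s : toggle x (toggle x s) =1 s.
Proof. by move=> y; rewrite /toggle -addbA addbb addbF. Qed.

Lemma toggle_out x s y : (y < x) || (x + 3 < y) -> toggle x s y = s y.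
Proof. by move=> h; rewrite /toggle; (have -> : (x <= y <= x + 3) = false by lia); rewrite addbF. Qed.

Lemma toggle_in x s y : x <= y <= x + 3 -> toggle x s y = ~~ s y.
Proof. by move=> h; rewrite /toggle h addbT. Qed.

Lemma toggle_inv s x z : movable s x -> toggle x s z ->
  [\/ z = x + 1, z = x + 2 | s z /\ (z < x \/ x + 3 < z)].
Proof.
move=> /and4P[h0 h3 h1 h2]; case: (boolP (x <= z <= x + 3)) => hz.
  rewrite toggle_in // => sz.
  have nx : z <> x by move=> e; rewrite e h0 in sz.
  have nx3 : z <> x + 3 by move=> e; rewrite e h3 in sz.
  have [->|->] : z = x + 1 \/ z = x + 2 by lia.
    by constructor 1.
  by constructor 2.
by rewrite toggle_out; [constructor 3; split => //|]; lia.
Qed.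

Lemma toggle_inv' s x z : movable' s x -> toggle x s z ->
  [\/ z = x, z = x + 3 | s z /\ (z < x \/ x + 3 < z)].
Proof.
move=> /and4P[h1 h2 h0 h3]; case: (boolP (x <= z <= x + 3)) => hz.
  rewrite toggle_in // => sz.
  have nx : z <> x + 1 by move=> e; rewrite e h1 in sz.
  have nx3 : z <> x + 2 by move=> e; rewrite e h2 in sz.
  have [->|->] : z = x \/ z = x + 3 by lia.
    by constructor 1.
  by constructor 2.
by rewrite toggle_out; [constructor 3; split => //|]; lia.
Qed.

Lemma movable_toggle s x : movable (toggle x s) x = movable' s x.
Proof.
by rewrite /movable /movable' !toggle_in; lia.
Qed.

Lemma movable'_toggle s x : movable' (toggle x s) x = movable s x.
Proof.
by rewrite /movable /movable' !toggle_in; lia.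
Qed.

Ltac splits H := let H1 := fresh in let H2 := fresh in let H3 := fresh in
  case: H => [H1|H1|[H1 H2]].

(** Particles after the move are the two new ones or old ones outside the four sites; in each case a
    pattern after the move reveals a pattern, or an occupied empty site, before it. *)
Lemma good_toggle s x : good s -> movable s x -> good (toggle x s).
Proof.
move=> hg hm y; have /and4P[h0 h3 h1 h2] := hm.
split=> [[]|[]|[]|[]].
- move=> /(toggle_inv hm) A /(toggle_inv hm) B.
  splits A; splits B; pats hg.
- move=> /(toggle_inv hm) A /(toggle_inv hm) B /(toggle_inv hm) D.
  splits A; splits B; splits D; pats hg.
- move=> /(toggle_inv hm) A /(toggle_inv hm) B /(toggle_inv hm) D.
  splits A; splits B; splits D; pats hg.
move=> /(toggle_inv hm) A /(toggle_inv hm) B /(toggle_inv hm) D /(toggle_inv hm) E.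
splits A; splits B; try (exfalso; alia); splits D; try (exfalso; alia); splits E; pats hg.
Qed.

Lemma good_toggle' s x : good s -> movable' s x -> good (toggle x s).
Proof.
move=> hg hm y; have /and4P[h1 h2 h0 h3] := hm.
split=> [[]|[]|[]|[]].
- move=> /(toggle_inv' hm) A /(toggle_inv' hm) B.
  splits A; splits B; pats hg.
- move=> /(toggle_inv' hm) A /(toggle_inv' hm) B /(toggle_inv' hm) D.
  splits A; splits B; splits D; pats hg.
- move=> /(toggle_inv' hm) A /(toggle_inv' hm) B /(toggle_inv' hm) D.
  splits A; splits B; splits D; pats hg.
move=> /(toggle_inv' hm) A /(toggle_inv' hm) B /(toggle_inv' hm) D /(toggle_inv' hm) E.
splits A; splits B; try (exfalso; alia); splits D; try (exfalso; alia); splits E; pats hg.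
Qed.

(* Number of monomers of the spacing-3 chain that ends at site [p] and extends to
   the left, a dimer at [p - 2], [p - 1] counting for two monomers. *)
Fixpoint chain s p : nat :=
  match p with
  | p1.+3 => if s p then (chain s p1).+1
             else if s p1.+2 && s p1.+1 then (if p1 is p2.+3 then chain s p2 else 0).+2
             else 0
  | _ => s p
  end.

Lemma chainE s p : chain s (p + 3) = if s (p + 3) then (chain s p).+1
   else if s (p + 2) && s (p + 1) then (if p < 3 then 0 else chain s (p - 3)).+2 else 0.
Proof. by rewrite !addnS !addn0; case: p => [|[|[|p]]] //=; rewrite !subSS subn0. Qed.

Lemma chain_small s p : p < 3 -> chain s p = s p.
Proof. by case: p => [|[|[|p]]]. Qed.

Lemma eq_chain s s' p : (forall y, y <= p -> s y = s' y) -> chain s p = chain s' p.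
Proof.
elim/ltn_ind: p => p IH h.
case: (ltnP p 3) => p3; first by rewrite !chain_small // h.
have e : p = p - 3 + 3 by lia.
rewrite e !chainE -e !h; [|lia..].
case: ifP => _; first by rewrite (IH (p - 3)) //; [lia|move=> y hy; apply: h; lia].
case: ifP => // _; case: ltnP => // h3.
by rewrite (IH (p - 3 - 3)) //; [lia|move=> y hy; apply: h; lia].
Qed.

Lemma chain_occ s p : s p -> chain s p = (if p < 3 then 0 else chain s (p - 3)).+1.
Proof.
move=> sp; case: ltnP => p3; first by rewrite chain_small // sp.
by (have e : p = p - 3 + 3 by lia); rewrite {1}e chainE -e sp.
Qed.

Lemma chain_dimer s p : 3 <= p -> ~~ s p -> s (p - 1) -> s (p - 2) ->
  chain s p = (if p < 6 then 0 else chain s (p - 6)).+2.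
Proof.
move=> p3 sp s1 s2; have e : p = p - 3 + 3 by lia.
rewrite {1}e chainE -e (negPf sp).
have -> : p - 3 + 2 = p - 1 by lia.
have -> : p - 3 + 1 = p - 2 by lia.
rewrite s1 s2 /=; congr (_.+2).
by (have -> : p - 3 - 3 = p - 6 by lia); have -> : (p - 3 < 3) = (p < 6) by lia.
Qed.

Lemma chain_gt0 s p : 0 < chain s p -> s p \/ [/\ 3 <= p, ~~ s p, s (p - 1) & s (p - 2)].
Proof.
case: (ltnP p 3) => p3; first by rewrite chain_small //; case: (s p); [left|].
(have e : p = p - 3 + 3 by lia); rewrite {1}e chainE -e.
have -> : p - 3 + 2 = p - 1 by lia.
have -> : p - 3 + 1 = p - 2 by lia.
by case: ifP => [|/negbT] sp; [left|case: ifP => // /andP[]; right].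
Qed.

Lemma chain_ge2 s p : 2 <= chain s p ->
  [\/ [/\ 3 <= p, ~~ s p, s (p - 1) & s (p - 2)], [/\ 3 <= p, s p & s (p - 3)] |
      [/\ 6 <= p, s p, ~~ s (p - 3), s (p - 4) & s (p - 5)]].
Proof.
move=> h; have /chain_gt0 [sp|?] : 0 < chain s p by lia.
  have := h; rewrite chain_occ //; case: (ltnP p 3) => p3 // hc.
  have /chain_gt0 : 0 < chain s (p - 3) by exact: hc.
  move=> [?|[? ? s1 s2]]; first by constructor 2.
  constructor 3; split => //; first lia.
    by move: s1; have -> : p - 3 - 1 = p - 4 by lia.
  by move: s2; have -> : p - 3 - 2 = p - 5 by lia.
by constructor 1.
Qed.

(** If the move ends at [p] it replaces the two last monomers by a dimer, counted alike. If it ends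
    before [p], the patterns keep it off the last unit and induction applies, or both chains are
    empty. *)
Lemma chain_toggle s x p : good s -> movable s x -> x + 3 <= p ->
  chain (toggle x s) p = chain s p.
Proof.
move=> hg hm; have /and4P[h0 h3 h1 h2] := hm.
elim/ltn_ind: p => p IH xp.
case: (ltngtP p (x + 3)) => [|xp'|->]; first lia.
  have p3 : 3 <= p by lia.
  case: (boolP (s p)) => sp.
    case: (leqP (x + 3) (p - 3)) => hx; last first.
      by (have [e|e] : x + 3 = p - 2 \/ x + 3 = p - 1 by lia); pats hg.
    have tp : toggle x s p by rewrite toggle_out ?sp //; lia.
    rewrite (chain_occ tp) (chain_occ sp) ltnNge p3 /= IH //; alia.
  have tp : ~~ toggle x s p by rewrite toggle_out ?sp //; lia.
  case: (boolP (s (p - 1) && s (p - 2))) => [/andP[s1 s2]|s12].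
    have hx : x + 3 < p - 5.
      rewrite ltnNge; apply/negP => hx.
      by (have [e|[e|[e|[e|e]]]] : x + 3 = p - 5 \/ x + 3 = p - 4 \/ x + 3 = p - 3
          \/ x + 3 = p - 2 \/ x + 3 = p - 1 by lia); pats hg.
    have t1 : toggle x s (p - 1) by rewrite toggle_out ?s1 //; alia.
    have t2 : toggle x s (p - 2) by rewrite toggle_out ?s2 //; alia.
    rewrite (chain_dimer p3 tp t1 t2) (chain_dimer p3 sp s1 s2) ltnNge.
    have -> /= : 6 <= p by alia.
    by rewrite IH //; alia.
  have -> : chain s p = 0.
    case: (posnP (chain s p)) => // /chain_gt0 [sp'|[_ _ s1 s2]]; first by rewrite sp' in sp.
    by rewrite s1 s2 in s12.
  case: (posnP (chain (toggle x s) p)) => // /chain_gt0 [tp'|[_ _ t1 t2]].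
    by rewrite tp' in tp.
  case/nandP: s12 => s12; splits (toggle_inv hm t1); splits (toggle_inv hm t2); pats hg.
have e3 : x + 3 - 3 = x by lia.
have t0 : ~~ toggle x s (x + 3) by rewrite toggle_in ?h3 //; lia.
have t1 : toggle x s (x + 3 - 1).
  by (have -> : x + 3 - 1 = x + 2 by lia); rewrite toggle_in ?h2 //; lia.
have t2 : toggle x s (x + 3 - 2).
  by (have -> : x + 3 - 2 = x + 1 by lia); rewrite toggle_in ?h1 //; lia.
rewrite (chain_dimer _ t0 t1 t2); last alia.
rewrite (chain_occ h3) e3 (chain_occ h0).
have -> : (x + 3 < 3) = false by alia.
congr (_.+2).
have -> : (x + 3 < 6) = (x < 3) by lia.
case: ltnP => // x3; have -> : x + 3 - 6 = x - 3 by lia.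
by apply: eq_chain => y hy; rewrite toggle_out //; lia.
Qed.

(** A move that straddles the end [t] never involves a chain of length two or more ending there, so
    such chains are stable under all moves. *)
Lemma chain_toggle_lt2 s x t : good s -> movable s x -> t < x + 3 <= t + 2 ->
  chain s t < 2 /\ chain (toggle x s) t < 2.
Proof.
move=> hg hm hx; have /and4P[h0 h3 h1 h2] := hm.
have ht : x + 2 = t \/ x + 1 = t by lia.
split; rewrite ltnNge; apply/negP.
  by case: ht => ht /chain_ge2 [[? ? ? ?]|[? ? ?]|[? ? ? ? ?]]; pats hg.
have hg' := good_toggle hg hm.
have t1 : toggle x s (x + 1) by rewrite toggle_in ?h1 //; lia.
have t2 : toggle x s (x + 2) by rewrite toggle_in ?h2 //; lia.
by case: ht => ht /chain_ge2 [[? ? ? ?]|[? ? ?]|[? ? ? ? ?]]; pats hg'.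
Qed.

Lemma chain_movable s x t : good s -> movable s x -> t <= x + 5 -> x + 3 < t -> chain s t = 0.
Proof.
move=> hg hm h5 h4; have /and4P[h0 h3 h1 h2] := hm.
have ht : t = x + 4 \/ t = x + 5 by lia.
by case: (posnP (chain s t)) => // /chain_gt0 [?|[? ? ? ?]]; case: ht => ht; pats hg.
Qed.

(** Hence a good configuration has at most one of the three ends e, e + 1, e + 2, and the sectors
    are disjoint. *)
Lemma chain_end_uniq s t t' : good s -> t < t' <= t + 2 ->
  2 <= chain s t -> 2 <= chain s t' -> False.
Proof.
move=> hg h; have ht : t' = t + 1 \/ t' = t + 2 by lia.
move=> /chain_ge2 [[? ? ? ?]|[? ? ?]|[? ? ? ? ?]]
   /chain_ge2 [[? ? ? ?]|[? ? ?]|[? ? ? ? ?]]; case: ht => ht; pats hg.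
Qed.

Definition mono k s t := all (fun j => (3 * j <= t) && s (t - 3 * j)) (iota 0 k).

Lemma monoS k s t : mono k.+1 s t = mono k s t && ((3 * k <= t) && s (t - 3 * k)).
Proof. by rewrite /mono -[k.+1]addn1 iotaD all_cat /= andbT add0n. Qed.

Lemma monoP k s t : reflect (forall j, j < k -> 3 * j <= t /\ s (t - 3 * j)) (mono k s t).
Proof.
apply: (iffP allP) => [h j jk|h j]; first by apply/andP; apply: h; rewrite mem_iota.
by rewrite mem_iota => /= /h [-> ->].
Qed.

Lemma mono_chain k s t : mono k s t ->
  chain s t = k + (if 3 * k <= t then chain s (t - 3 * k) else 0).
Proof.
elim: k => [|k IH]; first by rewrite muln0 subn0 add0n.
rewrite monoS => /andP[/IH -> /andP[kt sk]]; rewrite kt /= (chain_occ sk) addnS addSn.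
have -> : t - 3 * k - 3 = t - 3 * k.+1 by lia.
case: (leqP (3 * k.+1) t) => h.
  by have -> : (t - 3 * k < 3) = false by alia.
by have -> : (t - 3 * k < 3) = true by alia.
Qed.

Lemma mono_toggle k s t x : (forall j, j < k -> x + 3 < t - 3 * j) ->
  mono k (toggle x s) t = mono k s t.
Proof.
move=> h; apply: eq_in_all => j; rewrite mem_iota => /= jk.
by rewrite toggle_out // h // orbT.
Qed.

End Configurations.

(** * Overlap of kernel states within a sector *)

Lemma Re_amgm (R : realType) (c k : R) (z w : R[i]) : 0 < k ->
  2 * (c * complex.Re (Num.conj z * w)) <= k * sqmod z + c ^+ 2 / k * sqmod w.
Proof.
move=> k0; have -> : complex.Re (Num.conj z * w) =
  complex.Re z * complex.Re w + complex.Im z * complex.Im w.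
  by case: z w => a b [a' b'] /=; ring.
rewrite -(ler_pM2l k0) [leRHS]mulrDr [k * (_ / k * _)]mulrA [k * (c ^+ 2 / k)]mulrC divfK ?gt_eqF //.
rewrite /sqmod; case: z w => a b [a' b'] /=.
have h1 := sqr_ge0 (k * a - c * a'); have h2 := sqr_ge0 (k * b - c * b'); nra.
Qed.

(** Here B1 to B4 stand for beta (m - 1) to beta (m - 4), and B1 + r B2 for beta m. The left side
    collects the constants of the two arithmetic-geometric estimates; the right side is f_m times
    the squared norm of [psi] on the sector. *)
Lemma overlap_identity (R : realType) (r B1 B2 B3 B4 X : R) :
  0 < r -> 0 < B1 -> 0 < B2 -> 0 < B3 ->
  (1 - B1 / B2) ^+ 2 / (1 + r) * (r * B4 * X) + (1 + r - B1 / B2) ^+ 2 / (1 + 2 * r) * (B3 * X) =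
  r * (B1 / (B1 + r * B2)) * (B3 / B2) *
    ((1 - B2 / B1 * (1 + r)) ^+ 2 / (1 + 2 * r) + B4 / B3 * (r * (1 - B2 / B1) ^+ 2 / (1 + r))) *
  (B1 * X + (B1 / B2) ^+ 2 / r * (B2 * X)).
Proof.
move=> r0 g1 g2 g3; have g4 : 0 < B1 + r * B2 by rewrite addr_gt0 // mulr_gt0.
have g5 : 0 < 1 + r by lra.
have g6 : 0 < 1 + 2 * r by lra.
by field; rewrite !gt_eqF.
Qed.

Section Overlap.
Variables (R : realType) (lam : R[i]) (L b e : nat).
Local Notation C := R[i].
Local Notation r := (sqmod lam).
Hypothesis bL : (b <= L)%N.
Implicit Types (S : {set 'I_L}) (x : nat).

Definition tog x S : {set 'I_L} := finset (fun k : 'I_L => (k \in S) (+) (x <= k <= x + 3)%N).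
(** Sites from [b] on are spectators: the patterns ignore them and no move under consideration
    touches them. *)
Definition ob S : nat -> bool := fun y => oc S y && (y < b)%N.

Lemma togK x : involutive (tog x).
Proof. by move=> S; apply/setP=> k; rewrite !inE -addbA addbb addbF. Qed.

Lemma togC x y S : tog x (tog y S) = tog y (tog x S).
Proof. by apply/setP=> k; rewrite !inE addbAC. Qed.

Lemma ob_tog x S : (x + 3 < b)%N -> ob (tog x S) = toggle x (ob S).
Proof.
move=> xb; apply: funext => y; rewrite /ob /toggle.
case: (ltnP y b) => yb; last first.
  by rewrite !andbF /=; have -> : (x <= y <= x + 3)%N = false by lia.
have yL : (y < L)%N by lia.
have := ocE (tog x S) (Ordinal yL); have := ocE S (Ordinal yL); rewrite /= => -> ->.
by rewrite inE /= !andbT.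
Qed.

Hypotheses (be3 : b = (e + 3)%N) (e8 : (8 <= e)%N).

(** Total weight of the tilings of k units by monomers of weight 1 and dimers of weight [r]. *)
Fixpoint beta (k : nat) : R :=
  match k with k1.+1 => if k1 is k2.+1 then beta k1 + r * beta k2 else 1 | 0 => 1 end.

Lemma betaE k : beta k.+2 = beta k.+1 + r * beta k. Proof. by []. Qed.

Lemma beta_ge1 k : 1 <= beta k.
Proof.
elim/ltn_ind: k => [[|[|k]] IH] //; rewrite betaE.
by have := IH k.+1 (leqnn _); have := IH k (leqnSn _); have := sqmod_ge0 lam; nra.
Qed.

Lemma lamE : Num.conj lam * lam = r%:C. Proof. exact: sqmodE. Qed.

Section Sector.
Variables (t m : nat).
Hypotheses (te : (e <= t < b)%N) (m2 : (2 <= m)%N).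

Definition sect S := `[< good (ob S) >] && (chain (ob S) t == m).
Definition layer k S := sect S && mono k (ob S) t.

Ltac plia := repeat match goal with
  | H : is_true (ob _ _) |- _ => clear H
  | H : is_true (~~ ob _ _) |- _ => clear H
  | H : is_true (movable _ _) |- _ => clear H
  | H : is_true (movable' _ _) |- _ => clear H
  | H : is_true (layer _ _) |- _ => clear H
  | H : is_true (sect _) |- _ => clear H
  end; lia.

Lemma sect_tog S x : (x + 3 < b)%N -> movable (ob S) x -> sect (tog x S) = sect S.
Proof.
move=> xb hm; rewrite /sect ob_tog //.
case: (asboolP (good (ob S))) => hg.
  rewrite (asboolT (good_toggle hg hm)) /=; case: (leqP (x + 3) t) => xt.
    by rewrite chain_toggle.
  have tx : (t < x + 3 <= t + 2)%N by plia.
  have [h1 h2] := chain_toggle_lt2 hg hm tx.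
  by rewrite !ltn_eqF //; apply: leq_trans m2.
rewrite asboolF // => hg'; apply: hg.
have := good_toggle' hg'; move=> /(_ x); rewrite movable'_toggle => /(_ hm).
by congr good; apply: funext => y; rewrite toggleK.
Qed.

Lemma sectP S : sect S -> good (ob S) /\ chain (ob S) t = m.
Proof. by case/andP => /asboolP hg /eqP. Qed.

Lemma layer1 S : layer 1 S = sect S && ob S t.
Proof. by rewrite /layer /mono /= muln0 subn0 andbT. Qed.

Lemma layer_sect k S : layer k S -> sect S. Proof. by case/andP. Qed.

Lemma layerW k S : (0 < k)%N -> layer k S -> layer 1 S.
Proof.
move=> k0 /andP[d /monoP mo]; rewrite layer1 d /=.
by have [_] := mo 0%N k0; rewrite muln0 subn0.
Qed.

Lemma good_movable (s : nat -> bool) x : good s -> s x -> s (x + 3)%N -> movable s x.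
Proof.
move=> hg s0 s3; rewrite /movable s0 s3 /=.
apply/andP; split; apply/negP => h.
  by apply: (pat2 hg h s3); rewrite -addnA.
exact: (pat2 hg s0 h).
Qed.

Lemma layer_rest k S : (k < m)%N -> layer k S ->
  (3 * k <= t)%N /\ chain (ob S) (t - 3 * k) = (m - k)%N.
Proof.
move=> km /andP[/sectP[_ hc] /mono_chain]; rewrite hc.
by case: ifP => [h -> |_]; [split => //|]; plia.
Qed.

Lemma layerS2 k S : (3 * k.+1 <= t)%N -> layer k.+2 S =
  [&& layer k S, ob S (t - 3 * k) & ob S (t - 3 * k.+1)].
Proof.
move=> h; rewrite /layer !monoS h.
have -> : (3 * k <= t)%N by plia.
by rewrite /= !andbA.
Qed.

(** If the unit following the last k monomers is not a monomer it is a dimer, and undoing that dimer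
    is a bijection onto layer k + 2. *)
Lemma layer_tog k S : (k + 2 <= m)%N ->
  layer k (tog (t - 3 * k.+1) S) && ~~ ob (tog (t - 3 * k.+1) S) (t - 3 * k) = layer k.+2 S.
Proof.
move=> km; set x := (t - 3 * k.+1)%N.
have xk : (3 * k.+1 <= t)%N -> (t - 3 * k = x + 3)%N by rewrite /x; plia.
have xb : (x + 3 < b)%N by rewrite /x; plia.
have lx : (3 * k.+1 <= t)%N -> forall j, (j < k)%N -> (x + 3 < t - 3 * j)%N.
  by move=> h j jk; rewrite /x; plia.
apply/idP/idP => [/andP[hl hn]|hl].
  have km' : (k < m)%N by plia.
  have [k3 hc] := layer_rest km' hl.
  have [hg _] := sectP (layer_sect hl).
  have : (2 <= chain (ob (tog x S)) (t - 3 * k))%N by rewrite hc; plia.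
  case/chain_ge2 => [[p3 _ s1 s2]|[_ sp _]|[_ sp _ _ _]]; try by rewrite sp in hn.
  have kt : (3 * k.+1 <= t)%N by plia.
  have e1 : (t - 3 * k - 1 = x + 2)%N by rewrite /x; plia.
  have e2 : (t - 3 * k - 2 = x + 1)%N by rewrite /x; plia.
  rewrite e1 in s1; rewrite e2 in s2; rewrite (xk kt) in hn *.
  have hm' : movable' (ob (tog x S)) x.
    rewrite /movable' s1 s2 hn andbT /=; apply/negP => s0; exact: (pat2 hg s0 s1).
  have hm : movable (ob S) x by rewrite -movable'_toggle -ob_tog.
  rewrite layerS2 // -/x (xk kt); case/and4P: (hm) => -> -> _ _; rewrite !andbT /layer.
  rewrite -(sect_tog xb hm) (layer_sect hl) /=.
  by rewrite -(mono_toggle _ (lx kt)) -ob_tog //; case/andP: hl.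
have kt : (3 * k.+1 <= t)%N.
  by case/andP: (hl) => _ /monoP/(_ k.+1 (leqnn _)) [].
move: (hl); rewrite layerS2 // -/x (xk kt) => /and3P[hk s3 s0].
have [hg _] := sectP (layer_sect hl).
have hm := good_movable hg s0 s3.
rewrite /layer sect_tog // (layer_sect hl) /= ob_tog // mono_toggle; last exact: lx.
case/andP: hk => _ -> /=; rewrite toggle_in ?s3 //; plia.
Qed.

Lemma layer_step k (H : {set 'I_L} -> R) c : (k + 2 <= m)%N ->
  (forall S, layer k.+2 S -> H (tog (t - 3 * k.+1) S) = c * H S) ->
  \sum_(S | layer k S) H S = \sum_(S | layer k.+1 S) H S + c * \sum_(S | layer k.+2 S) H S.
Proof.
move=> km hH.
rewrite (bigID (fun S => ob S (t - 3 * k))) /=; congr (_ + _).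
  apply: eq_bigl => S; rewrite /layer monoS andbA -/(layer k S).
  case: (boolP (layer k S)) => //= /layer_rest; rewrite (_ : (k < m)%N); last plia.
  by move=> /(_ isT) [-> _].
rewrite (reindex_inj (inv_inj (togK (t - 3 * k.+1)))) /= mulr_sumr.
by apply: eq_big => [S|S]; rewrite layer_tog // => /hH.
Qed.

(** One remaining unit cannot be a dimer, which counts for two. *)
Lemma layer_last S : layer m.-1 S = layer m S.
Proof.
have m0 : m = m.-1.+1 by plia.
rewrite [in RHS]m0 /layer monoS andbA -/(layer m.-1 S).
case: (boolP (layer m.-1 S)) => //= hl.
have mm : (m.-1 < m)%N by plia.
have [h hc] := layer_rest mm hl; rewrite h /=.
have : (0 < chain (ob S) (t - 3 * m.-1))%N by rewrite hc; plia.
case/chain_gt0 => [->//|[h3 h0 h1 h2]].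
by have := chain_dimer h3 h0 h1 h2; rewrite hc; plia.
Qed.

(** The moves that spare the monomer at [t]. They all lie within the first [e] sites, because t < e
    + 3, so a kernel state of those sites obeys them. *)
Definition relR (H : {set 'I_L} -> R) := forall S x, layer 1 S -> (x + 3 + 3 <= t)%N ->
  movable (ob S) x -> H (tog x S) = r * H S.

Lemma layer_tog_rel k (H : {set 'I_L} -> R) S : (0 < k)%N -> relR H -> layer k.+2 S ->
  H (tog (t - 3 * k.+1) S) = r * H S.
Proof.
move=> k0 hH hl.
have kt : (3 * k.+1 <= t)%N.
  by case/andP: (hl) => _ /monoP/(_ k.+1 (leqnn _)) [].
apply: hH; [exact: layerW hl | plia |].
move: (hl); rewrite layerS2 // => /and3P[_ s3 s0].
have [hg _] := sectP (layer_sect hl); apply: good_movable => //.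
by have -> : (t - 3 * k.+1 + 3 = t - 3 * k)%N by plia.
Qed.

Lemma sum_layer (H : {set 'I_L} -> R) k : relR H -> (0 < k <= m)%N ->
  \sum_(S | layer k S) H S = beta (m - k) * \sum_(S | layer m S) H S.
Proof.
move=> hH; move: {2}(m - k)%N (leqnn (m - k)) => d.
elim/ltn_ind: d k => d IH k hd /andP[k0 km].
have [e1|[e1|km2]] : k = m \/ k = m.-1 \/ (k + 2 <= m)%N by plia.
- by rewrite e1 subnn mul1r.
- have -> : (m - k = 1)%N by plia.
  by rewrite mul1r e1; apply: eq_bigl => S; rewrite layer_last.
rewrite (layer_step km2 (fun S => layer_tog_rel k0 hH)).
have h1 := IH (m - k.+1)%N _ k.+1 (leqnn _) _; have h2 := IH (m - k.+2)%N _ k.+2 (leqnn _) _.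
rewrite h1 ?h2; try plia.
have -> : (m - k = (m - k.+2).+2)%N by plia.
have -> : (m - k.+1 = (m - k.+2).+1)%N by plia.
by rewrite betaE; ring.
Qed.

Definition relY (h : {set 'I_L} -> C) := forall S x, layer 1 S -> (x + 3 + 3 <= t)%N ->
  movable (ob S) x -> h (tog x S) = lam * h S.

Lemma relR_sqmod h : relY h -> relR (fun S => sqmod (h S)).
Proof. by move=> hh S x h1 h2 h3; rewrite hh // sqmodM. Qed.

Lemma Re_conj_lam (z w : C) :
  complex.Re (Num.conj (lam * z) * (lam * w)) = r * complex.Re (Num.conj z * w).
Proof.
rewrite rmorphM /=.
have -> : Num.conj lam * Num.conj z * (lam * w) = Num.conj lam * lam * (Num.conj z * w) by ring.
by rewrite lamE ReZ.
Qed.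

Variable psi : {set 'I_L} -> C.
Hypothesis hpsi : forall S x, (x + 3 < e)%N -> movable (ob S) x -> psi (tog x S) = lam * psi S.
Hypothesis orth : forall phi : {set 'I_L} -> C,
  (forall S, ~ good (ob S) -> phi S = 0) ->
  (forall S x, (x + 3 < b)%N -> movable (ob S) x -> phi (tog x S) = lam * phi S) ->
  \sum_S Num.conj (phi S) * psi S = 0.

(* [slid S] is the amplitude of [psi] after dimerizing the last two monomers of the chain,
   continued to the configurations where the monomer at [t - 3] is already dimerized. *)
Definition slid S := if ob S (t - 3) then psi (tog (t - 3) S)
                     else lam * psi (tog (t - 3) (tog (t - 6) S)).
(** The coefficients are those that summation over the layers produces in the pairing of [testv]
    with [psi], so that this pairing becomes a squared norm. *)
Definition testc S := (beta m.-1)%:C * psi S + Num.conj lam * (beta m.-2)%:C * slid S.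
(** The move at [t - 3] extends [testc] from the configurations ending in a monomer to the whole
    sector, which makes it a kernel state on the first [b] sites. *)
Definition testv S := if sect S then (if ob S t then testc S else lam * testc (tog (t - 3) S))
                      else 0.

Lemma relY_psi : relY psi.
Proof. by move=> S x _ h hm; apply: hpsi => //; plia. Qed.

Lemma ob_tog_out x y S : (x + 3 < b)%N -> (y < x)%N || (x + 3 < y)%N -> ob (tog x S) y = ob S y.
Proof. by move=> xb h; rewrite ob_tog // toggle_out. Qed.

Lemma movable_tog_out x y S : (x + 3 < y)%N -> (y + 3 < b)%N ->
  movable (ob (tog y S)) x = movable (ob S) x.
Proof. by move=> h h'; rewrite /movable !ob_tog_out //; plia. Qed.

(** The move at [t - 6] exchanges the two clauses of [slid], which were defined to agree with it;
    every other move commutes with the moves used in [slid]. *)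
Lemma relY_slid : relY slid.
Proof.
move=> S x hl hx hm; have := hl; rewrite layer1 => /andP[/sectP[hg hc] st].
have /and4P[h0 h3 h1 h2] := hm.
have xe : (x + 3 < e)%N by plia.
have xb : (x + 3 < b)%N by plia.
have tb : (t - 3 + 3 < b)%N by plia.
have tb' : (t - 6 + 3 < b)%N by plia.
rewrite /slid; case: (boolP (ob S (t - 3))) => s3.
  case: (leqP (t - 3) (x + 3)) => h.
    have ex : x = (t - 6)%N by plia.
    have -> : ob (tog x S) (t - 3) = false.
      by rewrite ob_tog // toggle_in ?s3 //; plia.
    by rewrite -ex togK.
  rewrite ob_tog_out // ?h ?orbT // s3 togC.
  by apply: hpsi => //; rewrite movable_tog_out.
have : (2 <= chain (ob S) t)%N by rewrite hc.
case/chain_ge2 => [[_ nst _ _]|[_ _ s3']|[t6 _ _ s4 s5]]; first by rewrite st in nst.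
  by rewrite s3' in s3.
have hx7 : (x + 3 < t - 6)%N.
  rewrite ltnNge; apply/negP => hx'.
  have [e1|[e1|[e1|e1]]] : (x + 3 = t - 6 \/ x + 3 = t - 5 \/ x + 3 = t - 4 \/ x + 3 = t - 3)%N by plia.
  - by apply: (pat2 hg h3 s4); plia.
  - by apply: (pat5' hg h0 h3 s4); plia.
  - by move: s5; rewrite (_ : (t - 5 = x + 2)%N) ?(negPf h2) //; plia.
  by rewrite -e1 h3 in s3.
rewrite ob_tog_out //; last plia.
rewrite (negPf s3) !(togC _ x) hpsi // !movable_tog_out //; plia.
Qed.

Lemma relY_testc : relY testc.
Proof.
move=> S x h1 h2 h3; rewrite /testc relY_psi // relY_slid //; ring.
Qed.

Lemma testv_good S : ~ good (ob S) -> testv S = 0.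
Proof. by move=> h; rewrite /testv /sect asboolF. Qed.

Lemma testv_rel S x : (x + 3 < b)%N -> movable (ob S) x -> testv (tog x S) = lam * testv S.
Proof.
move=> xb hm; rewrite /testv sect_tog //; case: (boolP (sect S)) => hs; last by rewrite mulr0.
have [hg hc] := sectP hs; have /and4P[h0 h3 h1 h2] := hm.
have tb : (t - 3 + 3 < b)%N by plia.
have xt : (x + 3 <= t)%N.
  rewrite leqNgt; apply/negP => xt.
  have tx : (t < x + 3 <= t + 2)%N by plia.
  by have [] := chain_toggle_lt2 hg hm tx; rewrite hc ltnNge m2.
have [ex|xt3] : x = (t - 3)%N \/ (x + 3 <= t - 3)%N.
  case: (eqVneq (x + 3)%N t) => ex; first by left; plia.
  right; rewrite leqNgt; apply/negP => h.
  have h5 : (t <= x + 5)%N by plia.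
  have h6 : (x + 3 < t)%N by plia.
  by have := chain_movable hg hm h5 h6; rewrite hc; plia.
  have e3 : (x + 3 = t)%N by plia.
  rewrite e3 in h3; rewrite h3 ob_tog // toggle_in; last plia.
  by rewrite h3 /= -ex togK.
have xt' : (x + 3 + 3 <= t)%N by plia.
rewrite ob_tog_out //; last plia.
case: (boolP (ob S t)) => st.
  by rewrite relY_testc // layer1 hs.
have : (2 <= chain (ob S) t)%N by rewrite hc.
case/chain_ge2 => [[t3 _ s1 s2]|[_ st' _]|[_ st' _ _ _]]; try by rewrite st' in st.
have s3 : ~~ ob S (t - 3) by apply/negP => s3; apply: (pat2 hg s3 s1); plia.
have hx : (x + 3 < t - 3)%N.
  rewrite ltn_neqAle xt3 andbT; apply/negP => /eqP ex; by rewrite -ex h3 in s3.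
have hm' : movable' (ob S) (t - 3).
  rewrite /movable'; have -> : (t - 3 + 1 = t - 2)%N by plia.
  have -> : (t - 3 + 2 = t - 1)%N by plia.
  have -> : (t - 3 + 3 = t)%N by plia.
  by rewrite s1 s2 s3 st.
have hm2 : movable (ob (tog (t - 3) S)) (t - 3) by rewrite ob_tog // movable_toggle.
rewrite togC relY_testc //; last by rewrite movable_tog_out.
rewrite layer1 -(sect_tog tb hm2) togK hs /=.
by have /and4P[_ + _ _] := hm2; rewrite subnK.
Qed.

Lemma slid2 S : layer 2 S -> psi (tog (t - 3) S) = slid S.
Proof.
move=> /andP[_ /monoP/(_ 1%N isT) [_]]; rewrite muln1 /slid => s3.
by rewrite s3.
Qed.

(** The pairing of [testv] with [psi] vanishes by orthogonality. Reducing its two sums, over layers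
    1 and 2, to layer m turns it into the sum of |testc|^2 over layer m, and [sum_layer] brings the
    vanishing back to layer 1. *)
Lemma testc_eq0 S : layer 1 S -> testc S = 0.
Proof.
have m1 : (0 < 1 <= m)%N by plia.
have m12 : (0 < 2 <= m)%N by plia.
have m02 : (0 + 2 <= m)%N by plia.
have := congr1 (@complex.Re R) (orth testv_good testv_rel); rewrite Re_sum /=.
rewrite (bigID sect) /= [X in _ + X]big1 ?addr0; last first.
  by move=> T /negPf hT; rewrite /testv hT rmorph0 mul0r.
pose H1 T := complex.Re (Num.conj (testc T) * psi T).
pose H2 T := complex.Re (Num.conj (testc T) * (Num.conj lam * slid T)).
have -> : \sum_(T | sect T) complex.Re (Num.conj (testv T) * psi T) =
   \sum_(T | layer 1 T) H1 T + \sum_(T | layer 2 T) H2 T.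
  rewrite (bigID (fun T => ob T t)) /=; congr (_ + _).
    apply: eq_big => T; first by rewrite layer1.
    by move=> /andP[h1 h2]; rewrite /testv h1 h2.
  rewrite (reindex_inj (inv_inj (togK (t - 3)))) /=.
  apply: eq_big => [T|T].
    by rewrite -layer_tog // muln0 subn0 /layer /= andbT.
  move=> /andP[h1 h2]; rewrite /testv h1 (negPf h2) togK.
  have hl : layer 2 T by rewrite -layer_tog // muln0 subn0 /layer /= andbT muln1 h1 h2.
  by rewrite slid2 // rmorphM /= /H2; congr complex.Re; ring.
have r1 : relR H1.
  move=> T x h1 h2 h3; rewrite /H1 relY_testc // relY_psi //; exact: Re_conj_lam.
have r2 : relR H2.
  move=> T x h1 h2 h3; rewrite /H2 relY_testc // relY_slid // [Num.conj lam * (lam * _)]mulrCA; exact: Re_conj_lam.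
rewrite (sum_layer r1 m1) (sum_layer r2 m12) !mulr_sumr -big_split /=.
have eT T : beta (m - 1) * H1 T + beta (m - 2) * H2 T = sqmod (testc T).
  have := congr1 (@complex.Re R) (sqmodE (testc T)); rewrite /= => <-.
  rewrite {2}/testc mulrDr ReD /H1 /H2 subn1 subn2; congr (_ + _).
    by rewrite mulrCA ReZ.
  by rewrite -[in LHS]ReZ; congr complex.Re; ring.
under eq_bigr => T _ do rewrite eT.
move=> h0; have := sum_layer (relR_sqmod relY_testc) m1; rewrite h0 mulr0 => /eqP.
rewrite psumr_eq0 => [/allP h|T _]; last exact: sqmod_ge0.
by move=> hS; have := h S (mem_index_enum _); rewrite hS /= sqmod_eq0 => /eqP.
Qed.

Definition ratio := beta m.-1 / beta m.-2.

Lemma beta_gt0 k : 0 < beta k. Proof. by apply: lt_le_trans (beta_ge1 k). Qed.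

(** The missing relation: under the move at [t - 3], [psi] acquires the factor - ratio / conj lam in
    place of lam. *)
Lemma psi_tog S : layer 2 S -> Num.conj lam * psi (tog (t - 3) S) = - ratio%:C * psi S.
Proof.
move=> hl; have hl1 : layer 1 S by exact: layerW hl.
have := testc_eq0 hl1; rewrite /testc -slid2 // => /eqP; rewrite addrC addr_eq0 => /eqP h.
have b0 : (beta m.-2)%:C != 0 by rewrite eq_complex /= eqxx andbT gt_eqF // beta_gt0.
apply: (mulfI b0); rewrite mulrCA mulrA h /ratio.
have -> : (beta m.-1 / beta m.-2)%:C = (beta m.-1)%:C / (beta m.-2)%:C by rewrite fmorph_div.
by field.
Qed.

Lemma sqmod_psi_tog S : lam != 0 -> layer 2 S ->
  sqmod (psi (tog (t - 3) S)) = ratio ^+ 2 / r * sqmod (psi S).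
Proof.
move=> l0 /psi_tog /(congr1 (@sqmod R)); rewrite !sqmodM.
have -> : sqmod (Num.conj lam) = r by rewrite /sqmod; case: (lam) => ? ? /=; rewrite sqrrN.
have -> : sqmod (- ratio%:C) = ratio ^+ 2 by rewrite /sqmod /= sqrrN oppr0 expr0n addr0.
move=> h; have r0 : r != 0 by rewrite sqmod_eq0.
by apply: (mulfI r0); rewrite h mulrA mulrCA mulfV // mulr1.
Qed.

Variable chi : {set 'I_L} -> C.
Hypothesis hchi : forall S x, (e - 6 <= x)%N -> (x + 3 < b)%N -> movable (ob S) x ->
  chi (tog x S) = lam * chi S.
Hypothesis l0 : lam != 0.

Let P S := complex.Re (Num.conj (chi S) * psi S).
Let Q S := sqmod (chi S).
Let W S := sqmod (psi S).

Lemma layer_movable k S : (k < 2)%N -> layer k.+2 S -> movable (ob S) (t - 3 * k.+1).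
Proof.
move=> k2 hl; have kt : (3 * k.+1 <= t)%N by plia.
move: (hl); rewrite layerS2 // => /and3P[_ s3 s0].
have [hg _] := sectP (layer_sect hl); apply: good_movable => //.
by have -> : (t - 3 * k.+1 + 3 = t - 3 * k)%N by plia.
Qed.

(** The window starts at e - 6, so it contains the last two moves, at [t - 3] and [t - 6], for every
    t >= e. *)
Let chi_tog k S : (k < 2)%N -> layer k.+2 S -> chi (tog (t - 3 * k.+1) S) = lam * chi S.
Proof. by move=> k2 hl; apply: hchi; [plia|plia|exact: layer_movable]. Qed.

Let sumP : \sum_(S | sect S) P S =
  \sum_(S | layer 1 S) P S - ratio * \sum_(S | layer 2 S) P S.
Proof.
have m02 : (0 + 2 <= m)%N by plia.
rewrite -mulNr -(layer_step m02) => [|S hl].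
  by apply: eq_bigl => S; rewrite /layer andbT.
have := @chi_tog 0%N S isT hl; rewrite /P muln1 => ->.
rewrite rmorphM /= [X in complex.Re X](_ : _ = Num.conj (chi S) * (Num.conj lam * psi (tog (t - 3) S))); last ring.
by rewrite psi_tog // mulrCA mulNr ReN ReZ mulNr.
Qed.

Let sumQ : \sum_(S | sect S) Q S = \sum_(S | layer 1 S) Q S + r * \sum_(S | layer 2 S) Q S.
Proof.
have m02 : (0 + 2 <= m)%N by plia.
rewrite -(layer_step m02) => [|S hl]; first by apply: eq_bigl => S; rewrite /layer andbT.
by rewrite /Q chi_tog // sqmodM.
Qed.

Let sumW : \sum_(S | sect S) W S =
  \sum_(S | layer 1 S) W S + ratio ^+ 2 / r * \sum_(S | layer 2 S) W S.
Proof.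
have m02 : (0 + 2 <= m)%N by plia.
rewrite -(layer_step m02) => [|S hl]; first by apply: eq_bigl => S; rewrite /layer andbT.
by rewrite muln1 /W sqmod_psi_tog.
Qed.

Let layer1P : (3 <= m)%N -> \sum_(S | layer 1 S) P S =
  \sum_(S | layer 2 S) P S + r * \sum_(S | layer 3 S) P S.
Proof.
move=> m3; apply: layer_step => // S hl; rewrite /P chi_tog //.
have hl1 : layer 1 S by exact: layerW hl.
rewrite (relY_psi hl1); [exact: Re_conj_lam|plia|exact: (@layer_movable 1%N)].
Qed.

Let layer1Q : (3 <= m)%N -> \sum_(S | layer 1 S) Q S =
  \sum_(S | layer 2 S) Q S + r * \sum_(S | layer 3 S) Q S.
Proof.
by move=> m3; apply: layer_step => // S hl; rewrite /Q chi_tog // sqmodM.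
Qed.

Definition fbeta :=
  r * (beta m.-1 / beta m) * (beta (m - 3) / beta (m - 2)) *
  ((1 - beta (m - 2) / beta m.-1 * (1 + r)) ^+ 2 / (1 + 2 * r)
   + beta (m - 4) / beta (m - 3) * (r * (1 - beta (m - 2) / beta m.-1) ^+ 2 / (1 + r))).

(** The move relations reduce the sums to two classes of representatives. On each, the
    arithmetic-geometric inequality is applied with the coefficient that matches the weight of
    [chi], and the resulting constants combine to f_m. *)
Lemma sector_overlap (F : R) : 0 <= F -> ((4 <= m)%N -> fbeta <= F) ->
  2 * \sum_(S | sect S) P S <= \sum_(S | sect S) Q S + F * \sum_(S | sect S) W S.
Proof.
move=> F0 hF.
have Q0 : 0 <= \sum_(S | sect S) Q S by apply: sumr_ge0 => S _; exact: sqmod_ge0.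
have W0 : 0 <= \sum_(S | sect S) W S by apply: sumr_ge0 => S _; exact: sqmod_ge0.
have triv : \sum_(S | sect S) P S = 0 ->
   2 * \sum_(S | sect S) P S <= \sum_(S | sect S) Q S + F * \sum_(S | sect S) W S.
  by move=> ->; rewrite mulr0 addr_ge0 // mulr_ge0.
have last2 k : k = m.-1 -> \sum_(S | layer k S) P S = \sum_(S | layer k.+1 S) P S.
  move=> ->; have -> : m.-1.+1 = m by plia.
  by apply: eq_bigl => S; rewrite layer_last.
have [em|[em|m4]] : m = 2%N \/ m = 3%N \/ (4 <= m)%N by plia.
(* For m = 2 the ratio is 1 and layers 1 and 2 coincide; for m = 3 it is 1 + r and layers 2 and 3
   coincide. The overlap vanishes in both cases, which is why f_m starts at m = 4. *)
- apply: triv; rewrite sumP (last2 1%N) ?em // /ratio em /= divr1; ring.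
- apply: triv; rewrite sumP layer1P ?em // (last2 2%N) ?em // /ratio em /= divr1; ring.
have {}hF := hF m4.
have [m3 k1 k2 k3] : [/\ (3 <= m)%N, (0 < 1 <= m)%N, (0 < 2 <= m)%N & (0 < 3 <= m)%N].
  by move: m4; clear; split; lia.
have [q1 q2] : (m - 2 = (m - 4).+2)%N /\ (m - 3 = (m - 4).+1)%N by move: m4; clear; lia.
have [q3 q4 q5] : [/\ (m - 2 = m.-2)%N, (m - 1 = m.-1)%N & m = m.-2.+2].
  by move: m4; clear; split; lia.
(* After the monomers at [t] and [t - 3] the next unit is either a dimer, collected here, or a
   monomer, which is layer 3. *)
pose N h := \sum_(S | layer 2 S && ~~ layer 3 S) (h S : R).
have splitN h : \sum_(S | layer 2 S) h S = \sum_(S | layer 3 S) h S + N h.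
  rewrite (bigID (layer 3)) /=; congr (_ + _); apply: eq_bigl => S.
  by rewrite andbC; case: (boolP (layer 3 S)) => //=; rewrite /layer monoS => /andP[-> /andP[->]].
have r0 : 0 < r by rewrite lt_neqAle sqmod_ge0 eq_sym sqmod_eq0 l0.
set c2 := 1 - ratio; set c3 := 1 + r - ratio.
have sP : \sum_(S | sect S) P S = c2 * N P + c3 * \sum_(S | layer 3 S) P S.
  by rewrite sumP layer1P // splitN /c2 /c3; ring.
have sQ : \sum_(S | sect S) Q S = (1 + r) * N Q + (1 + 2 * r) * \sum_(S | layer 3 S) Q S.
  by rewrite sumQ layer1Q // splitN; ring.
have am c k (A : pred {set 'I_L}) : 0 < k ->
    2 * (c * \sum_(S | A S) P S) <= k * (\sum_(S | A S) Q S) + c ^+ 2 / k * \sum_(S | A S) W S.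
  move=> k0; rewrite !mulr_sumr -big_split /=; apply: ler_sum => S _; exact: Re_amgm.
have a1 := @am c2 (1 + r) (fun S => layer 2 S && ~~ layer 3 S) _.
have a2 := @am c3 (1 + 2 * r) (layer 3) _.
have {}a1 : 2 * (c2 * N P) <= (1 + r) * N Q + c2 ^+ 2 / (1 + r) * N W by apply: a1; lra.
have r21 : 0 < 1 + 2 * r by lra.
have {}a2 := a2 r21.
pose X := \sum_(S | layer m S) W S.
have X0 : 0 <= X by apply: sumr_ge0 => S _; exact: sqmod_ge0.
have wl k : (0 < k <= m)%N -> \sum_(S | layer k S) W S = beta (m - k) * X.
  by move=> hk; apply: sum_layer => //; apply: relR_sqmod; exact: relY_psi.
have w1 := wl _ k1; have w2 := wl _ k2; have w3 := wl _ k3.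
rewrite sumW sP sQ w1 w2; rewrite w3 in a2.
have NW : N W = r * beta (m - 4) * X.
  by have := splitN W; rewrite w2 w3 q1 q2 betaE => h; lra.
rewrite NW in a1.
have key : c2 ^+ 2 / (1 + r) * (r * beta (m - 4) * X) + c3 ^+ 2 / (1 + 2 * r) * (beta (m - 3) * X)
   <= F * (beta (m - 1) * X + ratio ^+ 2 / r * (beta (m - 2) * X)).
  have -> : c2 ^+ 2 / (1 + r) * (r * beta (m - 4) * X) + c3 ^+ 2 / (1 + 2 * r) * (beta (m - 3) * X)
    = fbeta * (beta (m - 1) * X + ratio ^+ 2 / r * (beta (m - 2) * X)).
    rewrite /fbeta /c2 /c3 /ratio.
    have -> : beta m = beta m.-1 + r * beta m.-2 by rewrite {1}q5 betaE {1}[in RHS]q5.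
    rewrite q3 q4.
    by apply: overlap_identity => //; exact: beta_gt0.
  apply: ler_wpM2r => //; apply: addr_ge0; first by rewrite mulr_ge0 // ltW // beta_gt0.
  by rewrite mulr_ge0 ?divr_ge0 ?sqr_ge0 ?mulr_ge0 // ltW // beta_gt0.
lra.
Qed.

End Sector.
End Overlap.

(** * Kernel states in the occupation basis *)

Section KernelStates.
Variables (R : realType) (lam : R[i]) (L : nat).
Local Notation C := R[i].
Implicit Types (S : {set 'I_L}).

(** The kernel condition on amplitudes; the fermionic signs cancel, see [ker_stateE]. *)
Definition ker_state a b (psi : {set 'I_L} -> C) :=
  (forall S y, (a <= y)%N -> (y + 2 < b)%N -> oc S y -> oc S (y + 2) -> psi S = 0) /\
  (forall S x, (a <= x)%N -> (x + 3 < b)%N -> movable (oc S) x -> psi (tog x S) = lam * psi S).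

Lemma movable_ob b S x : (x + 3 < b)%N -> movable (ob b S) x = movable (oc S) x.
Proof.
move=> xb; rewrite /movable /ob.
have [-> -> -> ->] : [/\ (x < b)%N, (x + 1 < b)%N, (x + 2 < b)%N & (x + 3 < b)%N] by split; lia.
by rewrite !andbT.
Qed.

Lemma oc_tog S x y : (x + 3 < L)%N -> oc (tog x S) y = toggle x (oc S) y.
Proof.
move=> xL; case: (ltnP y L) => yL.
  have := ocE (tog x S) (Ordinal yL); have := ocE S (Ordinal yL); rewrite /toggle /= => -> ->.
  by rewrite inE.
rewrite toggle_out; last by rewrite (leq_trans xL yL) orbT.
have nc (T : {set 'I_L}) : oc T y = false by apply/negbTE/negP => /oc_lt; rewrite ltnNge yL.
by rewrite !nc.
Qed.

Section Forbidden.
Variables (a b : nat) (psi : {set 'I_L} -> C).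
Hypotheses (bL : (b <= L)%N) (ab : (a + 8 <= b)%N) (hpsi : ker_state a b psi) (l0 : lam != 0).
Let h2 := proj1 hpsi.
Let hm := proj2 hpsi.

(** The move at y + 1 creates two particles at distance 2, where the amplitude vanishes; since lam
    is nonzero the zero is carried back. *)
Lemma ker_11001 S y : (a <= y)%N -> (y + 4 < b)%N ->
  oc S y -> oc S (y + 1) -> oc S (y + 4) -> psi S = 0.
Proof.
move=> ay yb s0 s1 s4.
case: (boolP (oc S (y + 2))) => s2; first by apply: (h2 ay) s0 s2; lia.
case: (boolP (oc S (y + 3))) => s3.
  by apply: (@h2 S (y + 1)%N); rewrite -?addnA //; lia.
have mv : movable (oc S) (y + 1) by rewrite /movable -!addnA s1 s4 s2 s3.
have xb : (y + 1 + 3 < b)%N by rewrite -addnA.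
have := hm (leq_trans ay (leq_addr 1 y)) xb mv; rewrite (_ : psi (tog _ _) = 0).
  by move/esym/eqP; rewrite mulf_eq0 (negPf l0) => /eqP.
have xL : (y + 1 + 3 < L)%N by apply: leq_trans bL.
apply: (h2 ay); first lia.
  by rewrite oc_tog // toggle_out ?s0 //; lia.
by rewrite oc_tog // toggle_in ?s2 //; lia.
Qed.

Lemma ker_10011 S y : (a <= y)%N -> (y + 4 < b)%N ->
  oc S y -> oc S (y + 3) -> oc S (y + 4) -> psi S = 0.
Proof.
move=> ay yb s0 s3 s4.
case: (boolP (oc S (y + 2))) => s2; first by apply: (h2 ay) s0 s2; lia.
case: (boolP (oc S (y + 1))) => s1.
  by apply: (@h2 S (y + 1)%N); rewrite -?addnA //; lia.
have mv : movable (oc S) y by rewrite /movable s0 s3 s1 s2.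
have xb : (y + 3 < b)%N by lia.
have := hm ay xb mv; rewrite (_ : psi (tog _ _) = 0).
  by move/esym/eqP; rewrite mulf_eq0 (negPf l0) => /eqP.
have xL : (y + 3 < L)%N by apply: leq_trans bL.
apply: (@h2 _ (y + 2)%N); rewrite -?addnA; [lia|lia| |].
  by rewrite oc_tog // toggle_in ?s2 //; lia.
by rewrite oc_tog // toggle_out ?s4 //; lia.
Qed.

Lemma ker_untog S x : (a <= x)%N -> (x + 3 < b)%N -> movable' (oc S) x ->
  psi (tog x S) = 0 -> psi S = 0.
Proof.
move=> ax xb mv h0; have xL : (x + 3 < L)%N by apply: leq_trans bL.
have e : oc (tog x S) = toggle x (oc S) by apply: funext => y; rewrite oc_tog.
have := @hm (tog x S) x ax xb; rewrite e movable_toggle togK h0 mulr0.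
by apply.
Qed.

(** Opening one of the two dimers leads to 11001 or 10011, but requires an empty site next to the
    seven. With eight sites in the interval, y + 7 or y - 1 belongs to it. *)
Lemma ker_1100011 S y : (a <= y)%N -> (y + 6 < b)%N ->
  oc S y -> oc S (y + 1) -> oc S (y + 5) -> oc S (y + 6) -> psi S = 0.
Proof.
move=> ay yb s0 s1 s5 s6.
case: (boolP (oc S (y + 4))) => s4; first by apply: (@h2 S (y + 4)%N); rewrite -?addnA //; lia.
case: (boolP (oc S (y + 2))) => s2; first by apply: (h2 ay) s0 s2; lia.
case: (ltnP (y + 7) b) => y7.
  case: (boolP (oc S (y + 7))) => s7; first by apply: (@h2 S (y + 5)%N); rewrite -?addnA //; lia.
  have xb : (y + 4 + 3 < b)%N by lia.
  have xL : (y + 4 + 3 < L)%N by apply: leq_trans bL.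
  apply: (@ker_untog S (y + 4)%N); [lia|lia| |].
    by rewrite /movable' -!addnA s5 s6 s4 s7.
  apply: (@ker_11001 _ y) => //; [lia| | |]; rewrite oc_tog //.
  - by rewrite toggle_out ?s0 //; lia.
  - by rewrite toggle_out ?s1 //; lia.
  by rewrite toggle_in ?s4 //; lia.
have [z ez] : exists z, y = (z + 1)%N by exists y.-1; lia.
rewrite ez -!addnA in s0 s1 s2 s4 s5 s6.
case: (boolP (oc S z)) => sz; first by apply: (@h2 S z); [lia|lia|done|exact: s1].
have xb : (z + 3 < b)%N by lia.
have xL : (z + 3 < L)%N by apply: leq_trans bL.
apply: (@ker_untog S z); [lia|lia| |].
  by rewrite /movable' s0 s1 sz s2.
apply: (@ker_10011 _ (z + 3)%N); rewrite -?addnA; [lia|lia| | |]; rewrite oc_tog //.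
- by rewrite toggle_in ?s2 //; lia.
- by rewrite toggle_out ?s5 //; lia.
by rewrite toggle_out ?s6 //; lia.
Qed.

End Forbidden.

Section Combine.
Variables (b e : nat).
Hypotheses (bL : (b <= L)%N) (be3 : b = (e + 3)%N) (e8 : (8 <= e)%N).
Variables (psi chi : {set 'I_L} -> C) (F : R).
Hypotheses (hpsi : ker_state 0 e psi) (hchi : ker_state (e - 6) b chi)
  (orth : forall phi : {set 'I_L} -> C, ker_state 0 b phi -> \sum_S Num.conj (phi S) * psi S = 0)
  (F0 : 0 <= F).
Let P S := complex.Re (Num.conj (chi S) * psi S).
Let Q S := sqmod (chi S).
Let W S := sqmod (psi S).

Let P0 S : psi S = 0 \/ chi S = 0 -> P S = 0.
Proof. by rewrite /P => -[->|->]; rewrite ?mulr0 ?rmorph0 ?mul0r. Qed.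

Let QW0 : 0 <= \sum_S Q S + F * \sum_S W S.
Proof.
by rewrite addr_ge0 ?mulr_ge0 // sumr_ge0 // => S _; exact: sqmod_ge0.
Qed.

(** For lam = 0 the kernel conditions only restrict the support: no particles at distance 2 and no
    0110. Each such pattern lies in one of the two intervals, so where both states are nonzero the
    truncation [phi] of [psi] is a kernel state of the whole, and orthogonality makes it zero. *)
Lemma overlap_lam0 : lam = 0 -> 2 * \sum_S P S <= \sum_S Q S + F * \sum_S W S.
Proof.
move=> l0.
pose allowed S := `[< (forall y, (y + 2 < b)%N -> ~ (oc S y /\ oc S (y + 2))) /\
  (forall x, (x + 3 < b)%N -> ~ movable' (oc S) x) >].
have tog0 S x (c d : nat) (h : {set 'I_L} -> C) : (c <= x)%N -> (x + 3 < d)%N -> (d <= L)%N ->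
    ker_state c d h -> movable' (oc S) x -> h S = 0.
  move=> cx xd dL [_ hh] mv; have xL : (x + 3 < L)%N by apply: leq_trans dL.
  have e' : oc (tog x S) = toggle x (oc S) by apply: funext => y; rewrite oc_tog.
  by have := hh (tog x S) x cx xd; rewrite e' movable_toggle togK l0 mul0r; apply.
have hall S : psi S <> 0 -> chi S <> 0 -> allowed S.
  move=> p0 c0; apply/asboolP; split=> [y yb [s0 s2]|x xb mv].
    case: (ltnP (y + 2) e) => ye; first by apply: p0; apply: (hpsi.1 S y).
    by apply: c0; apply: (hchi.1 S y) => //; lia.
  case: (ltnP (x + 3) e) => xe.
    by apply: p0; apply: (@tog0 S x 0%N e) => //; lia.
  by apply: c0; apply: (@tog0 S x (e - 6)%N b) => //; lia.
pose phi S := if allowed S then psi S else 0.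
have hphi : ker_state 0 b phi.
  split=> [S y _ yb s0 s2|S x _ xb mv].
    rewrite /phi; case: ifP => // /asboolP[h _]; by case: (h y yb).
  rewrite l0 mul0r /phi; case: ifP => // /asboolP[_ h]; case: (h x xb).
  have xL : (x + 3 < L)%N by apply: leq_trans bL.
  have -> : oc (tog x S) = toggle x (oc S) by apply: funext => y; rewrite oc_tog.
  by rewrite movable'_toggle.
have : \sum_S sqmod (phi S) = 0.
  have h0 := congr1 (@complex.Re R) (orth hphi); rewrite Re_sum /= in h0.
  rewrite -[RHS]h0; apply: eq_bigr => S _; rewrite /phi; case: ifP => _; first by rewrite sqmodE.
  by rewrite rmorph0 mul0r /sqmod /= expr0n addr0.
move=> /eqP; rewrite psumr_eq0 => [/allP h|S _]; last exact: sqmod_ge0.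
rewrite (_ : \sum_S P S = 0) ?mulr0 //; apply: big1 => S _; apply: P0.
case: (eqVneq (psi S) 0) => [->|p0]; [by left|right].
apply: contrapT => c0; have hS := hall S (elimN eqP p0) c0.
have := h S (mem_index_enum _); rewrite /= /phi hS sqmod_eq0 => /eqP e0.
by rewrite e0 eqxx in p0.
Qed.

Hypothesis l0 : lam != 0.

(** The patterns span at most seven sites and the two intervals share six, so each pattern lies
    within one of the intervals, where the amplitude vanishes. *)
Let hsupp S : psi S <> 0 -> chi S <> 0 -> good (ob b S).
Proof.
move=> p0 c0 y.
have e0 : (0 + 8 <= e)%N by [].
have eL : (e <= L)%N by apply: leq_trans bL; lia.
have b8 : (e - 6 + 8 <= b)%N by lia.
split=> [[/andP[s0 _] /andP[s2 y2]]|[/andP[s0 _] /andP[s1 _] /andP[s4 y4]]|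
   [/andP[s0 _] /andP[s3 _] /andP[s4 y4]]|[/andP[s0 _] /andP[s1 _] /andP[s5 _] /andP[s6 y6]]].
- case: (ltnP (y + 2) e) => ye; first by apply: p0; apply: (hpsi.1 S y).
  by apply: c0; apply: (hchi.1 S y) => //; lia.
- case: (ltnP (y + 4) e) => ye.
    by apply: p0; apply: (ker_11001 eL e0 hpsi l0 (leq0n y) ye).
  by apply: c0; apply: (ker_11001 bL b8 hchi l0 _ y4) => //; lia.
- case: (ltnP (y + 4) e) => ye.
    by apply: p0; apply: (ker_10011 eL e0 hpsi l0 (leq0n y) ye).
  by apply: c0; apply: (ker_10011 bL b8 hchi l0 _ y4) => //; lia.
case: (ltnP (y + 6) e) => ye.
  by apply: p0; apply: (ker_1100011 eL e0 hpsi l0 (leq0n y) ye).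
by apply: c0; apply: (ker_1100011 bL b8 hchi l0 _ y6) => //; lia.
Qed.

Let hpsi' S x : (x + 3 < e)%N -> movable (ob b S) x -> psi (tog x S) = lam * psi S.
Proof. by move=> xe; rewrite movable_ob; [exact: hpsi.2|lia]. Qed.

Let hchi' S x : (e - 6 <= x)%N -> (x + 3 < b)%N -> movable (ob b S) x -> chi (tog x S) = lam * chi S.
Proof. by move=> ex xb; rewrite movable_ob //; exact: hchi.2. Qed.

Let orth' (phi : {set 'I_L} -> C) : (forall S, ~ good (ob b S) -> phi S = 0) ->
  (forall S x, (x + 3 < b)%N -> movable (ob b S) x -> phi (tog x S) = lam * phi S) ->
  \sum_S Num.conj (phi S) * psi S = 0.
Proof.
move=> h1 h2; apply: orth; split=> [S y _ yb s0 s2|S x _ xb mv]; last by apply: h2; rewrite ?movable_ob.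
apply: h1 => hg; have yb' : (y < b)%N by lia.
by apply: (@pat2 _ hg y (y + 2)%N); rewrite /ob ?s0 ?s2.
Qed.

Let cond t S := `[< good (ob b S) >] && (2 <= chain (ob b S) t)%N.

Let condE t S : (e <= t < b)%N -> cond t S = sect b t (chain (ob b S) t) S && (2 <= chain (ob b S) t)%N.
Proof. by rewrite /cond /sect eqxx andbT. Qed.

Let good_tog S x : (x + 3 < b)%N -> movable (ob b S) x -> good (ob b (tog x S)) <-> good (ob b S).
Proof.
move=> xb mv; rewrite (ob_tog bL) //; split=> hg; last exact: good_toggle.
have := good_toggle' hg; move=> /(_ x); rewrite movable'_toggle => /(_ mv).
by congr good; apply: funext => y; rewrite toggleK.
Qed.

Let cond_tog t S x : (e <= t < b)%N -> (x + 3 < b)%N -> movable (ob b S) x ->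
  cond t (tog x S) = cond t S.
Proof.
move=> te xb mv; rewrite /cond; have := good_tog xb mv.
case: (asboolP (good (ob b S))) => hg h; last by rewrite asboolF // => /h.
rewrite asboolT; last by apply/h.
rewrite (ob_tog bL) //=; case: (leqP (x + 3) t) => xt; first by rewrite chain_toggle.
have tx : (t < x + 3 <= t + 2)%N by lia.
by have [h1 h2] := chain_toggle_lt2 hg mv tx; rewrite [LHS]leqNgt [RHS]leqNgt h1 h2.
Qed.

Let type0 S := `[< good (ob b S) >] && [&& ~~ cond e S, ~~ cond (e + 1) S & ~~ cond (e + 2) S].

(** On these configurations no move crosses the end of the shorter interval, so [psi] truncated to
    them is a kernel state of the longer one, and its pairing with [psi] is its own squared norm. *)
Let psi_type0 S : type0 S -> psi S = 0.
Proof.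
have [t0 t1 t2] : [/\ (e <= e < b)%N, (e <= e + 1 < b)%N & (e <= e + 2 < b)%N].
  by move: be3; clear; split; lia.
pose phi T := if type0 T then psi T else 0.
have h1 T : ~ good (ob b T) -> phi T = 0 by move=> h; rewrite /phi /type0 asboolF.
have h2 T x : (x + 3 < b)%N -> movable (ob b T) x -> phi (tog x T) = lam * phi T.
  move=> xb mv; rewrite /phi.
  have -> : type0 (tog x T) = type0 T.
    rewrite /type0 !cond_tog //; congr (_ && _).
    by apply: asbool_equiv_eq; exact: good_tog.
  case: (boolP (type0 T)) => hT; last by rewrite mulr0.
  case: (ltnP (x + 3) e) => xe; first exact: hpsi'.
  case/andP: hT => hg; rewrite /cond hg /= -!ltnNge => /and3P[c0 c1 c2].
  have /and4P[s0 s3 _ _] := mv.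
  have hc : (2 <= chain (ob b T) (x + 3))%N.
    have -> : chain (ob b T) (x + 3) = (chain (ob b T) x).+1.
      rewrite (chain_occ s3) addnK; have -> : (x + 3 < 3)%N = false by clear; lia.
      by [].
    by rewrite (chain_occ s0).
  have [ex|[ex|ex]] : (x + 3 = e \/ x + 3 = e + 1 \/ x + 3 = e + 2)%N.
    by move: xe xb be3; clear; lia.
  - by rewrite -ex ltnNge hc in c0.
  - by rewrite -ex ltnNge hc in c1.
  by rewrite -ex ltnNge hc in c2.
have := congr1 (@complex.Re R) (orth' h1 h2); rewrite Re_sum /=.
have e1 T : complex.Re (Num.conj (phi T) * psi T) = sqmod (phi T).
  rewrite /phi; case: ifP => _; first by rewrite sqmodE.
  by rewrite rmorph0 mul0r /sqmod /= expr0n addr0.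
under eq_bigr => T _ do rewrite e1.
move=> /eqP; rewrite psumr_eq0 => [/allP h|T _]; last exact: sqmod_ge0.
by move=> hS; have := h S (mem_index_enum _); rewrite /= /phi hS sqmod_eq0 => /eqP.
Qed.

Hypothesis hF : forall m, (4 <= m)%N -> fbeta lam m <= F.

Let cond_overlap t : (e <= t < b)%N ->
  2 * \sum_(S | cond t S) P S <= \sum_(S | cond t S) Q S + F * \sum_(S | cond t S) W S.
Proof.
(* A common bound on the chain lengths, so that the sectors are indexed by a finite type. *)
move=> te; pose M := (\max_(S : {set 'I_L}) chain (ob b S) t)%N; pose B := M.+1.
have cM (S : {set 'I_L}) : (chain (ob b S) t < B)%N.
  by rewrite ltnS; apply: (leq_bigmax (F := fun S : {set 'I_L} => chain (ob b S) t)).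
have part (H : {set 'I_L} -> R) :
    \sum_(S | cond t S) H S = \sum_(m < B | (2 <= m)%N) \sum_(S | sect b t m S) H S.
  rewrite (partition_big (fun S => inord (chain (ob b S) t) : 'I_B) (fun m => 2 <= m)%N) /=.
    apply: eq_bigr => m m2; apply: eq_bigl => S; rewrite /cond /sect.
    case: (boolP `[< _ >]) => //= _.
    rewrite -val_eqE /= inordK //; case: eqP => [->|]; rewrite ?m2 ?andbF //.
  move=> S /andP[_ h].
  by rewrite inordK.
rewrite !part !mulr_sumr -big_split /=; apply: ler_sum => m m2.
by apply: (@sector_overlap R lam L b e bL be3 e8 t m te m2 psi hpsi' orth' chi hchi' l0 F F0); exact: hF.
Qed.

Lemma overlap_bound : 2 * \sum_S P S <= \sum_S Q S + F * \sum_S W S.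
Proof.
have [t0 t1 t2] : [/\ (e <= e < b)%N, (e <= e + 1 < b)%N & (e <= e + 2 < b)%N].
  by move: be3; clear; split; lia.
have c0 := cond_overlap t0; have c1 := cond_overlap t1; have c2 := cond_overlap t2.
have excl S : [/\ ~~ (cond e S && cond (e + 1) S), ~~ (cond e S && cond (e + 2) S) &
    ~~ (cond (e + 1) S && cond (e + 2) S)].
  have ex t t' : (t < t' <= t + 2)%N -> ~~ (cond t S && cond t' S).
    move=> tt; apply/negP => /andP[/andP[/asboolP hg h1] /andP[_ h2]].
    exact: (chain_end_uniq hg tt h1 h2).
  by split; apply: ex; clear; lia.
have tot (H : {set 'I_L} -> R) : (forall S, 0 <= H S) ->
   \sum_(S | cond e S) H S + \sum_(S | cond (e + 1) S) H S + \sum_(S | cond (e + 2) S) H S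
   <= \sum_S H S.
  move=> H0; rewrite ![\sum_(S | cond _ S) _]big_mkcond -!big_split /=; apply: ler_sum => S _.
  have [] := excl S; have := H0 S.
  by case: (cond e S); case: (cond (e + 1) S); case: (cond (e + 2) S) => //= h _ _ _; lra.
have totP : \sum_S P S =
   \sum_(S | cond e S) P S + \sum_(S | cond (e + 1) S) P S + \sum_(S | cond (e + 2) S) P S.
  rewrite ![\sum_(S | cond _ S) _]big_mkcond -!big_split /=; apply: eq_bigr => S _.
  case: (eqVneq (P S) 0) => [->|hP]; first by rewrite !if_same !addr0.
  have p0 : psi S <> 0 by move=> h; case/eqP: hP; apply: P0; left.
  have k0 : chi S <> 0 by move=> h; case/eqP: hP; apply: P0; right.
  have hg := hsupp p0 k0.
  have : ~~ type0 S by apply/negP => /psi_type0.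
  rewrite /type0 (asboolT hg) /=; have [] := excl S.
  by case: (cond e S); case: (cond (e + 1) S); case: (cond (e + 2) S) => //= *; rewrite ?addr0 ?add0r.
have tQ := tot Q (fun S => sqmod_ge0 _); have tW := tot W (fun S => sqmod_ge0 _).
have := ler_wpM2l F0 tW; rewrite totP; lra.
Qed.

End Combine.

Variable kappa : R.
Hypothesis kappa_gt0 : 0 < kappa.

Lemma sgn_succ S x : (x < L)%N -> ~~ oc S x -> sgn R S x.+1 = sgn R S x.
Proof.
move=> xL nx; rewrite /sgn !card_oc_lt //; last exact: ltnW.
by rewrite big_nat_recr //= (negPf nx) addn0.
Qed.

Lemma amp_cop2 (y z : 'I_L) (v : vec R L) T : (y < z)%N ->
  amp (cop R L y *m cop R L z *m v) T =
  if (y \in T) || (z \in T) then 0 else - (sgn R T y * sgn R T z) * amp v (z |: (y |: T)).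
Proof.
move=> yz; have zy : (z == y) = false by apply/negbTE; rewrite -val_eqE /= neq_ltn yz orbT.
rewrite -mulmxA !amp_cop !inE zy /=; case: (boolP (y \in T)) => //= yT.
case: (boolP (z \in T)) => zT; first by rewrite mulr0.
by rewrite sgnU // yz; ring.
Qed.

Lemma ker_stateE a l (v : vec R L) : (a + l <= L)%N -> (0 < L)%N -> (3 <= l)%N ->
  Hloc kappa lam L a l *m v = 0 <-> ker_state a (a + l) (amp v).
Proof.
move=> aL L0 l3; rewrite -/(Hsum kappa lam L _ _ _ _) ker_Hsum //.
have memS S x : (x < L)%N -> (site L0 x \in S) = oc S x by move=> xL; rewrite -ocE siteE.
have nnE x : (x + 2 < L)%N -> nn R L x *m v = 0 <->
    (forall S, oc S x -> oc S (x + 2) -> amp v S = 0).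
  move=> x2; have x0 : (x < L)%N by lia.
  split=> [h S s0 s2|h].
    by have := congr1 (fun w => amp w S) h; rewrite (amp_nn L0) !memS // s0 s2 mul1r amp0.
  apply: amp_ext => S; rewrite (amp_nn L0) !memS // amp0.
  case: (boolP (oc S x)) => s0; last by rewrite mul0r.
  case: (boolP (oc S (x + 2))) => s2; last by rewrite mul0r.
  by rewrite h // mulr0.
have qE x : (x + 3 < L)%N -> (forall S, oc S x -> oc S (x + 2) -> amp v S = 0) ->
    (forall S, oc S (x + 1) -> oc S (x + 3) -> amp v S = 0) ->
    qop L lam x *m v = 0 <-> (forall S, movable (oc S) x -> amp v (tog x S) = lam * amp v S).
  move=> x3 k02 k13.
  have [x0 x1 x2] : [/\ (x < L)%N, (x + 1 < L)%N & (x + 2 < L)%N] by move: x3; clear; split; lia.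
  pose o0 := Ordinal x0; pose o1 := Ordinal x1; pose o2 := Ordinal x2; pose o3 := Ordinal x3.
  have aq T : amp (qop L lam x *m v) T =
     (if (o1 \in T) || (o2 \in T) then 0 else - (sgn R T o1 * sgn R T o2) * amp v (o2 |: (o1 |: T)))
     - lam * (if (o0 \in T) || (o3 \in T) then 0 else
                - (sgn R T o0 * sgn R T o3) * amp v (o3 |: (o0 |: T))).
    rewrite /qop mulmxBl ampD ampN -scalemxAl ampZ -!amp_cop2 //=; try by clear; lia.
    by rewrite !addn1 !addn2 !addn3.
  have ocU (o : 'I_L) T y : oc (o |: T) y = (y == o :> nat) || oc T y.
    case: (ltnP y L) => yL.
      have := ocE (o |: T) (Ordinal yL); have := ocE T (Ordinal yL) => /= -> ->.
      by rewrite !inE -val_eqE.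
    have nc (T' : {set 'I_L}) : oc T' y = false by apply/negbTE/negP => /oc_lt; rewrite ltnNge yL.
    by rewrite !nc orbF; apply/esym/negbTE; rewrite neq_ltn (leq_trans (ltn_ord o) yL) orbT.
  (* When the four sites are empty in [T] their strings agree, and the signs cancel in pairs. *)
  have disj T : ~~ [|| oc T x, oc T (x + 1), oc T (x + 2) | oc T (x + 3)] ->
     [/\ amp (qop L lam x *m v) T = - amp v (o2 |: (o1 |: T)) + lam * amp v (o3 |: (o0 |: T)),
        movable (oc (o3 |: (o0 |: T))) x & tog x (o3 |: (o0 |: T)) = o2 |: (o1 |: T)].
    rewrite !negb_or => /and4P[t0 t1 t2 t3]; split.
    - rewrite aq -!ocE /= (negPf t0) (negPf t1) (negPf t2) (negPf t3) /=.
      have s1 : sgn R T (x + 1) = sgn R T x by rewrite addn1 sgn_succ.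
      have s2 : sgn R T (x + 2) = sgn R T x by rewrite (addnS x 1) sgn_succ.
      have s3 : sgn R T (x + 3) = sgn R T x by rewrite (addnS x 2) sgn_succ.
      by rewrite s1 s2 s3 !sgn2; ring.
    - rewrite /movable !ocU /= (negPf t0) (negPf t1) (negPf t2) (negPf t3) !orbF.
      by clear; lia.
    apply: oc_ext => y yL; rewrite oc_tog // /toggle !ocU /=.
    case: (boolP (x <= y <= x + 3)%N) => hy; last first.
      have [f0 f1 f2 f3] : [/\ (y == x) = false, (y == x + 1)%N = false,
           (y == x + 2)%N = false & (y == x + 3)%N = false] by move: hy; clear; split; lia.
      by rewrite f0 f1 f2 f3 addbF.
    have [->|[->|[->|->]]] : (y = x \/ y = x + 1 \/ y = x + 2 \/ y = x + 3)%N by move: hy; clear; lia.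
    - by rewrite (negPf t0) !orbF; clear; lia.
    - by rewrite (negPf t1) !orbF; clear; lia.
    - by rewrite (negPf t2) !orbF; clear; lia.
    by rewrite (negPf t3) !orbF; clear; lia.
  split=> [h S mv|h].
    have /and4P[s0 s3 s1 s2] := mv.
    pose T := S :\ o0 :\ o3.
    have eT y : oc T y = [&& y != x + 3, y != x & oc S y]%N.
      case: (ltnP y L) => yL.
        have := ocE T (Ordinal yL); have := ocE S (Ordinal yL) => /= -> ->.
        by rewrite !inE -!val_eqE.
      have nc (T' : {set 'I_L}) : oc T' y = false by apply/negbTE/negP => /oc_lt; rewrite ltnNge yL.
      by rewrite !nc !andbF.
    have hT : ~~ [|| oc T x, oc T (x + 1), oc T (x + 2) | oc T (x + 3)].
      by rewrite !eT (negPf s1) (negPf s2) !eqxx /= !andbF.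
    have eS : o3 |: (o0 |: T) = S.
      apply: oc_ext => y _; rewrite !ocU eT /=.
      case: (y =P x + 3)%N => [->|_]; first by rewrite s3.
      by case: (y =P x) => [->|_]; rewrite ?s0.
    have [d1 _ d3] := disj T hT; rewrite eS in d1 d3.
    have := congr1 (fun w => amp w T) h; rewrite d1 amp0 -d3 addrC => /eqP.
    by rewrite subr_eq0 => /eqP.
  apply: amp_ext => T; rewrite amp0.
  case: (boolP [|| oc T x, oc T (x + 1), oc T (x + 2) | oc T (x + 3)]) => hT; last first.
    by have [-> d2 d3] := disj T hT; rewrite -d3 h // addrC subrr.
  rewrite aq -!ocE /=.
  (* A pair added next to an occupied one of the four sites creates two particles at distance 2. *)
  have z1 : (oc T x || oc T (x + 3)) -> ~~ (oc T (x + 1) || oc T (x + 2)) ->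
      amp v (o2 |: (o1 |: T)) = 0.
    by move=> /orP[t|t] _; [apply: k02|apply: k13]; rewrite !ocU /= ?t ?eqxx ?orbT.
  have z2 : (oc T (x + 1) || oc T (x + 2)) -> ~~ (oc T x || oc T (x + 3)) ->
      amp v (o3 |: (o0 |: T)) = 0.
    by move=> /orP[t|t] _; [apply: k13|apply: k02]; rewrite !ocU /= ?t ?eqxx ?orbT.
  case: (boolP (oc T (x + 1) || oc T (x + 2))) => h12; case: (boolP (oc T x || oc T (x + 3))) => h03.
  - by rewrite mulr0 subr0.
  - by rewrite z2 // !mulr0 subr0.
  - by rewrite z1 // !mulr0 subr0.
  by case/orP: hT => [t|/or3P[t|t|t]]; rewrite t ?orbT in h12 h03.
split=> [[h1 h2]|[h1 h2]].
  have k1 S y : (a <= y)%N -> (y + 2 < a + l)%N -> oc S y -> oc S (y + 2) -> amp v S = 0.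
    move=> ay yl; have y2 : (y + 2 < L)%N by move: yl aL; clear; lia.
    by apply: (proj1 (nnE y y2)); apply: h1; move: ay yl; clear; lia.
  split=> // S x ax xl mv; have x3 : (x + 3 < L)%N by move: xl aL; clear; lia.
  have k02 T : oc T x -> oc T (x + 2) -> amp v T = 0 by apply: k1; move: ax xl; clear; lia.
  have k13 T : oc T (x + 1) -> oc T (x + 3) -> amp v T = 0.
    by move=> t1 t3; apply: (@k1 T (x + 1)%N); rewrite -?addnA //; move: ax xl; clear; lia.
  by apply: (proj1 (qE x x3 k02 k13)) => //; apply: h2; move: ax xl; clear; lia.
split=> x hx.
  have x2 : (x + 2 < L)%N by move: hx aL; clear; lia.
  by apply: (proj2 (nnE x x2)) => S; apply: h1; move: hx; clear; lia.
have x3 : (x + 3 < L)%N by move: hx aL; clear; lia.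
have k02 T : oc T x -> oc T (x + 2) -> amp v T = 0 by apply: h1; move: hx; clear; lia.
have k13 T : oc T (x + 1) -> oc T (x + 3) -> amp v T = 0.
  by move=> t1 t3; apply: (@h1 T (x + 1)%N); rewrite -?addnA //; move: hx; clear; lia.
by apply: (proj2 (qE x x3 k02 k13)) => S; apply: h2; move: hx; clear; lia.
Qed.

End KernelStates.

(** * From the recursion to the closed form of [f] *)

Section FBound.
Variables (R : realType) (lam : R[i]).
Local Notation r := (sqmod lam).
Local Notation beta := (beta lam).

Local Notation mup := (@Defs.mup R).
Local Notation d := (Num.sqrt (1 + 4 * r) : R).

Lemma sqrt_disc : 1 <= d /\ d ^+ 2 = 1 + 4 * r.
Proof.
have hr := sqmod_ge0 lam; have h : 1 <= 1 + 4 * r by lra.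
split; last by rewrite sqr_sqrtr //; lra.
by have := ler_wsqrtr h; rewrite sqrtr1.
Qed.

Lemma mup_root : mup r ^+ 2 = mup r + r.
Proof.
have [_] := sqrt_disc; rewrite /Defs.mup; set z := Num.sqrt _ => h.
have -> : ((1 + z) / 2) ^+ 2 = (1 + 2 * z + z ^+ 2) / 4 by field.
by rewrite h; field.
Qed.

Lemma mum_root : mum r ^+ 2 = mum r + r.
Proof.
have [_] := sqrt_disc; rewrite /mum; set z := Num.sqrt _ => h.
have -> : ((1 - z) / 2) ^+ 2 = (1 - 2 * z + z ^+ 2) / 4 by field.
by rewrite h; field.
Qed.

Lemma mup_gt0 : 0 < mup r.
Proof. by have [h _] := sqrt_disc; rewrite /Defs.mup divr_gt0 // ltr_wpDr //; lra. Qed.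

Lemma mup_sub_mum : mup r - mum r = d.
Proof. by rewrite /Defs.mup /mum; field. Qed.

(** The Binet formula: [mup r] and [mum r] are the roots of z^2 = z + r. *)
Lemma beta_closed k : beta k * d = mup r ^+ k.+1 - mum r ^+ k.+1.
Proof.
elim/ltn_ind: k => [[|[|k]] IH].
- by rewrite mul1r !expr1 mup_sub_mum.
- by rewrite mul1r mup_root mum_root -mup_sub_mum; ring.
rewrite betaE mulrDl -mulrA !IH //.
have e z : z ^+ 2 = z + r -> z ^+ k.+3 = z ^+ k.+2 + r * z ^+ k.+1.
  by move=> hz; rewrite -addn2 exprD hz (exprS _ k.+1); ring.
by rewrite (e _ mup_root) (e _ mum_root); ring.
Qed.

Lemma alphaE k : alpha r k.+1 = beta k / beta k.+1.
Proof.
have p0 := mup_gt0; have b1 := beta_gt0 lam k.+1.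
have d0 : 0 < d by case: sqrt_disc => h _; apply: lt_le_trans h.
have e j : 1 - mu r ^+ j.+1 = beta j * d / mup r ^+ j.+1.
  have p1 : mup r ^+ j.+1 != 0 by rewrite expf_neq0 // gt_eqF.
  by rewrite beta_closed /mu expr_div_n mulrBl divff.
rewrite /alpha !e (exprS (mup r) k.+1).
have q0 : 0 < mup r ^+ k.+1 by rewrite exprn_gt0.
by field; rewrite !gt_eqF.
Qed.

Lemma fn_beta m : (4 <= m)%N -> fn m r = fbeta lam m.
Proof.
move=> m4; rewrite /fn /fbeta.
have [m' ->] : exists m', m = m'.+4 by exists (m - 4)%N; lia.
have -> : (m'.+4 - 2 = m'.+2)%N by lia.
have -> : (m'.+4 - 1 = m'.+3)%N by lia.
have -> : (m'.+4 - 3 = m'.+1)%N by lia.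
have -> : (m'.+4 - 4 = m')%N by lia.
by rewrite !alphaE.
Qed.

Lemma alpha01 k : 0 <= alpha r k.+1 <= 1.
Proof.
rewrite alphaE; have b0 := beta_gt0 lam k; have b1 := beta_gt0 lam k.+1.
apply/andP; split; first by rewrite divr_ge0 ?ltW.
rewrite ler_pdivrMr // mul1r.
case: k b0 b1 => [|k] // b0 b1; by rewrite betaE lerDl mulr_ge0 ?sqmod_ge0 // ltW // beta_gt0.
Qed.

(** The crude upper bound, uniform in [m], ensures that the supremum defining [f] is over a bounded
    set. *)
Lemma fn_bounds m : (4 <= m)%N -> 0 <= fn m r <= r * ((1 + r) ^+ 2 + r).
Proof.
move=> m4; rewrite /fn.
have [m' ->] : exists m', m = m'.+4 by exists (m - 4)%N; lia.
have -> : (m'.+4 - 2 = m'.+2)%N by lia.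
have -> : (m'.+4 - 1 = m'.+3)%N by lia.
have -> : (m'.+4 - 3 = m'.+1)%N by lia.
move: (alpha01 m'.+3) (alpha01 m'.+1) (alpha01 m'.+2) (alpha01 m').
move: (alpha r m'.+4) (alpha r m'.+2) (alpha r m'.+3) (alpha r m'.+1) (sqmod_ge0 lam).
move: r => q a b c e q0 /andP[a0 a1] /andP[b0 b1] /andP[c0 c1] /andP[e0 e1].
have u0 : 0 <= (1 - c * (1 + q)) ^+ 2 / (1 + 2 * q) by rewrite divr_ge0 ?sqr_ge0 //; lra.
have u1 : (1 - c * (1 + q)) ^+ 2 / (1 + 2 * q) <= (1 + q) ^+ 2.
  rewrite ler_pdivrMr; last lra.
  have h1 : (1 - c * (1 + q)) ^+ 2 <= (1 + q) ^+ 2.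
    have h2 : 0 <= c * (1 + q) by rewrite mulr_ge0 //; lra.
    have h3 : c * (1 + q) <= 1 + q by rewrite ler_piMl //; lra.
    by nra.
  apply: (le_trans h1); rewrite ler_peMr ?sqr_ge0 //; lra.
have v0 : 0 <= q * (1 - c) ^+ 2 / (1 + q) by rewrite divr_ge0 ?mulr_ge0 ?sqr_ge0 //; lra.
have v1 : q * (1 - c) ^+ 2 / (1 + q) <= q.
  rewrite ler_pdivrMr; last lra.
  have h1 : (1 - c) ^+ 2 <= 1 by nra.
  have := ler_wpM2l q0 h1; nra.
have w0 : 0 <= e * (q * (1 - c) ^+ 2 / (1 + q)) by rewrite mulr_ge0.
have w1 : e * (q * (1 - c) ^+ 2 / (1 + q)) <= q by apply: le_trans v1; rewrite ler_piMl.
have ab0 : 0 <= q * a * b by rewrite !mulr_ge0.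
have ab1 : q * a * b <= q.
  by rewrite -mulrA ler_piMr // mulr_ile1.
apply/andP; split; first by rewrite mulr_ge0 // addr_ge0.
by apply: ler_pM => //; [rewrite addr_ge0 | apply: lerD].
Qed.

Lemma fn_le_f m : (4 <= m)%N -> fn m r <= f r.
Proof.
move=> m4; apply: ub_le_sup; last by exists m.
by exists (r * ((1 + r) ^+ 2 + r)) => _ [k k4 <-]; have /andP[] := fn_bounds k4.
Qed.

Lemma f_ge0 : 0 <= f r.
Proof.
by apply: le_trans (fn_le_f (leqnn 4)); have /andP[] := fn_bounds (leqnn 4).
Qed.

Lemma fbeta_le_f m : (4 <= m)%N -> fbeta lam m <= f r.
Proof. by move=> m4; rewrite -fn_beta //; exact: fn_le_f. Qed.

End FBound.

(** * The gap of the open chain *)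

Section OpenChain.
Variables (R : realType) (kappa : R) (lam : R[i]).
Hypothesis kappa_gt0 : 0 < kappa.
Local Notation C := R[i].

Lemma kerp_sub n (A B : 'M[C]_n) : herm A -> herm B ->
  (forall v : 'cV[C]_n, B *m v = 0 -> A *m v = 0) -> kerp A *m kerp B = kerp B.
Proof.
move=> hA hB h; apply: mulmx_ext => v; rewrite -mulmxA; apply: kerp_id => //.
by apply: h; rewrite mulmxA mul_kerp // mul0mx.
Qed.

Lemma ker_Hloc_sub L s l s' l' (v : vec R L) : (0 < L)%N ->
  (s' <= s)%N -> (s + l <= s' + l')%N -> Hloc kappa lam L s' l' *m v = 0 ->
  Hloc kappa lam L s l *m v = 0.
Proof.
move=> L0 h1 h2; rewrite -!/(Hsum kappa lam L _ _ _ _) !ker_Hsum // => -[k1 k2].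
by split=> x hx; [apply: k1|apply: k2]; move: hx h1 h2; clear; lia.
Qed.

Lemma count_window N c (P : nat -> bool) : (forall k, P k -> (c <= k <= c + 2)%N) ->
  (\sum_(0 <= k < N) (P k : nat) <= 3)%N.
Proof.
move=> hP; have cw M : (\sum_(0 <= k < M) ((c <= k <= c + 2)%N : nat) = minn (M - c) 3)%N.
  elim: M => [|M IH]; first by rewrite big_nil; clear; lia.
  by rewrite big_nat_recr //= IH; clear; lia.
apply: (@leq_trans (\sum_(0 <= k < N) ((c <= k <= c + 2)%N : nat))); last first.
  by rewrite cw; clear; lia.
apply: leq_sum => k _; case: (boolP (P k)) => // /hP ->; by [].
Qed.

Lemma sum_cover (a : nat -> R) (st en : nat -> nat) N B : (forall x, 0 <= a x) ->
  (forall k, (k < N)%N -> (en k <= B)%N) ->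
  (forall x, (\sum_(0 <= k < N) ((st k <= x < en k)%N : nat) <= 3)%N) ->
  \sum_(0 <= k < N) \sum_(st k <= x < en k) a x <= 3 * \sum_(0 <= x < B) a x.
Proof.
move=> a0 hB hc.
have -> : \sum_(0 <= k < N) \sum_(st k <= x < en k) a x =
   \sum_(0 <= k < N) \sum_(0 <= x < B) a x *+ (st k <= x < en k)%N.
  apply: eq_big_nat => k /andP[_ kN].
  rewrite (big_nat_widen _ _ _ _ _ (hB k kN)) (big_nat_widenl _ _ _ _ _ (leq0n (st k))).
  rewrite big_mkcond; apply: eq_bigr => x _ /=.
  by case: (st k <= x)%N; case: (x < en k)%N; rewrite ?mulr1n ?mulr0n.
rewrite exchange_big mulr_sumr /=; apply: ler_sum => x _.
rewrite sumrMnr -[leLHS]mulr_natl; apply: ler_wpM2r => //.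
by rewrite ler_nat.
Qed.

Section Chain.
Variables (L e0 N : nat) (m0 eps s : R).
Hypotheses (e8 : (8 <= e0 <= 10)%N) (LN : L = (e0 + 3 * N)%N)
  (hm0 : 0 <= m0) (m8 : m0 <= gap (Hopen kappa lam 8)) (m9 : m0 <= gap (Hopen kappa lam 9))
  (m10 : m0 <= gap (Hopen kappa lam 10))
  (hf : f (sqmod lam) <= eps ^+ 2) (eps0 : 0 < eps) (s0 : 0 < s) (s2 : s ^+ 2 = 3)
  (es : eps * s < 1).

(** The first window absorbs the residue of the length modulo 3; each later one has nine sites, of
    which the last three are new. *)
Definition win_start k := if k is k'.+1 then (e0 + 3 * k'.+1 - 9)%N else 0%N.
Definition win_len k := if k is k'.+1 then 9 else e0.
Let Hw k := Hloc kappa lam L (win_start k) (win_len k).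
Let H0 k := Hloc kappa lam L 0 (e0 + 3 * k).
(** Shifted by one, so that the first increment is the complement of the kernel of the first
    window. *)
Let G k : op R L := if k is k'.+1 then kerp (H0 k') else 1%:M.

Let L0 : (0 < L)%N. Proof. by rewrite LN; move: e8; clear; lia. Qed.
Let hHw k : herm (Hw k). Proof. exact: herm_Hloc. Qed.
Let hH0 k : herm (H0 k). Proof. exact: herm_Hloc. Qed.

Let win_end k : (win_start k + win_len k = e0 + 3 * k)%N.
Proof. by case: k => [|k] /=; move: e8; clear; lia. Qed.

Let hG k : herm (G k).
Proof. by case: k => [|k]; [exact: adj1 | exact: herm_kerp]. Qed.

Let GG j k : (j <= k)%N -> G j *m G k = G k.
Proof.
case: j => [|j]; first by rewrite mul1mx.
case: k => [//|k] jk; apply: kerp_sub => // v; apply: ker_Hloc_sub => //.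
by move: jk; clear; lia.
Qed.

Let GGl j k : (j <= k)%N -> G k *m G j = G k.
Proof. by move=> /GG /(congr1 (@adj _ _ _)); rewrite adjM !hG. Qed.

Let gG k m : (k < m)%N -> kerp (Hw k) *m G m = G m.
Proof.
case: m => [//|m] km; apply: kerp_sub => // v; apply: ker_Hloc_sub => //.
by rewrite win_end; move: km; clear; lia.
Qed.

(** For m > 0, [G m] lives on the first e0 + 3 (m - 1) sites, and window k starts at e0 + 3 k - 9,
    not before the end of these. *)
Let gGC k m : (k < N.+1)%N -> (m + 2 <= k)%N -> kerp (Hw k) *m G m = G m *m kerp (Hw k).
Proof.
move=> kN mk; case: m mk => [|m] mk; first by rewrite mul1mx mulmx1.
apply: kerp_comm2; [exact: hHw | exact: hH0 | apply/esym; apply: comm_Hloc2 => //].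
move=> i j hi hj; apply: neq_mod_lt; rewrite add0n.
have := win_end k; move: hi hj mk kN e8 LN; case: k => [|k] /=; clear; lia.
Qed.

Let hform k v : (k < N.+1)%N -> m0 * (rdot v v - rdot v (kerp (Hw k) *m v)) <= rdot v (Hw k *m v).
Proof.
move=> kN; apply: gapge_form => // w hw.
have hl : (0 < win_len k <= L)%N.
  by case: (k) kN => [|k'] /=; move: e8 LN; clear; lia.
apply: le_trans (@gapge_Hloc R kappa lam kappa_gt0 L (win_start k) _ hl _ hw).
apply: ler_wpM2r; first exact: rdot_ge0.
have : win_len k = 8 \/ win_len k = 9 \/ win_len k = 10.
  by case: (k) => [|k'] /=; move: e8; clear; lia.
by move=> [->|[->|->]].
Qed.

Let rdot_amp (u w : vec R L) : rdot u w = \sum_S complex.Re (Num.conj (amp u S) * amp w S).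
Proof. by rewrite /rdot dot_amp Re_sum. Qed.

Let rdot_sqmod (u : vec R L) : rdot u u = \sum_S sqmod (amp u S).
Proof. by rewrite rdot_amp; apply: eq_bigr => S _; rewrite sqmodE. Qed.

Let overlap k (v : 'cV[C]_(fdim L)) : (k < N.+1)%N ->
  let x := (G k - G k.+1) *m v in
  rdot (kerp (Hw k) *m x) (kerp (Hw k) *m x) <= eps ^+ 2 * rdot x x.
Proof.
move=> kN; cbv zeta; case: k kN => [|k] kN; set x := (_ - _) *m v.
  (* The first increment is orthogonal to the kernel of the first window. *)
  have -> : kerp (Hw 0) *m x = 0.
    rewrite /x mulmxA /G /H0 muln0 addn0 -[Hloc _ _ _ _ _]/(Hw 0) mulmxBr mulmx1.
    by rewrite kerp_idem ?subrr ?mul0mx.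
  by rewrite rdot0r mulr_ge0 ?sqr_ge0 ?rdot_ge0.
set e := (e0 + 3 * k)%N; set b := (e + 3)%N.
have eb : (e0 + 3 * k.+1 = b)%N by rewrite /b /e; clear; lia.
have [e8' bL e6 ws] : [/\ (8 <= e)%N, (b <= L)%N, (e - 6 + 9 = b)%N & win_start k.+1 = (e - 6)%N].
  by rewrite /= /b /e; move: e8 LN kN; clear; split; lia.
set y := kerp (Hw k.+1) *m x.
have [l1 l2 l3 l4 l5] : [/\ (0 + e <= L)%N, (3 <= e)%N, (e - 6 + 9 <= L)%N, (0 + b <= L)%N & (3 <= b)%N].
  by move: e8' bL; rewrite /b; clear; split; lia.
have gx : G k.+1 *m x = x by rewrite /x mulmxA mulmxBr !GG.
have gy : kerp (Hw k.+1) *m y = y by rewrite /y mulmxA kerp_idem.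
have hx : Hloc kappa lam L 0 e *m x = 0 by exact: (kerp_ker (hH0 k) gx).
have hy : Hloc kappa lam L (e - 6) 9 *m y = 0 by rewrite -ws; exact: (kerp_ker (hHw k.+1) gy).
have kx : ker_state lam 0 e (amp x).
  exact: (proj1 (@ker_stateE R lam L kappa kappa_gt0 0 e x l1 L0 l2) hx).
have ky : ker_state lam (e - 6) b (amp y).
  have := proj1 (@ker_stateE R lam L kappa kappa_gt0 (e - 6) 9 y l3 L0 isT) hy.
  by rewrite e6.
have orth (phi : {set 'I_L} -> C) : ker_state lam 0 b phi ->
    \sum_S Num.conj (phi S) * amp x S = 0.
  move=> kp; have hw : Hloc kappa lam L 0 b *m mkv phi = 0.
    apply: (proj2 (@ker_stateE R lam L kappa kappa_gt0 0 b (mkv phi) l4 L0 l5)).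
    by rewrite add0n (_ : amp (mkv phi) = phi) //; apply: funext => S; rewrite amp_mkv.
  have e1 : kerp (H0 k.+1) *m mkv phi = mkv phi.
    by apply: kerp_id => //; rewrite /H0 eb.
  have : dot (mkv phi) x = 0.
    rewrite -e1 dot_adj (herm_kerp (hH0 _)) -[kerp _]/(G k.+2) /x mulmxA mulmxBr.
    by rewrite GGl // GG // subrr mul0mx /dot mulmx0 mxE.
  by rewrite dot_amp => h0; rewrite -[RHS]h0; apply: eq_bigr => S _; rewrite amp_mkv.
have key : 2 * \sum_S complex.Re (Num.conj (amp y S) * amp x S) <=
   \sum_S sqmod (amp y S) + f (sqmod lam) * \sum_S sqmod (amp x S).
  case: (eqVneq lam 0) => l0.
    by apply: (@overlap_lam0 R lam L b e) => //; exact: f_ge0.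
  by apply: (@overlap_bound R lam L b e) => //; [exact: f_ge0 | exact: fbeta_le_f].
rewrite -!rdot_sqmod -rdot_amp in key.
(* As [y] is the projection of [x], the linear bound [key] turns into |y|^2 <= f |x|^2. *)
have e2 : rdot y x = rdot y y.
  by rewrite /y rdot_herm ?(rdot_proj (herm_kerp _)) //; [exact: kerp_idem | exact: herm_kerp].
rewrite e2 in key.
apply: le_trans (_ : f (sqmod lam) * rdot x x <= _); first lra.
by apply: ler_wpM2r => //; exact: rdot_ge0.
Qed.

Let sum_Hw v : \sum_(0 <= k < N.+1) rdot v (Hw k *m v) <= 3 * rdot v (Hopen kappa lam L *m v).
Proof.
have LE : (e0 + 3 * N = L)%N by [].
rewrite HopenE -/(Hsum kappa lam L _ _ _ _) rdot_Hsum.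
under [leLHS]eq_bigr do rewrite -/(Hsum kappa lam L _ _ _ _) rdot_Hsum.
rewrite big_split /= -mulr_sumr mulrDr mulrCA.
have cnt d x : (2 <= d <= 3)%N ->
   (\sum_(0 <= k < N.+1) ((win_start k <= x < win_start k + (win_len k - d))%N : nat) <= 3)%N.
  (* A later window k meets the condition only if x + 3 - e0 <= 3 k, as [d] is at least 2; rounding
     up the quotient by 3 gives this first index. *)
  move=> d2; apply: (@count_window _ ((x + 5 - e0) %/ 3)) => k.
  by case: k => [|k] /=; move: e8 d2; clear; lia.
apply: lerD.
  apply: (@sum_cover (fun x => rdot v (nn R L x *m v)) win_start
     (fun k => win_start k + (win_len k - 2))%N).
  - by move=> x; exact: rdot_nn_ge0.
  - move=> k kN; have := win_end k; move: kN LE e8; case: k => [|k] /=; clear; lia.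
  by move=> x; exact: cnt.
rewrite ler_pM2l //.
apply: (@sum_cover (fun x => rdot v (qq lam L x *m v)) win_start
     (fun k => win_start k + (win_len k - 3))%N).
- by move=> x; exact: rdot_qq_ge0.
- move=> k kN; have := win_end k; move: kN LE e8; case: k => [|k] /=; clear; lia.
by move=> x; exact: cnt.
Qed.

Lemma gap_Hopen_chain : m0 / 3 * (1 - eps * s) ^+ 2 <= gap (Hopen kappa lam L).
Proof.
apply: gapge_le_gap.
- exact: (herm_Hloc kappa lam 0 L L0).
- rewrite HopenE; apply: (@Hsum_neq0 R kappa lam kappa_gt0 L); rewrite LN; move: e8; clear; lia.
move=> v hv.
have Gv : G N.+1 *m v = 0.
  by rewrite /G /H0 -LN; apply/orthkerE => //; exact: herm_Hloc.
have := @martingale_bound R (fdim L) N.+1 Hw (fun k => kerp (Hw k)) G m0 eps s.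
move=> /(_ (fun k _ => hG k) (fun j k h => @GG j k (andP h).1) erefl
   (fun k _ => herm_kerp (hHw k)) (fun k _ => kerp_idem (hHw k))
   (fun k m h => @gG k m (andP h).1) gGC overlap hform hm0 s0 s2 eps0 es v Gv) h1.
have h2 := le_trans h1 (sum_Hw v).
have -> : m0 / 3 * (1 - eps * s) ^+ 2 * rdot v v = m0 * (1 - eps * s) ^+ 2 * rdot v v / 3 by field.
by rewrite ler_pdivrMr // [leRHS]mulrC; exact: h2.
Qed.

End Chain.
End OpenChain.

(** * Choice of parameters and the limit inferior *)

Section FinalBounds.
Variables (R : realType) (kappa : R) (lam : R[i]).
Hypothesis kappa_gt0 : 0 < kappa.

Lemma small_eps (x eta s : R) : 0 <= x -> 0 < eta -> 0 < s ->
  exists eps, [/\ 0 < eps, eps * s < 1 & x * (2 * (eps * s)) <= eta].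
Proof.
move=> x0 eta0 s0; pose c := 2 * (x + 1) * (1 + eta).
have c0 : 0 < c by rewrite /c !mulr_gt0 //; lra.
have q1 : 0 <= x * eta by rewrite mulr_ge0 // ltW.
have q2 : 0 <= x * eta * eta by rewrite mulr_ge0 // ltW.
have q3 : 0 <= eta * eta by rewrite mulr_ge0 // ltW.
exists (eta / c / s); rewrite divfK ?gt_eqF //; split.
- by rewrite !divr_gt0.
- by rewrite ltr_pdivrMr // mul1r /c; lra.
by rewrite !mulrA ler_pdivrMr // /c; lra.
Qed.

Lemma gap_Hopen_ge (L : nat) (m0 : R) : (8 <= L)%N -> 0 <= m0 ->
  m0 <= gap (Hopen kappa lam 8) -> m0 <= gap (Hopen kappa lam 9) ->
  m0 <= gap (Hopen kappa lam 10) -> f (sqmod lam) < 1 / 3 ->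
  m0 / 3 * (1 - Num.sqrt (3 * f (sqmod lam))) ^+ 2 <= gap (Hopen kappa lam L).
Proof.
move=> L8 m00 h8 h9 h10; have := f_ge0 lam; set F := f (sqmod lam) => F0 F1.
pose s : R := Num.sqrt 3.
have s2 : s ^+ 2 = 3 by rewrite sqr_sqrtr.
have s0 : 0 < s by rewrite sqrtr_gt0.
have bound eps : 0 < eps -> F <= eps ^+ 2 -> eps * s < 1 ->
    m0 / 3 * (1 - eps * s) ^+ 2 <= gap (Hopen kappa lam L).
  move=> eps0 hF es.
  (* The residue of L - 8 modulo 3 selects a first window of 8, 9 or 10 sites. *)
  apply: (@gap_Hopen_chain R kappa lam kappa_gt0 L (8 + (L - 8) %% 3)%N ((L - 8) %/ 3)%N m0 eps s) => //.
    by clear; lia.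
  by move: L8; clear; lia.
(* The martingale bound asks for eps > 0, so for F = 0 the claim is a limit over small eps instead
   of the choice eps = sqrt F. *)
have [F0'|F0'] := eqVneq F 0.
  rewrite F0' mulr0 sqrtr0 subr0 expr1n mulr1.
  apply/ler_addgt0Pr => eta eta0.
  have m3 : 0 <= m0 / 3 by rewrite divr_ge0.
  have [eps [eps0 es h3]] := small_eps m3 eta0 s0.
  have hF : F <= eps ^+ 2 by rewrite F0' sqr_ge0.
  have h := bound eps eps0 hF es.
  have h2 : 0 <= m0 / 3 * (eps * s) ^+ 2 by rewrite mulr_ge0 ?sqr_ge0.
  by move: h h2 h3; move: (m0 / 3) (eps * s) (gap _) => x y z; lra.
have Fp : 0 < F by rewrite lt_neqAle eq_sym F0'.
have -> : Num.sqrt (3 * F) = Num.sqrt F * s by rewrite sqrtrM // mulrC.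
apply: bound; rewrite ?sqrtr_gt0 // ?sqr_sqrtr //.
have -> : Num.sqrt F * s = Num.sqrt (3 * F) by rewrite sqrtrM // mulrC.
rewrite -[X in _ < X](sqrtr1 R) ltr_sqrt //; lra.
Qed.

Lemma opnorm_Hopen_ge0 l : (0 < l)%N -> 0 <= opnorm (Hopen kappa lam l).
Proof.
move=> l0; have hh : herm (Hopen kappa lam l) by rewrite HopenE; exact: herm_Hloc.
have pp : psd (Hopen kappa lam l) by rewrite HopenE; apply: psd_Hloc.
have [U [d [_ _ _ he]]] := eigenbasis hh.
(* Any index provides an eigenvalue; the empty configuration shows that there is one. *)
have e := he (enum_rank (finset (fun _ : 'I_l => false))).
exact: le_trans (psd_eig pp e) (eig_le_opnorm hh pp e).
Qed.

Lemma limn_einf_ge (u : nat -> R) (c : R) :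
  (forall c' : R, c' < c -> exists N : nat, forall n, (N <= n)%N -> c' <= u n) ->
  (c%:E <= limn_einf (fun n => (u n)%:E))%E.
Proof.
move=> h; rewrite limn_einf_lim.
have -> := cvg_lim (@ereal_hausdorff R) (@cvg_einfs_sup R (fun n => (u n)%:E)).
apply/lee_addgt0Pr => eta eta0.
have hlt : c - eta < c by rewrite ltrBlDr ltrDl.
have [N hN] := h _ hlt.
have -> : c%:E = ((c - eta)%:E + eta%:E)%E by rewrite -EFinD subrK.
apply: leeD => //.
apply: (@le_trans _ _ (einfs (fun n => (u n)%:E) N)); last by apply: ereal_sup_ubound; exists N.
by apply: le_ereal_inf_tmp => _ [k /= kN <-]; rewrite lee_fin; exact: hN.
Qed.

Lemma gap_Hper_ge0 L : (0 < L)%N -> 0 <= gap (Hper kappa lam L).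
Proof. by move=> L0; apply: gap_ge0; rewrite HperE; exact: (psd_Hsum lam L0). Qed.

Let gamma := Num.min (gap (Hopen kappa lam 6)) (gap (Hopen kappa lam 7)).
Let Gamma := Num.max (opnorm (Hopen kappa lam 6)) (opnorm (Hopen kappa lam 7)).

Lemma min_gap_ge0 : 0 <= gamma.
Proof. by rewrite /gamma le_min !gap_Hopen_ge0. Qed.

Lemma max_norm_ge0 : 0 <= Gamma.
Proof. by rewrite /Gamma le_max opnorm_Hopen_ge0. Qed.

Lemma gap_Hper_criterion (n N r : nat) (g : R) : (2 <= n)%N -> (n < N)%N -> (r <= 5)%N ->
  (forall j, (j <= 5)%N -> g <= gap (Hopen kappa lam (3 * n.+1 + j))) -> Gamma / n%:R < g ->
  gamma * n%:R / (2 * Gamma * (n%:R - 1)) * (g - Gamma / n%:R) <= gap (Hper kappa lam (6 * N + r)).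
Proof.
move=> n2 nN r5 hg hgn.
have L0 : (0 < 6 * N + r)%N by move: nN; clear; lia.
have G0 := max_norm_ge0; have gam0 := min_gap_ge0.
have g0 : 0 <= g by apply: ltW; apply: le_lt_trans hgn; rewrite divr_ge0.
(* Division by zero yields zero, so for Gamma = 0 the claimed bound is just nonnegativity of the
   gap. *)
case: (eqVneq Gamma 0) => [GE|GE].
  by rewrite GE !(mulr0, mul0r, invr0); exact: gap_Hper_ge0.
have Gp : 0 < Gamma by rewrite lt_neqAle eq_sym GE.
have [a6 a7] : gamma <= gap (Hopen kappa lam 6) /\ gamma <= gap (Hopen kappa lam 7).
  by rewrite /gamma; split; rewrite ge_min lexx ?orbT.
have [b6 b7] : opnorm (Hopen kappa lam 6) <= Gamma /\ opnorm (Hopen kappa lam 7) <= Gamma.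
  by rewrite /Gamma; split; rewrite le_max lexx ?orbT.
exact: (@gap_Hper_ge R kappa lam kappa_gt0 n N r gamma Gamma g).
Qed.

Lemma mul_inv_regroup (a b m t : R) :
  a * m / (2 * b * (m - 1)) * t = m / (m - 1) * (a / (2 * b) * t).
Proof.
have E (p q : R) : a * m * (p * q) * t = m * q * (a * p * t) by ring.
have -> : (2 * b * (m - 1))^-1 = (2 * b)^-1 * (m - 1)^-1 by exact: invfM.
exact: E.
Qed.

(** The open bound X does not depend on the length, so it serves as [g] for every n. With K = gamma
    / (2 Gamma) the criterion gives n / (n - 1) K (X - Gamma / n), which is at least K X up to an
    error that vanishes for large n. *)
Lemma liminf_gap_Hper (m0 : R) : 0 <= m0 ->
  m0 <= gap (Hopen kappa lam 8) -> m0 <= gap (Hopen kappa lam 9) ->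
  m0 <= gap (Hopen kappa lam 10) -> f (sqmod lam) < 1 / 3 ->
  ((gamma / (6 * Gamma) * m0 * (1 - Num.sqrt (3 * f (sqmod lam))) ^+ 2)%:E
    <= limn_einf (fun L => (gap (Hper kappa lam L))%:E))%E.
Proof.
move=> m00 h8 h9 h10 hf; apply: limn_einf_ge => c' hc'.
case: (leP c' 0) => c0.
  by exists 1%N => L L0; apply: le_trans c0 _; exact: gap_Hper_ge0.
have G0 := max_norm_ge0; have gam0 := min_gap_ge0.
pose X := m0 / 3 * (1 - Num.sqrt (3 * f (sqmod lam))) ^+ 2.
have X0 : 0 <= X by rewrite mulr_ge0 ?sqr_ge0 ?divr_ge0.
have gX L : (8 <= L)%N -> X <= gap (Hopen kappa lam L).
  by move=> L8; apply: gap_Hopen_ge.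
pose K := gamma / (2 * Gamma).
have K0 : 0 <= K by rewrite divr_ge0 // mulr_ge0.
have GE : Gamma != 0.
  apply/eqP => e; move: hc'; rewrite e mulr0 invr0 mulr0 !mul0r => hc'.
  by have := lt_trans c0 hc'; rewrite ltxx.
have Gp : 0 < Gamma by rewrite lt_neqAle eq_sym GE.
have cE : gamma / (6 * Gamma) * m0 * (1 - Num.sqrt (3 * f (sqmod lam))) ^+ 2 = K * X.
  by rewrite /K /X; field; rewrite GE.
rewrite cE in hc'; pose delta := K * X - c'.
have d0 : 0 < delta by rewrite subr_gt0.
have KG0 : 0 <= K * Gamma / delta by apply: divr_ge0; [exact: mulr_ge0 | exact: ltW].
(* This n makes K Gamma / n at most [delta], the room between c' and K X. *)
have [n n2 nb] : exists2 n : nat, (2 <= n)%N & K * Gamma / delta < n%:R.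
  exists (Num.bound (K * Gamma / delta)).+2 => //.
  by apply: lt_le_trans (archi_boundP KG0) _; rewrite ler_nat; exact: leqW (leqnSn _).
have n0 : 0 < n%:R :> R by rewrite ltr0n; exact: ltnW.
have n1 : 0 < n%:R - 1 :> R by rewrite subr_gt0 ltr1n.
have hKn : c' <= K * (X - Gamma / n%:R).
  rewrite ltr_pdivrMr // in nb.
  have : K * (Gamma / n%:R) <= delta by rewrite mulrA ler_pdivrMr // [leRHS]mulrC; exact: ltW.
  by rewrite /delta mulrBr; lra.
have hX : 0 < X - Gamma / n%:R.
  by rewrite ltNge; apply/negP => h; have := le_trans hKn (mulr_ge0_le0 K0 h); rewrite leNgt c0.
(* From this length on the quotient by 6 exceeds n, as the criterion requires. *)
exists (6 * n.+1)%N => L hL.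
have [N [r [nN r5 ->]]] : exists N r, [/\ (n < N)%N, (r <= 5)%N & L = (6 * N + r)%N].
  exists (L %/ 6)%N, (L %% 6)%N; move: hL; generalize n => k; clear => hk.
  by split; lia.
have hg j : (j <= 5)%N -> X <= gap (Hopen kappa lam (3 * n.+1 + j)).
  by move=> _; apply: gX; move: n2; clear; lia.
have hGX : Gamma / n%:R < X by rewrite -subr_gt0.
apply: (le_trans _ (gap_Hper_criterion n2 nN r5 hg hGX)).
apply: (le_trans hKn).
have -> : gamma * n%:R / (2 * Gamma * (n%:R - 1)) * (X - Gamma / n%:R) =
   n%:R / (n%:R - 1) * (K * (X - Gamma / n%:R)).
  by rewrite /K mul_inv_regroup.
have h1 : 1 <= n%:R / (n%:R - 1) :> R by rewrite ler_pdivlMr // mul1r lerBlDr lerDl ler01.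
exact: (ler_peMl (mulr_ge0 K0 (ltW hX)) h1).
Qed.

End FinalBounds.

Unset Implicit Arguments.
Local Open Scope classical_set_scope.

Theorem theorem1p2 (R : realType) (kappa : R) (lam : R[i]) (hkappa : 0 < kappa) :
  let gamma := Num.min (gap (Hopen kappa lam 6)) (gap (Hopen kappa lam 7)) in
  let Gamma := Num.max (opnorm (Hopen kappa lam 6)) (opnorm (Hopen kappa lam 7)) in
  (forall n : nat, (2 <= n)%N ->
     let gn := inf [set gap (Hopen kappa lam (3 * n.+1 + r)) | r in [set r : nat | (r <= 5)%N]] in
     gn > Gamma / n%:R ->
     forall N r : nat, (n < N)%N -> (r <= 5)%N ->
       gap (Hper kappa lam (6 * N + r))
         >= gamma * n%:R / (2 * Gamma * (n%:R - 1)) * (gn - Gamma / n%:R)) /\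
  (f ((complex.Re lam) ^+ 2 + (complex.Im lam) ^+ 2) < 1 / 3 ->
     (limn_einf (fun L : nat => (gap (Hper kappa lam L))%:E)
       >= (gamma / (6 * Gamma)
           * Num.min (gap (Hopen kappa lam 8))
               (Num.min (gap (Hopen kappa lam 9)) (gap (Hopen kappa lam 10)))
           * (1 - Num.sqrt (3 * f ((complex.Re lam) ^+ 2 + (complex.Im lam) ^+ 2))) ^+ 2)%:E)%E).
Proof.
move=> gamma Gamma; split.
  move=> n n2 gn hgn N r nN r5; apply: gap_Hper_criterion => // j j5.
  apply: ge_inf; last by exists j.
  exists 0 => _ [k _ <-]; apply: gap_Hopen_ge0 => //; move: (n); clear; lia.
move=> hf; apply: liminf_gap_Hper => //; rewrite ?le_min ?gap_Hopen_ge0 //.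
- by rewrite ge_min lexx.
- by rewrite !ge_min lexx !orbT.
by rewrite !ge_min lexx !orbT.
Qed.
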